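(* Let $d\ge2$, $\alpha\in(0,2)$ and let $\nu$ be the L\'evy measure on $\mathbb{R}^d$ with spectral measure $\mu$. If $\nu$ is a $\gamma$-measure on the unit sphere, then for every multiindex $\beta\in\mathbb{N}_0^d$ there exists a constant $c=c(\beta)$ such that $$|D^\beta p_1(y)|\le c\,(1+|y|)^{-\alpha-\gamma},\qquad y\in\mathbb{R}^d,$$ where $p_1$ is the density at time $1$ of the stable semigroup generated by $\nu$ and $D^0=\mathrm{Id}$.
   Context: Setting. $d\ge2$ is an integer, $\alpha\in(0,2)$, $B(x,r)$ is the open Euclidean ball, $\mathbb{S}=\{x\in\mathbb{R}^d:|x|=1\}$. The spectral measure $\mu$ is a finite positive Borel measure on $\mathbb{S}$ that is symmetric ($\mu(D)=\mu(-D)$) and nondegenerate (its support is not contained in a proper linear subspace of $\mathbb{R}^d$; in particular $\mu\ne0$). The L\'evy measure is $\nu(D)=\int_{\mathbb{S}}\int_0^\infty \mathbf{1}_D(r\xi)\,r^{-1-\alpha}\,dr\,\mu(d\xi)$. We say that $\nu$ is a $\gamma$-measure on $\mathbb{S}$ if there is a constant $c$ with $\nu(B(x,r))\le c r^\gamma$ for all $|x|=1$, $0<r<1/2$ (necessarily $\gamma\le d$). $\{P_t,t>0\}$ is the convolution semigroup of symmetric $\alpha$-stable probability measures on $\mathbb{R}^d$ with $\int e^{iu\cdot y}P_t(dy)=\exp(-t\Phi(u))$, $\Phi(u)=\int(1-\cos(u\cdot y))\,\nu(dy)$; $P_t$ has a smooth bounded density $p_t$. Convention on constants: constants $c$ depend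 only on $\mu,\gamma,d,\alpha$, and additionally on the quantities explicitly indicated. *)

(* Defs.v *)
From HB Require Import structures.
From mathcomp Require Import all_boot all_order all_algebra.
From mathcomp Require Import all_classical all_reals all_analysis.
From mathcomp Require Import measurable_realfun complex.
Set Implicit Arguments.
Unset Strict Implicit.
Unset Printing Implicit Defensive.
Import Order.TTheory GRing.Theory Num.Theory.
Import numFieldNormedType.Exports.
Local Open Scope classical_set_scope.
Local Open Scope ring_scope.

(* The library leaves matrices without a sigma-algebra; they get the Borel one. *)
HB.instance Definition _ (R : realType) (m n : nat) :=
  Measurable.copy 'M[R]_(m, n) (g_sigma_algebraType (open : set (set 'M[R]_(m, n)))).

Section borel_matrix.
Context (R : realType) (m n : nat).

Lemma measurable_coord (i : 'I_m) (j : 'I_n) :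
  measurable_fun [set: 'M[R]_(m, n)] (fun M : 'M[R]_(m, n) => M i j).
Proof.
apply: (measurability _ (RGenOpens.measurableE R)) => _ [_ [a [b ->] <-]].
rewrite setTI; apply: sub_sigma_algebra => /=.
by apply: open_comp; [move=> x _; exact: coord_continuous|exact: interval_open].
Qed.

Lemma measurable_fun_mx d (T : measurableType d) (f : T -> 'M[R]_(m, n)) :
  (forall i j, measurable_fun setT (fun x => f x i j)) -> measurable_fun setT f.
Proof.
move=> mf.
apply: (@measurability _ _ _ _ setT f open) => // _ [U oU <-].
rewrite setTI.
pose box (qk : 'M[rat]_(m, n) * nat) :=
  ball (map_mx ratr qk.1 : 'M[R]_(m, n)) (qk.2.+1%:R^-1 : R).
have -> : U = \bigcup_qk (if asbool (box qk `<=` U) then box qk else set0).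
  apply/seteqP; split => [x Ux|x [qk _]]; last by case: asboolP => // + ?; apply.
  have /nbhs_ballP[e /= e0 eU] : nbhs x U by exact: open_nbhs_nbhs.
  have [k ke] : exists k, k.+1%:R^-1 < e / 2 :> R.
    have e20 : 0 < e / 2 by rewrite divr_gt0.
    by exists (Num.truncn (e / 2)^-1); rewrite invf_plt ?posrE// truncnS_gt.
  have k0 : (0 : R) < k.+1%:R^-1 by rewrite invr_gt0.
  have q_ i j : exists q : rat, `|x i j - ratr q| < k.+1%:R^-1 :> R.
    have /rat_in_itvoo[q /itvP qx] : x i j - k.+1%:R^-1 < x i j + k.+1%:R^-1.
      by rewrite ltrBlDr -addrA ltrDl addr_gt0.
    by exists q; rewrite distrC ltr_distl !qx.
  pose q := \matrix_(i, j) sval (cid (q_ i j)).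
  exists (q, k) => //.
  have qx : ball (map_mx ratr q : 'M[R]_(m, n)) (k.+1%:R^-1 : R) x.
    by split=> // i j; rewrite !mxE /ball/= distrC; exact: svalP (cid (q_ i j)).
  case: asboolP => // -[] y qy; apply: eU.
  have := ball_triangle (ball_sym qx) qy; apply: le_ball.
  by rewrite [leRHS]splitr; exact: (lerD (ltW ke) (ltW ke)).
rewrite preimage_bigcup; apply: countable_bigcupT_measurable.
  exact: countableP.
move=> qk; case: asboolP => // _; last by rewrite preimage_set0.
have -> : f @^-1` box qk = \bigcap_i \bigcap_j
    [set x | ball (ratr (qk.1 i j) : R) (qk.2.+1%:R^-1 : R) (f x i j)].
  apply/seteqP; split => [x [_ h] i _ j _|x h].
    by have := h i j; rewrite mxE.
  by split=> [|i j]; [rewrite invr_gt0|rewrite mxE; exact: h].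
apply: fin_bigcap_measurable => // i _; apply: fin_bigcap_measurable => // j _.
rewrite -[X in measurable X]setTI.
exact: (mf i j measurableT _ (open_measurable (ball_open _ _))).
Qed.

End borel_matrix.

Section lebesgue_measure_rV.
Context (R : realType).
Local Open Scope ereal_scope.

Definition rV_cons n (z : measurableTypeR R * 'rV[R]_n) : 'rV[R]_n.+1 :=
  @row_mx R 1 1 n (const_mx z.1) z.2.

Lemma measurable_rV_cons n : measurable_fun setT (@rV_cons n).
Proof.
apply: measurable_fun_mx => i j.
have [k ->|k ->] := split_ordP (j : 'I_(1 + n)).
  rewrite (_ : (fun _ => _) = fst)//; apply/funext => z.
  by rewrite [LHS](@row_mxEl R 1 1 n) mxE.
rewrite (_ : (fun _ => _) = (fun M : 'rV[R]_n => M i k) \o snd); last first.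
  by apply/funext => z; exact: (@row_mxEr R 1 1 n).
by apply: measurableT_comp => //; exact: measurable_coord.
Qed.

Definition rV_uncons n (v : 'rV[R]_n.+1) : measurableTypeR R * 'rV[R]_n :=
  (v ord0 ord0, rsubmx (v : 'rV_(1 + n))).

Lemma rV_consK n : cancel (@rV_cons n) (@rV_uncons n).
Proof.
move=> [x v]; rewrite /rV_uncons /rV_cons row_mxKr; congr pair.
have -> : ord0 = lshift n (ord0 : 'I_1) :> 'I_(1 + n) by exact/val_inj.
by rewrite [LHS](@row_mxEl R 1 1 n) mxE.
Qed.

Lemma measurable_rV_uncons n : measurable_fun setT (@rV_uncons n).
Proof.
apply: measurable_fun_pair; first exact: measurable_coord.
apply: measurable_fun_mx => i j.
by under eq_fun do rewrite mxE; exact: measurable_coord.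
Qed.

Section step.
Context (n : nat) (m : {sigma_finite_measure set 'rV[R]_n -> \bar R}).

Definition lebesgue_rV_succ : set 'rV[R]_n.+1 -> \bar R :=
  pushforward (lebesgue_measure \x m) (@rV_cons n).

Let mf := @measurable_rV_cons n.

Let lebesgue_rV_succ0 : lebesgue_rV_succ set0 = 0.
Proof. exact: measure0. Qed.

Let lebesgue_rV_succ_ge0 A : 0 <= lebesgue_rV_succ A.
Proof. exact: measure_ge0. Qed.

Let lebesgue_rV_succ_sigma_additive : semi_sigma_additive lebesgue_rV_succ.
Proof. exact: measure_semi_sigma_additive. Qed.

HB.instance Definition _ := isMeasure.Build _ _ _ lebesgue_rV_succ
  lebesgue_rV_succ0 lebesgue_rV_succ_ge0 lebesgue_rV_succ_sigma_additive.

Let lebesgue_rV_succ_sigma_finite : sigma_finite setT lebesgue_rV_succ.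
Proof.
have /sigma_finiteP[F [FT ndF Foo]] := sigma_finiteT (@lebesgue_measure R).
have /sigma_finiteP[G [GT ndG Goo]] := sigma_finiteT m.
exists (fun k => @rV_uncons n @^-1` (F k `*` G k)).
  rewrite -preimage_bigcup; apply/seteqP; split => // v _ /=.
  have [i _ Fi] : (\bigcup_i F i) (rV_uncons v).1 by rewrite -FT.
  have [j _ Gj] : (\bigcup_i G i) (rV_uncons v).2 by rewrite -GT.
  exists (maxn i j) => //; split.
    by move: Fi; exact/subsetPset/ndF/leq_maxl.
  by move: Gj; exact/subsetPset/ndG/leq_maxr.
move=> k; have [mF Fk] := Foo k; have [mG Gk] := Goo k; split.
  rewrite -[X in measurable X]setTI.
  by apply: measurable_rV_uncons => //; exact: measurableX.
rewrite /lebesgue_rV_succ /pushforward -comp_preimage.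
rewrite (_ : _ \o _ = id) ?preimage_id; last first.
  by apply/funext => z; exact: rV_consK.
by rewrite product_measure1E// lte_mul_pinfty// ge0_fin_numE.
Qed.

HB.instance Definition _ := Measure_isSigmaFinite.Build _ _ _ lebesgue_rV_succ
  lebesgue_rV_succ_sigma_finite.

End step.

(* The (n+1)-fold product measure is transported along R * R^n ~ R^(n+1); see
   [lebesgue_measure_rV_box] for its value on boxes. *)
Fixpoint lebesgue_measure_rV n : {sigma_finite_measure set 'rV[R]_n -> \bar R} :=
  match n with
  | 0 => \d_(0%R : 'rV[R]_0)
  | n.+1 => lebesgue_rV_succ (lebesgue_measure_rV n)
  end.

Lemma measurable_rV_box n (a b : 'rV[R]_n) :
  measurable [set x : 'rV[R]_n | forall i, a ord0 i <= x ord0 i <= b ord0 i]%R.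
Proof.
rewrite [X in measurable X](_ : _ = \bigcap_i
    [set x : 'rV[R]_n | x ord0 i \in `[a ord0 i, b ord0 i]]%R); last first.
  apply/seteqP; split=> [x xab i _|x xab i]; first by rewrite /= in_itv/= xab.
  by have := xab i I; rewrite /= in_itv.
apply: fin_bigcap_measurable => // i _; rewrite -[X in measurable X]setTI.
exact: (@measurable_coord R 1 n ord0 i measurableT _ (measurable_itv _)).
Qed.

Lemma lebesgue_measure_rV_box n (a b : 'rV[R]_n) :
  (forall i, a ord0 i <= b ord0 i)%R ->
  lebesgue_measure_rV n [set x | forall i, a ord0 i <= x ord0 i <= b ord0 i]%R =
  (\prod_i (b ord0 i - a ord0 i))%:E.
Proof.
elim: n a b => [|n IHn] a b ab.
  by rewrite big_ord0 /= diracE mem_set// => -[].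
have ab' i : (rsubmx (a : 'rV_(1 + n)) ord0 i <= rsubmx (b : 'rV_(1 + n)) ord0 i)%R.
  by rewrite !mxE.
rewrite big_ord_recl EFinM.
rewrite (_ : (\prod_i _)%R = \prod_i (rsubmx (b : 'rV_(1 + n)) ord0 i -
    rsubmx (a : 'rV_(1 + n)) ord0 i))%R; last first.
  apply: eq_bigr => i _; rewrite !mxE.
  by congr (b _ _ - a _ _)%R; exact/val_inj.
rewrite -(IHn _ _ ab') /=.
have -> : (b ord0 ord0 - a ord0 ord0)%:E =
    lebesgue_measure (`[a ord0 ord0, b ord0 ord0]%classic : set R).
  rewrite lebesgue_measure_itv/= lte_fin.
  by case: ltgtP (ab ord0) => // -> _; rewrite subrr.
rewrite /lebesgue_rV_succ /pushforward -product_measure1E//; last first.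
  exact: measurable_rV_box.
congr (_ _); apply/seteqP; split => -[x v] /=.
  move=> xv; split.
    have := xv ord0; rewrite in_itv/=.
    have -> : ord0 = lshift n (ord0 : 'I_1) :> 'I_(1 + n) by exact/val_inj.
    by rewrite [X in (_ <= X <= _)%R](@row_mxEl R 1 1 n) mxE.
  move=> i; have := xv (rshift 1 i).
  by rewrite [X in (_ <= X <= _)%R -> _](@row_mxEr R 1 1 n) !mxE.
move=> [+ vB] i; rewrite in_itv/= => xab.
have [k ->|k ->] := split_ordP (i : 'I_(1 + n)).
  rewrite [X in (_ <= X <= _)%R](@row_mxEl R 1 1 n) mxE.
  have -> // : lshift n k = ord0 :> 'I_n.+1.
  by apply/val_inj => /=; case: k => -[].
rewrite [X in (_ <= X <= _)%R](@row_mxEr R 1 1 n).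
by have := vB k; rewrite !mxE.
Qed.

End lebesgue_measure_rV.

Section euclidean.
Context (R : realType) (d : nat).
Implicit Types x y u : 'rV[R]_d.

Definition dotv u y : R := \sum_i u ord0 i * y ord0 i.

(* The library norm on ['rV[R]_d] is the sup norm. *)
Definition enorm x : R := Num.sqrt (dotv x x).

Definition eball x (r : R) : set 'rV[R]_d := [set y | enorm (y - x) < r].

Definition esphere : set 'rV[R]_d := [set x | enorm x = 1].

Lemma measurable_enorm : measurable_fun setT enorm.
Proof.
apply: (@measurableT_comp _ _ _ _ _ _ (@Num.sqrt R) _ (fun x => dotv x x)).
  by apply: continuous_measurable_fun; exact: sqrt_continuous.
by apply: measurable_sum => i; apply: measurable_funM; exact: measurable_coord.
Qed.

Lemma measurable_esphere : measurable esphere.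
Proof.
rewrite [X in measurable X](_ : _ = setT `&` enorm @^-1` [set 1]).
  by apply: measurable_enorm.
by apply/seteqP; split => x //= -[].
Qed.

End euclidean.

Section levy_measure.
Context (R : realType) (d : nat) (alpha : R).
Variable mu : {finite_measure set 'rV[R]_d -> \bar R}.
Local Open Scope ereal_scope.

Definition levy_measure (D : set 'rV[R]_d) : \bar R :=
  \int[mu]_(xi in @esphere R d) \int[lebesgue_measure]_(r in `]0%R, +oo[)
    (\1_D (r *: xi)%R * r `^ (- 1 - alpha))%:E.

Let h D (z : 'rV[R]_d * measurableTypeR R) : \bar R :=
  ((fun r : R => (\1_D (r *: z.1)%R * r `^ (- 1 - alpha))%:E) \_ `]0%R, +oo[) z.2.

Let h_ge0 D z : 0 <= h D z.
Proof. by apply: erestrict_ge0 => r _; rewrite lee_fin mulr_ge0// powR_ge0. Qed.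

Let measurable_h D : measurable D -> measurable_fun setT (h D).
Proof.
move=> mD.
rewrite (_ : h D = fun z => (\1_D ((z.2 : R) *: z.1)%R *
   (\1_(`]0%R, +oo[%classic : set R) z.2 * (z.2 : R) `^ (- 1 - alpha)))%:E); last first.
  apply/funext => z; rewrite /h patchE [X in _ = (_ * (X * _))%:E]indicE.
  by case: ifPn => _; rewrite ?mul1r// mul0r mulr0.
apply/measurable_EFinP; apply: measurable_funM.
  apply: (@measurableT_comp _ _ _ _ _ _ (\1_D : 'rV[R]_d -> R) _
    (fun z : 'rV[R]_d * measurableTypeR R => ((z.2 : R) *: z.1)%R)).
    exact: measurable_indic.
  apply: measurable_fun_mx => i j; under eq_fun do rewrite mxE.
  apply: measurable_funM; first exact: measurable_snd.
  exact: (measurableT_comp (@measurable_coord R 1 d i j) measurable_fst).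
apply: (@measurableT_comp _ _ _ _ _ _
  (fun r : R => \1_(`]0%R, +oo[%classic : set R) r * r `^ (- 1 - alpha))%R _ snd) => //.
apply: measurable_funM; first exact: measurable_indic.
exact: measurable_powR.
Qed.

Let levy_measureE D : levy_measure D =
  \int[mu]_(xi in @esphere R d) fubini_F lebesgue_measure (h D) xi.
Proof. by apply: eq_integral => xi _; rewrite [LHS]integral_mkcond. Qed.

Let measurable_F D : measurable D ->
  measurable_fun (@esphere R d) (fubini_F lebesgue_measure (h D)).
Proof.
move=> mD; apply: measurable_funTS.
by apply: measurable_fun_fubini_tonelli_F => //; exact: measurable_h.
Qed.

Let levy_measure0 : levy_measure set0 = 0.
Proof.
rewrite /levy_measure; apply: integral0_eq => xi _; apply: integral0_eq => r _.
by rewrite indic0 mul0r.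
Qed.

Let levy_measure_ge0 D : 0 <= levy_measure D.
Proof.
apply: integral_ge0 => xi _; apply: integral_ge0 => r _.
by rewrite lee_fin mulr_ge0// powR_ge0.
Qed.

Let levy_measure_sigma_additive : semi_sigma_additive levy_measure.
Proof.
move=> F mF tF mUF.
rewrite [X in _ --> X](_ : _ = \sum_(n <oo) levy_measure (F n)).
  by apply: is_cvg_ereal_nneg_natsum => n _; exact: levy_measure_ge0.
rewrite levy_measureE; under [RHS]eq_eseriesr do rewrite levy_measureE.
rewrite -integral_nneseries//; last 3 first.
- exact: measurable_esphere.
- by move=> n; exact: measurable_F.
- by move=> n xi _; exact: integral_ge0.
apply: eq_integral => xi _; rewrite /fubini_F -integral_nneseries//; last first.
  by move=> n; apply: measurableT_comp; [exact: measurable_h|exact: measurable_pair1].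
apply: eq_integral => r _; rewrite /h /=.
rewrite patchE; case: ifPn => r0; last first.
  by rewrite eseries0// => n _ _; rewrite patchE (negbTE r0).
under eq_eseriesr do rewrite patchE r0 EFinM muleC.
rewrite nneseriesZl//.
by rewrite EFinM muleC indic_bigcup.
Qed.

HB.instance Definition _ := isMeasure.Build _ _ _ levy_measure
  levy_measure0 levy_measure_ge0 levy_measure_sigma_additive.

End levy_measure.

Section definitions.
Context (R : realType) (d : nat).
Local Notation Rd := 'rV[R]_d.

Definition msupport (mu : set Rd -> \bar R) : set Rd :=
  [set x | forall U : set Rd, open U -> U x -> (0 < mu U)%E].

(* A measure on the unit sphere is a Borel measure on R^d not charging the
   complement of the sphere. *)
Definition is_spectral_measure (mu : set Rd -> \bar R) : Prop :=
  [/\ mu (~` @esphere R d) = 0%E,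
      forall D : set Rd, measurable D -> mu D = mu [set - x | x in D] &
      forall V : {vspace Rd}, msupport mu `<=` [set` V] -> V = fullv].

Definition is_gamma_measure (nu : set Rd -> \bar R) (gamma : R) : Prop :=
  exists c : R, forall (x : Rd) (r : R), enorm x = 1 -> 0 < r < 1 / 2 ->
    (nu (eball x r) <= (c * r `^ gamma)%:E)%E.

Definition levy_exponent (nu : {measure set Rd -> \bar R}) (u : Rd) : R :=
  \int[nu]_y (1 - cos (dotv u y)).

(* The integral of [expi (dotv u y)], real and imaginary parts. *)
Definition char_fun (P : {measure set Rd -> \bar R}) (u : Rd) : R[i] :=
  Complex (\int[P]_y cos (dotv u y)) (\int[P]_y sin (dotv u y)).

Definition convolution (P Q : {measure set Rd -> \bar R}) (A : set Rd) : \bar R :=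
  (\int[P]_x Q [set y : Rd | A (x + y)%R])%E.

(* Only the restriction of [P] to positive times matters. *)
Definition is_stable_semigroup (nu : {measure set Rd -> \bar R})
    (P : R -> probability Rd R) : Prop :=
  (forall s t A, 0 < s -> 0 < t -> measurable A ->
     P (s + t) A = convolution (P s) (P t) A) /\
  (forall t u, 0 < t ->
     char_fun (P t) u = (expR (- t * levy_exponent nu u))%:C%C).

Definition is_density (P : set Rd -> \bar R) (p : Rd -> R) : Prop :=
  [/\ measurable_fun setT p, forall x, 0 <= p x &
      forall A, measurable A ->
        P A = (\int[lebesgue_measure_rV R d]_(x in A) (p x)%:E)%E].

Definition partial (i : 'I_d) (f : Rd -> R) : Rd -> R :=
  'D_(delta_mx ord0 i) f.

Definition smooth (f : Rd -> R) : Prop :=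
  forall s : seq 'I_d, let g := foldr partial f s in
    continuous g /\ forall i x, derivable g x (delta_mx ord0 i).

(* [mderiv beta f] = (d/dx_0)^(beta 0) ... (d/dx_(d-1))^(beta (d-1)) f *)
Definition mderiv (beta : 'I_d -> nat) (f : Rd -> R) : Rd -> R :=
  foldr (fun i g => iter (beta i) (partial i) g) f (enum 'I_d).

End definitions.

(* Main.v *)
(* Split [nu] into its restrictions to the open unit ball and to its complement, the finite
   measure [far]. Then the characteristic function of [P 1] is a constant times
   [phi * expR chi], where [phi = expR (- psi)], [psi] is the exponent of the small jumps and
   [chi] is the cosine transform of [far].

   Scaling of [nu] and nondegeneracy give [psi u >= c |u|^alpha] for [|u| >= 1], and [psi] is
   smooth with derivatives of polynomial growth; integrating by parts, the Fourier transform
   of (polynomial * phi) decays faster than any power.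

   Multiplication by [chi] is convolution with [far] on the other side. The gamma-measure
   property rescales to [nu (B(y, r)) <= c |y|^(- alpha - gamma) r^gamma] for [r < |y| / 2],
   and a dyadic decomposition yields [far * w <= K w] for [w y = (1 + |y|)^(- alpha - gamma)].
   Expanding [expR chi] in a power series, a bound by [C w] becomes one by [C e^K w].

   Everything being symmetric, only cosines are needed. The inversion formula is used in the
   form [p1 * \int phi^ = ch^], with [phi] as summability kernel: the value of the constant
   [\int phi^] is irrelevant, only that it is nonzero. *)
Require Import Defs.
From HB Require Import structures.
From mathcomp Require Import all_boot all_order all_algebra.
From mathcomp Require Import all_classical all_reals all_analysis.
From mathcomp Require Import measurable_realfun complex.
From mathcomp Require Import ring lra.
Set Implicit Arguments.
Unset Strict Implicit.
Unset Printing Implicit Defensive.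
Import Order.TTheory GRing.Theory Num.Theory.
Import numFieldNormedType.Exports.
Local Open Scope classical_set_scope.
Local Open Scope ring_scope.

(** * Cosines, Euclidean norm and integration *)

Section trigonometry.
Context (R : realType).
Implicit Types x a b : R.

(** The split is forced by two opposite defects. Moments of [far] of order alpha and more are
    infinite, so [chi] is in general not smooth enough for repeated integration by parts; it is used
    only as an integral of cosines against a finite measure. The small jumps have all moments of
    order two and more, hence a smooth [psi], and they alone already supply the lower bound on the
    exponent. Derivatives in the frequency u are handled as second-order Taylor bounds with explicit
    majorants, so that no differentiability theory in u is involved. Derivatives of the density in y
    only multiply the amplitude by coordinates, while integration by parts brings in moments of the
    small jumps; the class [tame] absorbs both. In the dyadic estimate a ball of radius 2^k carries
    a weight of order 2^(- k (alpha + gamma)) and a mass of order 2^(k gamma). The product has ratio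
    2^(- alpha), so the series converges whatever the sign of gamma. If alpha + gamma <= 0 the
    claimed weight is at least 1 and boundedness of the derivatives is enough. *)

Lemma ge0_of_derive (f f' : R -> R) (M : R) : 0 <= f 0 ->
  (forall x, derivable f x 1) -> (forall x, 'D_1 f x = f' x) ->
  (forall x, 0 <= x <= M -> 0 <= f' x) ->
  forall x, 0 <= x <= M -> 0 <= f x.
Proof.
move=> f0 df dfE f'0 x /andP[x0 xM].
have {dfE}df (z : R) : is_derive z 1 f (f' z) by exact: DeriveDef.
have [->//|xN0] := eqVneq x 0.
have {xN0}x_gt0 : 0 < x by rewrite lt_neqAle eq_sym xN0.
have cf : {within `[0, x], continuous f}.
  apply: continuous_subspaceT => z; apply: differentiable_continuous.
  by apply/derivable1_diffP; exact: ex_derive.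
have [c /andP[c0 cx] fE] := MVT x_gt0 (fun z _ => df z) cf.
have : 0 <= f x - f 0.
  rewrite fE mulr_ge0 ?subr_ge0//; apply: f'0.
  by rewrite (ltW c0)/= (le_trans (ltW cx)).
by rewrite subr_ge0; exact: le_trans.
Qed.

Lemma sin_le_id x : 0 <= x -> sin x <= x.
Proof.
move=> x0; rewrite -subr_ge0.
apply: (@ge0_of_derive (id - @sin R) (fun x => 1 - cos x) x).
- by rewrite !fctE sin0 subrr.
- by move=> z; exact: ex_derive.
- by move=> z; rewrite derive_val.
- by move=> z _; rewrite subr_ge0 cos_le1.
- by rewrite x0 lexx.
Qed.

Let half_sqr : R -> R := 2^-1 \*: (id ^+ 2).

Let half_sqr0 : half_sqr 0 = 0.
Proof. by rewrite /half_sqr/= fctE expr0n/= scaler0. Qed.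

Let half_sqrE x : half_sqr x = x ^+ 2 / 2.
Proof. by rewrite /half_sqr/= fctE /GRing.scale/= mulrC. Qed.

#[local] Instance is_derive_half_sqr x : is_derive x 1 half_sqr x.
Proof. apply: is_derive_eq; rewrite /GRing.scale/=; lra. Qed.

Lemma one_minus_cos_le x : 1 - cos x <= x ^+ 2 / 2.
Proof.
wlog x0 : x / 0 <= x => [h|].
  have [x0|x0] := leP 0 x; first exact: h.
  by have := h (- x); rewrite cosN sqrrN; apply; rewrite oppr_ge0 ltW.
rewrite -subr_ge0 -half_sqrE.
apply: (@ge0_of_derive (half_sqr - (cst 1 - @cos R)) (fun x => x - sin x) x).
- by rewrite !fctE half_sqr0 cos0 !subrr.
- by move=> z; exact: ex_derive.
- by move=> z; rewrite derive_val; lra.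
- by move=> z /andP[z0 _]; rewrite subr_ge0 sin_le_id.
- by rewrite x0 lexx.
Qed.

(** A quadratic bound, weaker near 0 than the cubic one, but of the shape that the global remainder
    in [trig_taylor] needs. *)
Lemma id_minus_sin_le x : 0 <= x -> x - sin x <= x ^+ 2 / 2.
Proof.
move=> x0; rewrite -subr_ge0 -half_sqrE.
apply: (@ge0_of_derive (half_sqr - (id - @sin R)) (fun x => x - (1 - cos x)) x).
- by rewrite !fctE half_sqr0 sin0 !subrr.
- by move=> z; exact: ex_derive.
- by move=> z; rewrite derive_val.
- move=> z /andP[z0 _].
  apply: (@ge0_of_derive (id - (cst 1 - @cos R)) (fun x => 1 - sin x) z).
  + by rewrite !fctE cos0 !subrr.
  + by move=> t; exact: ex_derive.
  + by move=> t; rewrite derive_val; lra.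
  + by move=> t _; rewrite subr_ge0 sin_le1.
  + by rewrite z0 lexx.
- by rewrite x0 lexx.
Qed.

(** The second derivative of the difference is [cos x - 2^-1], which is nonnegative on [0, 1]
    because cos t >= 1 - t^2/2; two comparisons starting at 0 integrate this back. *)
Lemma one_minus_cos_ge x : `|x| <= 1 -> x ^+ 2 / 4 <= 1 - cos x.
Proof.
wlog x0 : x / 0 <= x => [h|].
  have [x0|x0] := leP 0 x; first exact: h.
  by have := h (- x); rewrite cosN sqrrN normrN; apply; rewrite oppr_ge0 ltW.
rewrite ger0_norm// => x1; rewrite -subr_ge0.
rewrite (_ : x ^+ 2 / 4 = 2^-1 * half_sqr x); last by rewrite half_sqrE; field.
apply: (@ge0_of_derive ((cst 1 - @cos R) - 2^-1 \*: half_sqr)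
  (fun x => sin x - 2^-1 * x) 1).
- rewrite [leRHS](_ : _ = 1 - cos 0 - 2^-1 * half_sqr 0)//.
  by rewrite half_sqr0 cos0 mulr0 !subrr.
- by move=> z; exact: ex_derive.
- by move=> z; rewrite derive_val; rewrite /GRing.scale/=; lra.
- move=> z /andP[z0 z1].
  apply: (@ge0_of_derive (@sin R - 2^-1 \*: id) (fun x => cos x - 2^-1) z).
  + rewrite [leRHS](_ : _ = sin 0 - 2^-1 * 0)//.
    by rewrite sin0 mulr0 subrr.
  + by move=> t; exact: ex_derive.
  + by move=> t; rewrite derive_val; rewrite /GRing.scale/=; lra.
  + move=> t /andP[t0 tz]; have := one_minus_cos_le t.
    have : t ^+ 2 <= 1 by rewrite expr_le1// (le_trans tz).
    lra.
  + by rewrite z0 lexx.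
- by rewrite x0 x1.
Qed.

(* The [s]-th derivative of [cos], so that differentiation only shifts [s]. *)
Definition trig (s : nat) (x : R) : R := cos (x + s%:R * (pi / 2)).

Lemma trig0 x : trig 0 x = cos x.
Proof. by rewrite /trig mul0r addr0. Qed.

Lemma trigS s x : trig s.+1 x = - sin (x + s%:R * (pi / 2)).
Proof. by rewrite /trig -addn1 natrD mulrDl mul1r addrA cosDpihalf. Qed.

Lemma trig_le1 s x : `|trig s x| <= 1.
Proof. by rewrite /trig ler_norml cos_geN1 cos_le1. Qed.

(** Multiplying by a cosine averages two translates. This is the identity behind reading
    multiplication by [chi] as a convolution, and it keeps the phase [s]. *)
Lemma trig_sum s a b : trig s (a - b) + trig s (a + b) = 2 * (trig s a * cos b).
Proof.
rewrite /trig (_ : a - b + _ = a + s%:R * (pi / 2) - b); last by ring.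
rewrite (_ : a + b + _ = a + s%:R * (pi / 2) + b); last by ring.
by move: (a + _) => c; rewrite cosB cosD; ring.
Qed.

(** The addition formula splits the remainder into [cos c * (1 - cos b)] and [sin c * (b - sin b)],
    each at most b^2/2. The bound holds for all [b], which allows it to be integrated in a parameter
    without restricting its range. *)
Lemma trig_taylor s a b :
  `|trig s (a + b) - trig s a - b * trig s.+1 a| <= b ^+ 2.
Proof.
rewrite trigS /trig (_ : a + b + _ = a + s%:R * (pi / 2) + b); last by ring.
set c := a + _; rewrite cosD.
rewrite (_ : _ - _ - _ = - (cos c * (1 - cos b)) + sin c * (b - sin b)); last by ring.
have h1 : `|cos c * (1 - cos b)| <= b ^+ 2 / 2.
  rewrite normrM (le_trans (ler_piMl _ _))//.
    by rewrite ler_norml cos_geN1 cos_le1.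
  by rewrite ger0_norm ?subr_ge0 ?cos_le1// one_minus_cos_le.
have h2 : `|sin c * (b - sin b)| <= b ^+ 2 / 2.
  rewrite normrM (le_trans (ler_piMl _ _))//.
    by rewrite ler_norml sin_geN1 sin_le1.
  have [b0|/ltW b0] := leP 0 b.
    by rewrite ger0_norm ?subr_ge0 ?sin_le_id// id_minus_sin_le.
  have b0' : 0 <= - b by rewrite oppr_ge0.
  rewrite -normrN opprB -sqrrN (_ : sin b - b = - b - sin (- b)).
    by rewrite ger0_norm ?subr_ge0 ?sin_le_id// id_minus_sin_le.
  by rewrite sinN opprK addrC.
rewrite (le_trans (ler_normD _ _))// normrN; lra.
Qed.

Lemma trig_lip s a b : `|trig s a - trig s b| <= `|a - b|.
Proof.
have cosB2 (u v : R) : `|cos u - cos v| <= `|u - v|.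
  wlog uv : u v / u <= v => [h|].
    have [/h//|/ltW/h] := leP u v.
    by rewrite (distrC u) (distrC (cos u)).
  move: uv; rewrite le_eqVlt => /predU1P[->|uv]; first by rewrite !subrr.
  have cf : {within `[u, v], continuous (@cos R)}.
    by apply: continuous_subspaceT => z; exact: continuous_cos.
  have [c _] := MVT uv (fun z _ => is_derive_cos z) cf.
  rewrite distrC => ->; rewrite normrM distrC ler_piMl// normrN.
  by rewrite ler_norml sin_geN1 sin_le1.
by rewrite (le_trans (cosB2 _ _))// opprD addrACA subrr addr0.
Qed.

End trigonometry.

Section euclidean_norm.
Context (R : realType) (d : nat).
Implicit Types (x y u v : 'rV[R]_d) (t : R).

Lemma dotvC u y : dotv u y = dotv y u.
Proof. by apply: eq_bigr => i _; rewrite mulrC. Qed.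

Lemma dotvDr u x y : dotv u (x + y) = dotv u x + dotv u y.
Proof. by rewrite -big_split; apply: eq_bigr => i _; rewrite mxE mulrDr. Qed.

Lemma dotvZr u t y : dotv u (t *: y) = t * dotv u y.
Proof. by rewrite mulr_sumr; apply: eq_bigr => i _; rewrite mxE mulrCA. Qed.

Lemma dotvNr u y : dotv u (- y) = - dotv u y.
Proof. by rewrite -scaleN1r dotvZr mulN1r. Qed.

Lemma dotvBr u x y : dotv u (x - y) = dotv u x - dotv u y.
Proof. by rewrite dotvDr dotvNr. Qed.

Lemma dotvDl x y u : dotv (x + y) u = dotv x u + dotv y u.
Proof. by rewrite dotvC dotvDr !(dotvC u). Qed.

Lemma dotvZl t x u : dotv (t *: x) u = t * dotv x u.
Proof. by rewrite dotvC dotvZr dotvC. Qed.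

Lemma dotv_delta u i : dotv u (delta_mx ord0 i) = u ord0 i.
Proof.
rewrite /dotv (bigD1 i)//= big1 ?addr0; first by rewrite mxE !eqxx mulr1.
by move=> j ji; rewrite mxE (negbTE ji) andbF mulr0.
Qed.

Lemma dotvv_ge0 x : 0 <= dotv x x.
Proof. by apply: sumr_ge0 => i _; rewrite -expr2 sqr_ge0. Qed.

Lemma enorm_ge0 x : 0 <= enorm x.
Proof. exact: sqrtr_ge0. Qed.
Hint Resolve enorm_ge0 : core.

Lemma sqr_enorm x : enorm x ^+ 2 = dotv x x.
Proof. by rewrite sqr_sqrtr// dotvv_ge0. Qed.

Lemma enormZ t x : enorm (t *: x) = `|t| * enorm x.
Proof.
by rewrite /enorm dotvZr dotvZl mulrA -expr2 sqrtrM ?sqr_ge0// sqrtr_sqr.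
Qed.

Lemma enormN x : enorm (- x) = enorm x.
Proof. by rewrite -scaleN1r enormZ normrN1 mul1r. Qed.

Lemma enorm0 : enorm (0 : 'rV[R]_d) = 0.
Proof. by rewrite -(scale0r 0) enormZ normr0 mul0r. Qed.

Lemma enorm_eq0 x : enorm x = 0 -> x = 0.
Proof.
move=> x0; apply/rowP => i; rewrite mxE.
have /eqP : dotv x x = 0 by rewrite -sqr_enorm x0 expr0n.
rewrite psumr_eq0 => [/allP/(_ i)|j _]; last by rewrite -expr2 sqr_ge0.
by rewrite mem_index_enum => /(_ isT)/=; rewrite mulf_eq0 orbb => /eqP.
Qed.

Lemma enorm_gt0 x : x != 0 -> 0 < enorm x.
Proof.
move=> x0; rewrite lt_neqAle enorm_ge0 andbT eq_sym.
by apply: contra x0 => /eqP/enorm_eq0 ->.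
Qed.

(** Cauchy-Schwarz, by expanding the squared length of the difference of the two normalized
    vectors. *)
Lemma normr_dotv_le u y : `|dotv u y| <= enorm u * enorm y.
Proof.
suff h v : dotv v y <= enorm v * enorm y.
  rewrite ler_norml h andbT lerNl -(enormN u) (le_trans _ (h (- u)))//.
  by rewrite (dotvC (- u)) dotvNr dotvC.
have [->|v0] := eqVneq v 0; first by rewrite -(scale0r 0) dotvZl enormZ normr0 !mul0r.
have [->|y0] := eqVneq y 0; first by rewrite -(scale0r 0) dotvZr enormZ normr0 !mul0r mulr0.
have {}v0 := enorm_gt0 v0; have {}y0 := enorm_gt0 y0.
have := dotvv_ge0 ((enorm v)^-1 *: v - (enorm y)^-1 *: y).
rewrite dotvBr dotvC dotvBr [X in _ - X]dotvC dotvBr !(dotvZl, dotvZr) -!sqr_enorm.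
rewrite (dotvC y v) => h.
have : dotv v y / (enorm v * enorm y) <= 1.
  move: h; rewrite !expr2 !mulrA; move: (enorm v) (enorm y) (dotv v y) v0 y0 => a b c a0 b0.
  have -> : a^-1 * a^-1 * a * a - a^-1 * b^-1 * c - (b^-1 * a^-1 * c - b^-1 * b^-1 * b * b)
     = 2 * (1 - c / (a * b)) by field; rewrite ?gt_eqF.
  by lra.
by rewrite ler_pdivrMr ?mulr_gt0// mul1r.
Qed.

Lemma ler_enormD x y : enorm (x + y) <= enorm x + enorm y.
Proof.
rewrite -[leLHS]ger0_norm// -[leRHS]ger0_norm ?addr_ge0// -ler_sqr ?nnegrE ?addr_ge0//.
rewrite !ger0_norm ?addr_ge0// sqrrD !sqr_enorm dotvDr !dotvDl (dotvC y x).
by have := normr_dotv_le x y; rewrite ler_norml => /andP[_]; lra.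
Qed.

Lemma enorm_sub x y : enorm (x - y) = enorm (y - x).
Proof. by rewrite -enormN opprB. Qed.

Lemma enorm_delta i : enorm (delta_mx ord0 i : 'rV[R]_d) = 1.
Proof. by rewrite /enorm dotv_delta mxE !eqxx sqrtr1. Qed.

Lemma coord_le_enorm x i : `|x ord0 i| <= enorm x.
Proof. by rewrite -dotv_delta (le_trans (normr_dotv_le _ _))// enorm_delta mulr1. Qed.

Lemma enorm_le_sum x : enorm x <= \sum_i `|x ord0 i|.
Proof.
rewrite {1}(row_sum_delta x); elim/big_ind2 : _ => [|a b c e ab ce|i _].
- by rewrite enorm0.
- by rewrite (le_trans (ler_enormD _ _))// lerD.
- by rewrite enormZ enorm_delta mulr1.
Qed.

Lemma enorm_le_norm x : enorm x <= d%:R * `|x|.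
Proof.
rewrite (le_trans (enorm_le_sum x))//.
rewrite (@le_trans _ _ (\sum_(i < d) `|x|))//; last first.
  by rewrite sumr_const card_ord mulr_natl.
apply: ler_sum => i _; rewrite [leRHS]/Num.norm/= mx_normrE.
by apply/bigmax_geP; right; exists (ord0, i).
Qed.

Lemma continuous_rV_measurable (f : 'rV[R]_d -> R) :
  continuous f -> measurable_fun setT f.
Proof.
move=> cf; apply: (measurability _ (RGenOpens.measurableE R)) => _ [_ [a [b ->] <-]].
rewrite setTI; apply: sub_sigma_algebra => /=.
by apply: open_comp; [move=> x _; exact: cf|exact: interval_open].
Qed.

(** The increments are measured in the Euclidean norm while the topology comes from the sup norm;
    [enorm_le_norm] translates. Adding 1 to [d] and to the absolute value of [C] keeps the radius
    positive for [d = 0] and for [C] of any sign. *)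
Lemma lipschitz_continuous (f : 'rV[R]_d -> R) :
  (forall u, exists C, forall h, enorm h <= 1 -> `|f (u + h) - f u| <= C * enorm h) ->
  continuous f.
Proof.
move=> lf u; have [C fC] := lf u.
apply/(@cvgrPdist_le _ _ _ (nbhs u) (nbhs_filter u)) => e e0.
have hC : (0 : R) < `|C| + 1 by rewrite ltr_wpDl.
have d1 : (0 : R) < d%:R + 1 by rewrite ltr_wpDl.
pose r := Num.min 1 (e / (`|C| + 1)) / (d%:R + 1).
have r0 : 0 < r by rewrite divr_gt0// lt_min ltr01 divr_gt0.
apply/nbhs_ballP; exists r => //= v; rewrite -ball_normE/= distrC => uv.
have hv : enorm (v - u) <= Num.min 1 (e / (`|C| + 1)).
  rewrite (le_trans (enorm_le_norm _))// (@le_trans _ _ ((d%:R + 1) * `|v - u|))//.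
    by rewrite ler_wpM2r// lerDl.
  by rewrite mulrC -ler_pdivlMr// ltW.
move: hv; rewrite le_min => /andP[hv1 hv2].
have := fC (v - u) hv1; rewrite (addrC u) subrK distrC => /le_trans -> //.
rewrite (@le_trans _ _ ((`|C| + 1) * enorm (v - u)))//.
  by rewrite ler_wpM2r// (le_trans (ler_norm _))// lerDl.
by rewrite mulrC -ler_pdivlMr.
Qed.

End euclidean_norm.
#[global] Hint Extern 0 (is_true (0 <= enorm _)) => exact: enorm_ge0 : core.

Section bracket.
Context (R : realType) (d : nat).
Implicit Types (x y u v : 'rV[R]_d).

Definition bracket u : R := 1 + enorm u.

Lemma bracket_ge1 u : 1 <= bracket u.
Proof. by rewrite /bracket lerDl. Qed.
Hint Resolve bracket_ge1 : core.

Lemma bracket_gt0 u : 0 < bracket u.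
Proof. exact: lt_le_trans (bracket_ge1 u). Qed.
Hint Resolve bracket_gt0 : core.

Lemma bracket_ge0 u : 0 <= bracket u.
Proof. exact: ltW. Qed.
Hint Resolve bracket_ge0 : core.

Lemma bracketN u : bracket (- u) = bracket u.
Proof. by rewrite /bracket enormN. Qed.

Lemma bracketD u v : bracket (u + v) <= bracket u * bracket v.
Proof.
rewrite /bracket (@le_trans _ _ (1 + (enorm u + enorm v)))//.
  by rewrite lerD2l ler_enormD.
have := mulr_ge0 (enorm_ge0 u) (enorm_ge0 v).
by move: (enorm u) (enorm v) => a b; nra.
Qed.

(** Peetre's inequality with exponent one; it is what makes rapid decay stable under bounded
    shifts. *)
Lemma bracket_shift u v : bracket u <= bracket (u + v) * bracket v.
Proof. by rewrite -{1}(addrK v u) -(bracketN v) bracketD. Qed.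

Lemma coord_le_bracket u i : `|u ord0 i| <= bracket u.
Proof. by rewrite (le_trans (coord_le_enorm _ _))// /bracket lerDr. Qed.

Lemma measurable_bracket : measurable_fun setT bracket.
Proof. by apply: measurable_funD => //; exact: measurable_enorm. Qed.

End bracket.
#[global] Hint Extern 0 (is_true (0 <= bracket _)) => exact: bracket_ge0 : core.
#[global] Hint Extern 0 (is_true (0 < bracket _)) => exact: bracket_gt0 : core.
#[global] Hint Extern 0 (is_true (1 <= bracket _)) => exact: bracket_ge1 : core.

Section integration.
Context d (T : measurableType d) (R : realType).
Variable mu : {measure set T -> \bar R}.
Variables (D : set T) (mD : measurable D).
Implicit Types f g : T -> R.

Lemma integrable_dominated f g : measurable_fun D f ->
  mu.-integrable D (EFin \o g) -> (forall x, D x -> `|f x| <= g x) ->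
  mu.-integrable D (EFin \o f).
Proof.
move=> mf ig fg; apply: le_integrable ig => //; first exact/measurable_EFinP.
by move=> x Dx; rewrite /= lee_fin (le_trans (fg _ Dx))// ler_norm.
Qed.

Lemma normr_Rintegral_le f g : measurable_fun D f ->
  mu.-integrable D (EFin \o g) -> (forall x, D x -> `|f x| <= g x) ->
  `|\int[mu]_(x in D) f x| <= \int[mu]_(x in D) g x.
Proof.
move=> mf ig fg; have if_ := integrable_dominated mf ig fg.
rewrite (le_trans (le_normr_Rintegral mD if_))// le_Rintegral//.
exact: integrable_norm.
Qed.

Lemma Rintegral_EFin f : mu.-integrable D (EFin \o f) ->
  (\int[mu]_(x in D) (f x)%:E)%E = (\int[mu]_(x in D) f x)%:E.
Proof. by move=> if_; rewrite /Rintegral fineK// integrable_fin_num. Qed.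

Lemma integrable_ge0P f : measurable_fun D f -> (forall x, D x -> 0 <= f x) ->
  (\int[mu]_(x in D) (f x)%:E < +oo)%E -> mu.-integrable D (EFin \o f).
Proof.
move=> mf f0 foo; apply/integrableP; split; first exact/measurable_EFinP.
rewrite (eq_integral (fun x => (f x)%:E))// => x; rewrite inE => Dx.
by rewrite /= ger0_norm// f0.
Qed.

End integration.

Section real_fubini.
Context d1 d2 (T1 : measurableType d1) (T2 : measurableType d2) (R : realType).
Variables (m1 : {sigma_finite_measure set T1 -> \bar R}).
Variables (m2 : {sigma_finite_measure set T2 -> \bar R}).
Variables (f : T1 * T2 -> R) (g : T1 -> R) (h : T2 -> R).
Hypotheses (mf : measurable_fun setT f)
  (ig : m1.-integrable setT (EFin \o g)) (ih : m2.-integrable setT (EFin \o h))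
  (fgh : forall x y, `|f (x, y)| <= g x * h y).

Let mg : measurable_fun setT g.
Proof. by apply/measurable_EFinP; exact: measurable_int ig. Qed.

Let mh : measurable_fun setT h.
Proof. by apply/measurable_EFinP; exact: measurable_int ih. Qed.

(** Domination by a product makes every section integrable, not just almost every one, so the inner
    integrals are real-valued functions everywhere and Fubini can be stated with real integrals. *)
Lemma integrable_pair1 x : m2.-integrable setT (fun y => (f (x, y))%:E).
Proof.
apply: (@integrable_dominated _ _ _ _ _ _ _ (fun y => g x * h y)) => //.
  by apply: measurableT_comp => //; exact: pair1_measurable.
exact: (integrableZl measurableT (g x) ih).
Qed.

Lemma integrable_pair2 y : m1.-integrable setT (fun x => (f (x, y))%:E).
Proof.
apply: (@integrable_dominated _ _ _ _ _ _ _ (fun x => g x * h y)) => //.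
  by apply: measurableT_comp => //; exact: pair2_measurable.
exact: (integrableZr measurableT (h y) ig).
Qed.

Let if_ : (m1 \x m2)%E.-integrable setT (EFin \o f).
Proof.
apply/integrable12ltyP; first exact/measurable_EFinP.
have H0 : 0 <= \int[m2]_y `|h y| by apply: Rintegral_ge0.
apply: (@le_lt_trans _ _ (\int[m1]_x ((\int[m2]_y `|h y|)%R%:E * (`|g x|)%R%:E)))%E.
  apply: ge0_le_integral => //.
  - by move=> x _; exact: integral_ge0.
  - apply: (@measurable_fun_fubini_tonelli_F _ _ _ _ _ _ (fun z => `|f z|%:E)) => //.
    by apply/measurable_EFinP; exact: measurableT_comp.
  - by apply/measurable_EFinP; apply: measurable_funM => //; exact: measurableT_comp.
  move=> x _; rewrite /= -Rintegral_EFin//; last exact: (integrable_norm ih).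
  rewrite -ge0_integralZr//; last by apply/measurable_EFinP; exact: measurableT_comp.
  apply: ge0_le_integral => //.
  - apply/measurable_EFinP; apply: measurableT_comp => //.
    by apply: measurableT_comp => //; exact: pair1_measurable.
  - by apply/measurable_EFinP; apply: measurable_funM => //; exact: measurableT_comp.
  - move=> y _; rewrite -EFinM lee_fin (le_trans (fgh _ _))//.
    by rewrite mulrC -normrM ler_norm.
rewrite ge0_integralZl//; last by apply/measurable_EFinP; exact: measurableT_comp.
by rewrite lte_mul_pinfty// ?lee_fin ?Rintegral_ge0//; move/integrableP : ig => [].
Qed.

Lemma measurable_Rintegral1 : measurable_fun setT (fun x => \int[m2]_y f (x, y)).
Proof.
apply/measurable_EFinP; have := measurable_fubini_F if_.
apply: eq_measurable_fun => x _.
by rewrite /fubini_F/= Rintegral_EFin//; exact: integrable_pair1.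
Qed.

Lemma Rintegral_fubini :
  \int[m1]_x (\int[m2]_y f (x, y)) = \int[m2]_y (\int[m1]_x f (x, y)).
Proof.
have := Fubini if_.
under eq_integral => x _ do rewrite Rintegral_EFin ?integrable_pair1//.
under [in X in _ = X -> _]eq_integral => x _ do rewrite Rintegral_EFin ?integrable_pair2//.
by move/(congr1 fine).
Qed.

End real_fubini.

(** * Lebesgue measure under translations and dilations *)

Section lebesgue_affine.
Context (R : realType).
Local Open Scope ereal_scope.

(** The pushforward of Lebesgue measure by the affine map, multiplied by [s], has the right value on
    half-open intervals, so it is Lebesgue measure by uniqueness. *)
Lemma ge0_integral_affine1 (f : R -> \bar R) (a s : R) : (0 < s)%R ->
  measurable_fun setT f -> (forall x, 0 <= f x) ->
  \int[lebesgue_measure]_x f (a + s * x)%R = s^-1%:E * \int[lebesgue_measure]_x f x.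
Proof.
move=> s0 mf f0; have s0' : (0 <= s)%R by exact: ltW.
pose phi : measurableTypeR R -> measurableTypeR R := fun x => (a + s * x)%R.
have mphi : measurable_fun setT phi.
  by apply: measurable_funD => //; exact: measurable_funM.
pose push : {measure set (measurableTypeR R) -> \bar R} :=
  measure_function_pushforward__canonical__measure_function_Measure lebesgue_measure mphi.
have -> : \int[lebesgue_measure]_x f x = \int[mscale (NngNum s0') push]_x f x.
  apply: eq_measure_integral => A mA _; apply: lebesgue_measure_unique => //.
  move=> _ [[b c]] _ <-; rewrite /= /mscale/= /pushforward.
  rewrite (_ : phi @^-1` _ = `](s^-1 * (b - a))%R, (s^-1 * (c - a))%R]%classic); last first.
    apply/seteqP; split=> x; rewrite /= !in_itv/= /phi.
      move=> /andP[bx xc]; rewrite -(ler_pM2l s0) -(ltr_pM2l s0) !mulVKf ?gt_eqF//.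
      by rewrite ltrBlDl bx lerBrDl.
    rewrite -(ler_pM2l s0) -(ltr_pM2l s0) !mulVKf ?gt_eqF//.
    by rewrite ltrBlDl lerBrDl.
  rewrite !lebesgue_measure_itv/= !lte_fin ltr_pM2l ?invr_gt0// ltrD2r.
  case: ifPn => _; last by rewrite mule0.
  by rewrite -!EFinD -EFinM; congr EFin; field; rewrite gt_eqF.
rewrite ge0_integral_mscale// /push ge0_integral_pushforward//= muleA -EFinM.
by rewrite mulVf ?gt_eqF// mul1e preimage_setT.
Qed.

Lemma ge0_integral_rVS n (f : 'rV[R]_n.+1 -> \bar R) :
  measurable_fun setT f -> (forall x, 0 <= f x) ->
  \int[lebesgue_measure_rV R n.+1]_x f x =
  \int[lebesgue_measure]_x \int[lebesgue_measure_rV R n]_v f (rV_cons (x, v)).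
Proof.
move=> mf f0; rewrite [LHS]ge0_integral_pushforward//; last exact: measurable_rV_cons.
rewrite preimage_setT fubini_tonelli1//; last by move=> z; exact: f0.
by apply: measurableT_comp => //; exact: measurable_rV_cons.
Qed.

Lemma measurable_integral_rV_cons n (f : 'rV[R]_n.+1 -> \bar R) :
  measurable_fun setT f -> (forall x, 0 <= f x) ->
  measurable_fun setT (fun x : measurableTypeR R =>
    \int[lebesgue_measure_rV R n]_v f (rV_cons (x, v))).
Proof.
move=> mf f0.
apply: (@measurable_fun_fubini_tonelli_F _ _ _ _ _ _ (f \o @rV_cons R n)) => //;
  last by move=> z; exact: f0.
by apply: measurableT_comp => //; exact: measurable_rV_cons.
Qed.

Lemma rV_cons_affine n (a : 'rV[R]_n.+1) (s : R) z :
  (a + s *: rV_cons z)%R =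
  rV_cons ((a ord0 ord0 + s * z.1)%R, (rsubmx (a : 'rV_(1 + n)) + s *: z.2)%R).
Proof.
apply/rowP => i; rewrite mxE [X in (_ + X)%R]mxE; have [k ->|k ->] := split_ordP (i : 'I_(1 + n)).
  rewrite !(@row_mxEl R 1 1 n) !mxE.
  by congr (a _ _ + _)%R; apply/val_inj => /=; case: k => -[].
by rewrite !(@row_mxEr R 1 1 n) !mxE.
Qed.

Lemma measurable_affine_rV n (a : 'rV[R]_n) (s : R) :
  measurable_fun setT (fun x : 'rV[R]_n => (a + s *: x)%R).
Proof.
apply: measurable_fun_mx => i j; under eq_fun do rewrite !mxE.
by apply: measurable_funD => //; apply: measurable_funM => //; exact: measurable_coord.
Qed.

(** Induction on the dimension: an affine map with scalar linear part acts on the first coordinate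
    and on the rest separately, and each coordinate contributes one factor [s^-1]. *)
Lemma ge0_integral_affine n (f : 'rV[R]_n -> \bar R) (a : 'rV[R]_n) (s : R) :
  (0 < s)%R -> measurable_fun setT f -> (forall x, 0 <= f x) ->
  \int[lebesgue_measure_rV R n]_x f (a + s *: x)%R =
  (s^-1 ^+ n)%:E * \int[lebesgue_measure_rV R n]_x f x.
Proof.
move=> s0; elim: n f a => [|n IHn] f a mf f0.
  rewrite expr0 mul1e; apply: eq_integral => x _; congr f.
  by rewrite [LHS]thinmx0 [RHS]thinmx0.
rewrite !ge0_integral_rVS//; last by apply: measurableT_comp => //; exact: measurable_affine_rV.
have mS (x : measurableTypeR R) :
    measurable_fun setT (fun v : 'rV[R]_n => f (rV_cons (x, v))).
  apply: measurableT_comp => //; apply: measurableT_comp; first exact: measurable_rV_cons.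
  exact: pair1_measurable.
under eq_integral => x _.
  under eq_integral do rewrite rV_cons_affine/=.
  rewrite (IHn (fun v => f (rV_cons ((a ord0 ord0 + s * x)%R, v))))//.
  over.
pose g (x : R) := \int[lebesgue_measure_rV R n]_v f (rV_cons (x, v)).
have g0 x : 0 <= g x by exact: integral_ge0.
have mg : measurable_fun setT g by exact: measurable_integral_rV_cons.
transitivity ((s^-1 ^+ n)%:E * \int[lebesgue_measure]_x g (a ord0 ord0 + s * x)%R).
  rewrite -ge0_integralZl//; last by rewrite lee_fin exprn_ge0// invr_ge0 ltW.
  by apply: (measurableT_comp mg); apply: measurable_funD => //; exact: measurable_funM.
by rewrite ge0_integral_affine1// muleA -EFinM exprSr.
Qed.

End lebesgue_affine.

Section lebesgue_rV.
Context (R : realType) (n : nat).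
Local Notation leb := (lebesgue_measure_rV R n).
Implicit Types (f : 'rV[R]_n -> R) (a : 'rV[R]_n) (s : R).

Lemma integrable_affine f a s : 0 < s -> leb.-integrable setT (EFin \o f) ->
  leb.-integrable setT (fun x => (f (a + s *: x))%:E).
Proof.
move=> s0 /integrableP[mf foo]; apply/integrableP; split.
  by apply: (measurableT_comp mf); exact: measurable_affine_rV.
rewrite (ge0_integral_affine a s0 (f := fun x => `|(f x)%:E|%E))//.
  by rewrite lte_mul_pinfty// lee_fin exprn_ge0// invr_ge0 ltW.
exact: measurableT_comp.
Qed.

Lemma Rintegral_affine f a s : 0 < s -> leb.-integrable setT (EFin \o f) ->
  \int[leb]_x f (a + s *: x) = s^-1 ^+ n * \int[leb]_x f x.
Proof.
move=> s0 if_; have /measurable_EFinP mf := measurable_int leb if_.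
have s1 : 0 <= s^-1 ^+ n by rewrite exprn_ge0// invr_ge0 ltW.
rewrite /Rintegral [in LHS]integralE [in RHS]integralE.
have mp : measurable_fun setT (EFin \o f)^\+%E by apply: measurable_funepos; exact/measurable_EFinP.
have mn : measurable_fun setT (EFin \o f)^\-%E by apply: measurable_funeneg; exact/measurable_EFinP.
have fp := integral_funepos_lt_pinfty measurableT if_.
have fn := integral_funeneg_lt_pinfty measurableT if_.
have ep : (\int[leb]_x ((fun x => (f (a + s *: x))%:E)^\+ x) =
    (s^-1 ^+ n)%:E * \int[leb]_x ((EFin \o f)^\+ x))%E.
  rewrite (funepos_comp (EFin \o f) (fun x => a + s *: x)).
  by apply: (ge0_integral_affine a s0 mp) => x; rewrite funepos_ge0.
have en : (\int[leb]_x ((fun x => (f (a + s *: x))%:E)^\- x) =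
    (s^-1 ^+ n)%:E * \int[leb]_x ((EFin \o f)^\- x))%E.
  rewrite (funeneg_comp (EFin \o f) (fun x => a + s *: x)).
  by apply: (ge0_integral_affine a s0 mn) => x; rewrite funeneg_ge0.
rewrite ep en.
have [fp' fn'] : (\int[leb]_x ((EFin \o f)^\+ x) \is a fin_num)%E /\
                 (\int[leb]_x ((EFin \o f)^\- x) \is a fin_num)%E.
  by split; rewrite ge0_fin_numE//; apply: integral_ge0 => x _.
by rewrite -(fineK fp') -(fineK fn') -!EFinM -!EFinB/= mulrBr.
Qed.

Lemma integrable_shift f a : leb.-integrable setT (EFin \o f) ->
  leb.-integrable setT (fun x => (f (x + a))%:E).
Proof.
move=> /(integrable_affine a ltr01); apply: eq_integrable => // x _.
by rewrite scale1r addrC.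
Qed.

Lemma Rintegral_shift f a : leb.-integrable setT (EFin \o f) ->
  \int[leb]_x f (x + a) = \int[leb]_x f x.
Proof.
move=> /(Rintegral_affine a ltr01); rewrite invr1 expr1n mul1r => <-.
by apply: eq_Rintegral => x _; rewrite scale1r addrC.
Qed.

End lebesgue_rV.

Section integrable_bracket.
Context (R : realType).
Implicit Type n : nat.

Lemma integral_oneDsqrV_lty :
  (\int[@lebesgue_measure R]_x ((oneDsqr x)^-1)%:E < +oo)%E.
Proof.
rewrite ge0_symfun_integralT//=.
- rewrite (_ : [set x | _] = `[0, +oo[%classic); last first.
    by apply/seteqP; split => x/=; rewrite in_itv/= andbT.
  by rewrite integral0y_oneDsqr -EFinM ltry.
- exact: continuous_oneDsqrV.
- by move=> x/=; rewrite /oneDsqr sqrrN.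
Qed.

Let prod_oneDsqrV n (x : 'rV[R]_n) : R := \prod_i (oneDsqr (x ord0 i))^-1.

Let oneDsqrV_ge0 (x : R) : 0 <= (oneDsqr x)^-1.
Proof. by rewrite invr_ge0 (le_trans ler01)// oneDsqr_ge1. Qed.

Let prod_oneDsqrV_ge0 n (x : 'rV[R]_n) : 0 <= prod_oneDsqrV x.
Proof. exact: prodr_ge0. Qed.
#[local] Hint Resolve oneDsqrV_ge0 prod_oneDsqrV_ge0 : core.

Let measurable_oneDsqrV : measurable_fun setT (fun x : R => (oneDsqr x)^-1).
Proof. by apply: continuous_measurable_fun => x; exact: continuous_oneDsqrV. Qed.

Let measurable_prod_oneDsqrV n : measurable_fun setT (@prod_oneDsqrV n).
Proof.
apply: measurable_prod => i _.
exact: (measurableT_comp measurable_oneDsqrV (measurable_coord _ _)).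
Qed.

Let integral_prod_oneDsqrV n :
  (\int[lebesgue_measure_rV R n]_x (prod_oneDsqrV x)%:E < +oo)%E.
Proof.
elim: n => [|n IHn].
  rewrite (_ : (fun x => _) = cst 1%E); last first.
    by apply/funext => x; rewrite /prod_oneDsqrV big_ord0.
  by rewrite integral_cst//= mul1e diracT ltry.
rewrite ge0_integral_rVS//; last 2 first.
- by apply/measurable_EFinP; exact: measurable_prod_oneDsqrV.
- by move=> x; rewrite lee_fin; exact: prod_oneDsqrV_ge0.
pose I := (\int[lebesgue_measure_rV R n]_x (prod_oneDsqrV x)%:E)%E.
have I0 : (0 <= I)%E by apply: integral_ge0 => x _; rewrite lee_fin.
rewrite (eq_integral (fun x : measurableTypeR R => ((oneDsqr (x : R))^-1)%:E * I)%E); last first.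
  move=> x _; rewrite -ge0_integralZl_EFin//; last 2 first.
    by move=> v _; rewrite lee_fin.
    by apply/measurable_EFinP; exact: measurable_prod_oneDsqrV.
  apply: eq_integral => v _; rewrite -EFinM; congr EFin.
  rewrite /prod_oneDsqrV big_ord_recl /rV_cons; congr *%R.
    have -> : ord0 = lshift n (ord0 : 'I_1) :> 'I_(1 + n) by exact/val_inj.
    by rewrite (@row_mxEl R 1 1 n) mxE.
  apply: eq_bigr => i _.
  have -> : lift ord0 i = rshift 1 i :> 'I_(1 + n) by exact/val_inj.
  by rewrite (@row_mxEr R 1 1 n).
rewrite ge0_integralZr//; last by apply/measurable_EFinP.
rewrite muleC lte_mul_pinfty//; last exact: integral_oneDsqrV_lty.
by rewrite ge0_fin_numE.
Qed.

(** Since (1 + |x|)^2 >= 1 + x_i^2 for every i, the power 2n of the bracket dominates the product of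
    the n factors 1 + x_i^2, whose inverse is integrable by Tonelli and the arctangent integral. The
    exponent is not sharp, but any fixed one serves against rapid decay. *)
Lemma integrable_bracketV n N : (n.*2 <= N)%N ->
  (lebesgue_measure_rV R n).-integrable setT (fun x => ((bracket x) ^- N)%:E).
Proof.
move=> nN; apply: (@integrable_dominated _ _ _ _ _ measurableT _ (@prod_oneDsqrV n)).
- under eq_fun do rewrite -powR_mulrn// -powRN.
  exact: (measurableT_comp (measurable_powR _) (@measurable_bracket _ _)).
- by apply: integrable_ge0P => // x _; exact: prod_oneDsqrV_ge0.
move=> x _; rewrite ger0_norm ?invr_ge0 ?exprn_ge0//.
rewrite /prod_oneDsqrV prodfV lef_pV2 ?posrE ?exprn_gt0//; last first.
  by apply: prodr_gt0 => i _; rewrite (lt_le_trans ltr01)// oneDsqr_ge1.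
rewrite (@le_trans _ _ (bracket x ^+ n.*2))//; last by rewrite ler_weXn2l.
rewrite -muln2 mulnC exprM -[X in _ ^+ X]card_ord -prodr_const.
apply: ler_prod => i _; rewrite (le_trans ler01) ?oneDsqr_ge1//= /oneDsqr.
have : x ord0 i ^+ 2 <= enorm x ^+ 2.
  by rewrite -real_normK ?num_real// ler_sqr ?nnegrE// coord_le_enorm.
by have := enorm_ge0 x; rewrite /bracket; move: (enorm x) (x ord0 i) => e a; nra.
Qed.

End integrable_bracket.

(** * The Levy measure *)

Section levy_measure_properties.
Context (R : realType) (d : nat) (alpha : R).
Variable mu : {finite_measure set 'rV[R]_d -> \bar R}.
Local Open Scope ereal_scope.
Implicit Types (D : set 'rV[R]_d) (xi v : 'rV[R]_d).

(** The half-line enters as an indicator factor, so that the radial integral runs over all of R and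
    the affine change of variables applies to it. *)
Let radial D xi (r : R) : R :=
  (\1_D (r *: xi) * (\1_(`]0, +oo[%classic : set R) r * r `^ (- 1 - alpha)))%R.

Let radial_ge0 D xi r : (0 <= radial D xi r)%R.
Proof. by rewrite /radial mulr_ge0// mulr_ge0// powR_ge0. Qed.

Let inner D xi : \bar R := \int[lebesgue_measure]_r (radial D xi r)%:E.

Let inner_ge0 D xi : 0 <= inner D xi.
Proof. by apply: integral_ge0 => r _; rewrite lee_fin. Qed.

Let measurable_radial D : measurable D ->
  measurable_fun setT (fun z : 'rV[R]_d * measurableTypeR R => radial D z.1 z.2).
Proof.
move=> mD; apply: measurable_funM.
  apply: (@measurableT_comp _ _ _ _ _ _ (\1_D : 'rV[R]_d -> R) _
    (fun z : 'rV[R]_d * measurableTypeR R => ((z.2 : R) *: z.1)%R)).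
    exact: measurable_indic.
  apply: measurable_fun_mx => i j; under eq_fun do rewrite mxE.
  apply: measurable_funM; first exact: measurable_snd.
  exact: (measurableT_comp (@measurable_coord R 1 d i j) measurable_fst).
apply: (@measurableT_comp _ _ _ _ _ _
  (fun r : R => \1_(`]0%R, +oo[%classic : set R) r * r `^ (- 1 - alpha))%R _ snd) => //.
by apply: measurable_funM; [exact: measurable_indic|exact: measurable_powR].
Qed.

Let measurable_radial2 D xi : measurable D -> measurable_fun setT (radial D xi).
Proof.
move=> mD; have := measurable_radial mD.
by move=> /measurableT_comp/(_ (@pair1_measurable _ _ _ (measurableTypeR R) xi)).
Qed.

Let measurable_inner D : measurable D -> measurable_fun setT (inner D).
Proof.
move=> mD; apply: (@measurable_fun_fubini_tonelli_F _ _ _ _ _ _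
  (fun z : 'rV[R]_d * measurableTypeR R => (radial D z.1 z.2)%:E)) => //.
  by apply/measurable_EFinP; exact: measurable_radial.
by move=> z; rewrite lee_fin.
Qed.

Let levy_measureE D : levy_measure alpha mu D = \int[mu]_(xi in @esphere R d) inner D xi.
Proof.
apply: eq_integral => xi _; rewrite integral_mkcond; apply: eq_integral => r _.
rewrite patchE /radial.
case: ifPn => r0; first by rewrite [X in (_ * (X * _))%R]indicE r0 mul1r.
by rewrite [X in (_ * (X * _))%R]indicE (negbTE r0) mul0r mulr0.
Qed.

(** Substitution r -> s r on each ray: the density contributes s^(1 + alpha) and the length element
    s^(-1). *)
Lemma levy_measure_scale (s : R) D : (0 < s)%R -> measurable D ->
  levy_measure alpha mu ((fun y => s *: y) @^-1` D) =
  (s `^ alpha)%:E * levy_measure alpha mu D.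
Proof.
move=> s0 mD; rewrite !levy_measureE -ge0_integralZl_EFin//; last 3 first.
- exact: measurable_esphere.
- by apply: measurable_funTS; exact: measurable_inner.
- exact: powR_ge0.
apply: eq_integral => xi _.
transitivity ((s `^ (1 + alpha))%:E * \int[lebesgue_measure]_r (radial D xi (0 + s * r))%:E).
  rewrite -ge0_integralZl_EFin ?powR_ge0//; last first.
  - apply/measurable_EFinP; apply: (measurableT_comp (measurable_radial2 xi mD)).
    by apply: measurable_funD => //; exact: measurable_funM.
  - by move=> r _; rewrite lee_fin.
  apply: eq_integral => r _; rewrite -EFinM; apply: (congr1 EFin); rewrite /radial add0r.
  rewrite [RHS]mulrCA; congr (_ * _)%R.
    rewrite !indicE; congr (nat_of_bool _)%:R.
    by apply/idP/idP; rewrite !in_setE/= scalerA.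
  have E t : \1_(`]0%R, +oo[%classic : set R) t = (0 < t)%R%:R :> R.
    rewrite indicE; congr (nat_of_bool _)%:R.
    by apply/idP/idP; rewrite in_setE/= in_itv/= andbT.
  rewrite mulrCA !E pmulr_rgt0//; have [r0|_] := ltP 0%R r; last by rewrite !mul0r.
  congr (_ * _)%R.
  rewrite powRM ?ltW// mulrA -powRD; last by apply/implyP => _; rewrite gt_eqF.
  rewrite (_ : (1 + alpha + (- 1 - alpha))%R = 0%R); last by ring.
  by rewrite powRr0 mul1r.
rewrite (ge0_integral_affine1 0 s0 (f := fun r => (radial D xi r)%:E))//; last 2 first.
- by apply/measurable_EFinP; exact: measurable_radial2.
- by move=> r; rewrite lee_fin.
rewrite muleA -EFinM; congr (_%:E * _).
rewrite -(@powR_inv1 _ s) ?ltW// -powRD; last by apply/implyP => _; rewrite gt_eqF.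
by rewrite addrAC subrr add0r.
Qed.

Lemma measurable_shell : measurable [set y : 'rV[R]_d | (1 <= enorm y < 2)%R].
Proof.
rewrite (_ : [set y | _] = setT `&` @enorm R d @^-1` [set` `[1%R, 2%R[]).
  by apply: (@measurable_enorm R d) => //; exact: measurable_itv.
by apply/seteqP; split => y; rewrite /= in_itv/=; [split|case].
Qed.

Lemma measurable_dotv v : measurable_fun setT (dotv v).
Proof.
by apply: measurable_sum => i; apply: measurable_funM => //; exact: measurable_coord.
Qed.

(** On [1, 2) the radial density is at most 1, so every ray contributes at most 1 and the total is
    at most the mass of the sphere. *)
Lemma levy_measure_shell_lty : (0 < alpha)%R ->
  levy_measure alpha mu [set y | (1 <= enorm y < 2)%R] < +oo.
Proof.
move=> alpha0; rewrite levy_measureE.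
apply: (@le_lt_trans _ _ (\int[mu]_(xi in @esphere R d) cst 1 xi)).
  apply: ge0_le_integral => //.
  - exact: measurable_esphere.
  - by apply: measurable_funTS; apply: measurable_inner; exact: measurable_shell.
  move=> xi /= xi1.
  apply: (@le_trans _ _ (\int[lebesgue_measure]_r (\1_(`[1, 2[%classic : set R) r)%:E)).
    apply: ge0_le_integral => //.
    - by move=> r _; rewrite lee_fin.
    - by apply/measurable_EFinP; apply: measurable_radial2; exact: measurable_shell.
    - by apply/measurable_EFinP; exact: measurable_indic.
    move=> r _; rewrite lee_fin /radial indicE.
    have [|_] := boolP (r *: xi \in _); last by rewrite mul0r.
    rewrite mul1r in_setE/= enormZ xi1 mulr1 => /andP[r1 r2].
    have [r0|r0] := ltP 0%R r; last first.
      rewrite indicE memNset ?mul0r//= in_itv/= andbT; apply/negP.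
      by rewrite -leNgt.
    move: r1 r2; rewrite gtr0_norm// => r1 r2.
    rewrite !indicE !mem_set/= ?in_itv/= ?r1 ?r2 ?r0// mul1r.
    by rewrite -[leRHS](powRr0 r) ler_powR//; lra.
  rewrite integral_indic// setIT [leLHS]lebesgue_measure_itv/= lte_fin ltr1n.
  by rewrite -EFinD lee_fin; lra.
rewrite integral_cst; last exact: measurable_esphere.
by rewrite mul1e -ge0_fin_numE// fin_num_measure//; exact: measurable_esphere.
Qed.

Hypothesis hmu : is_spectral_measure mu.

(** Otherwise the open set where [dotv v] does not vanish is null, so it misses the support, which
    then lies in the kernel of this linear form. Nondegeneracy makes the kernel the whole space, yet
    it does not contain [v]. *)
Let spectral_gt0 v : v != 0%R ->
  0 < mu (@esphere R d `&` [set y | dotv v y != 0%R]).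
Proof.
move=> v0; have mO : measurable [set y : 'rV[R]_d | dotv v y != 0%R].
  rewrite (_ : [set y | _] = setT `&` dotv v @^-1` [set~ 0%R]).
    by apply: measurable_dotv => //; exact: measurableC.
  by apply/seteqP; split => y /=; [move/eqP; split|case=> _ /eqP].
rewrite lt0e measure_ge0 andbT; apply/negP => /eqP h.
have [mu0 _ muV] := hmu.
have h0 : mu [set y | dotv v y != 0%R] = 0.
  have mS := @measurable_esphere R d.
  set O := [set y | dotv v y != 0%R] in mO h *.
  have : mu O <= mu (@esphere R d `&` O) + mu (~` @esphere R d).
    rewrite -[X in mu X](setUIDK O (@esphere R d)) setIC.
    apply: (le_trans (measureU2 _ (measurableI _ _ mS mO) (measurableD mO mS))).
    rewrite leeD2l// le_measure ?inE//.
    - exact: measurableD.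
    - exact: measurableC.
  by rewrite h mu0 adde0 => ?; apply/eqP; rewrite eq_le measure_ge0 andbT.
have ker0 x : ((linfun (mulmxr v^T : 'rV[R]_d -> 'rV[R]_1)) x == 0%R) = (dotv v x == 0%R).
  rewrite lfunE/=; have -> : (x *m v^T)%R = const_mx (dotv v x).
    apply/rowP => i; rewrite !mxE (ord1 i); apply: eq_bigr => j _.
    by rewrite mxE mulrC.
  by apply/eqP/eqP => [/rowP/(_ ord0)|->]; [rewrite !mxE|apply/rowP => i; rewrite !mxE].
have kerT : lker (linfun (mulmxr v^T : 'rV[R]_d -> 'rV[R]_1)) = fullv.
  apply: muV => x /= xs; rewrite memv_ker ker0; apply: contraT => vx.
  have : open [set y : 'rV[R]_d | dotv v y != 0%R].
    rewrite (_ : [set y | _] = dotv v @^-1` [set~ 0%R]); last first.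
      by apply/seteqP; split => y /eqP.
    apply: open_comp; last by apply: closed_openC; exact: closed_eq.
    move=> y _; apply: lipschitz_continuous => u; exists (enorm v) => k _.
    by rewrite dotvDr addrC addKr normr_dotv_le.
  by move=> /xs/(_ vx); rewrite h0 ltxx.
have : v \in lker (linfun (mulmxr v^T : 'rV[R]_d -> 'rV[R]_1)) by rewrite kerT memvf.
rewrite memv_ker ker0 -sqr_enorm sqrf_eq0 => /eqP/enorm_eq0 v00.
by rewrite v00 eqxx in v0.
Qed.

Lemma measurable_shell_dotv v :
  measurable [set y : 'rV[R]_d | (1 <= enorm y < 2)%R /\ dotv v y != 0%R].
Proof.
rewrite (_ : [set y | _] = [set y | (1 <= enorm y < 2)%R] `&` dotv v @^-1` [set~ 0%R]).
  rewrite -[X in _ `&` X]setTI; apply: measurableI; first exact: measurable_shell.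
  by apply: measurable_dotv => //; exact: measurableC.
by apply/seteqP; split => y [y1 /eqP y2].
Qed.

(** The condition on the sign of [dotv v] is constant along rays, and on [1, 2) the density is at
    least 2^(- 1 - alpha). The claim thus reduces to positivity of the spectral measure off the
    hyperplane orthogonal to [v]. *)
Lemma levy_measure_shell_gt0 v : (0 < alpha)%R -> v != 0%R ->
  0 < levy_measure alpha mu [set y | (1 <= enorm y < 2)%R /\ dotv v y != 0%R].
Proof.
move=> alpha0 v0; have mS := @measurable_esphere R d.
have mO : measurable [set y : 'rV[R]_d | dotv v y != 0%R].
  rewrite (_ : [set y | _] = setT `&` dotv v @^-1` [set~ 0%R]).
    by apply: measurable_dotv => //; exact: measurableC.
  by apply/seteqP; split => y; [move/eqP; split|case=> _ /eqP].
set D := [set y | _]; have mD : measurable D by exact: measurable_shell_dotv.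
have c0 : (0 < 2 `^ (- 1 - alpha) :> R)%R by rewrite powR_gt0.
apply: (@lt_le_trans _ _ ((2 `^ (- 1 - alpha))%:E *
    mu (@esphere R d `&` [set y | dotv v y != 0%R]))).
  by rewrite mule_gt0// ?lte_fin// spectral_gt0.
rewrite levy_measureE -integral_cst; last exact: measurableI.
apply: (@le_trans _ _
  (\int[mu]_(xi in @esphere R d `&` [set y | dotv v y != 0%R]) inner D xi)); last first.
  apply: ge0_subset_integral => //; first exact: measurableI.
  by apply: measurable_funTS; exact: measurable_inner.
apply: ge0_le_integral => //.
- exact: measurableI.
- by move=> xi _; rewrite lee_fin ltW.
- by apply: measurable_funTS; exact: measurable_inner.
move=> xi /= [xi1 xiv].
apply: (@le_trans _ _
  (\int[lebesgue_measure]_r (2 `^ (- 1 - alpha) * \1_(`[1, 2[%classic : set R) r)%:E)).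
  under eq_integral do rewrite EFinM.
  rewrite ge0_integralZl_EFin//; last by apply/measurable_EFinP; exact: measurable_indic.
  rewrite integral_indic// setIT [X in _ <= _ * X]lebesgue_measure_itv/= lte_fin ltr1n.
  by rewrite -EFinD -EFinM lee_fin (_ : (2 - 1 = 1)%R) ?mulr1//; ring.
apply: ge0_le_integral => //.
- by apply/measurable_EFinP; apply: measurable_funM => //; exact: measurable_indic.
- by apply/measurable_EFinP; exact: measurable_radial2.
move=> r _; rewrite lee_fin [X in (_ * X)%R]indicE.
have [|_] := boolP (r \in (`[1%R, 2%R[%classic : set R)); last by rewrite mulr0.
rewrite in_setE/= in_itv/= mulr1 => /andP[r1 r2].
have r0 : (0 < r)%R by rewrite (lt_le_trans ltr01).
rewrite /radial indicE mem_set; last first.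
  rewrite /D/= enormZ xi1 mulr1 gtr0_norm// r1 r2; split => //.
  by rewrite dotvZr mulf_neq0// gt_eqF.
rewrite indicE mem_set/= ?in_itv/= ?r0// !mul1r.
rewrite (_ : (- 1 - alpha = - (1 + alpha))%R); last by ring.
rewrite !powRN lef_pV2 ?posrE ?powR_gt0//.
by rewrite ge0_ler_powR ?nnegrE ?ltW// addr_gt0.
Qed.

End levy_measure_properties.

Section dyadic.
Context (R : realType).

Lemma geometric_sum_le (a q : R) n : 0 <= a -> 0 <= q < 1 ->
  \sum_(0 <= k < n) a * q ^+ k <= a / (1 - q).
Proof.
move=> a0 /andP[q0 q1]; rewrite ler_pdivlMr ?subr_gt0//.
suff -> : (\sum_(0 <= i < n) a * q ^+ i) * (1 - q) = a * (1 - q ^+ n).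
  by rewrite ler_piMr// gerBl exprn_ge0.
elim: n => [|n IHn]; first by rewrite big_nil mul0r expr0 subrr mulr0.
by rewrite big_nat_recr//= mulrDl IHn exprS; ring.
Qed.

Lemma geometric_eseries_lty (a q : R) : 0 <= a -> 0 <= q < 1 ->
  (\sum_(0 <= k <oo) (a * q ^+ k)%:E < +oo)%E.
Proof.
move=> a0 q01; apply: (@le_lt_trans _ _ (a / (1 - q))%:E); last exact: ltry.
apply: lime_le.
  apply: is_cvg_nneseries => n _ _; rewrite lee_fin mulr_ge0// exprn_ge0//.
  by case/andP: q01.
by apply: nearW => n; rewrite sumEFin lee_fin geometric_sum_le.
Qed.

Lemma dyadic_ge1 (t : R) : 1 <= t -> exists k, 2 ^+ k <= t < 2 ^+ k * 2.
Proof.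
move=> t1; have ex : exists n, t < 2 ^+ n.
  exists (Num.truncn t).+1; rewrite (lt_le_trans (truncnS_gt t))//.
  by rewrite -natrX ler_nat ltnW// ltn_expl.
case: (ex_minnP ex) => -[|n] tn min_n; first by move: tn; rewrite expr0 ltNge t1.
exists n; rewrite -exprSr tn andbT leNgt; apply/negP => /min_n.
by rewrite ltnn.
Qed.

Lemma dyadic_lt1 (t : R) : 0 < t < 1 -> exists k, 2 ^- k.+1 <= t < 2 ^- k.+1 * 2.
Proof.
move=> /andP[t0 t1]; have ex : exists n, 2 ^- n <= t.
  exists (Num.truncn t^-1).+1; rewrite -[leRHS]invrK lef_pV2 ?posrE ?invr_gt0 ?exprn_gt0//.
  rewrite ltW// (lt_le_trans (truncnS_gt _))//.
  by rewrite -natrX ler_nat ltnW// ltn_expl.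
case: (ex_minnP ex) => -[|n] tn min_n; first by move: tn; rewrite expr0 invr1 leNgt t1.
exists n; rewrite tn/= [X in _ < X](_ : _ = 2 ^- n); last first.
  by rewrite exprSr invfM mulrAC -mulrA divff ?mulr1.
by rewrite ltNge; apply/negP => /min_n; rewrite ltnn.
Qed.

Lemma powR_exprn (x a : R) n : 0 <= x -> (x ^+ n) `^ a = (x `^ a) ^+ n.
Proof.
move=> x0; elim: n => [|n IHn]; first by rewrite !expr0 powR1.
by rewrite !exprS powRM ?exprn_ge0// IHn.
Qed.

Lemma powR2_lt1 (a : R) : a < 0 -> 2 `^ a < 1.
Proof.
by move=> a0; rewrite /powR pnatr_eq0/= expR_lt1 pmulr_llt0// ln_gt0// ltr1n.
Qed.

End dyadic.

(** * Dyadic shells and the lower bound for the exponent of the small jumps *)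

Section shells.
Context (R : realType) (d : nat).
Implicit Types (s : R) (y : 'rV[R]_d).

Definition shell s : set 'rV[R]_d := [set y | s <= enorm y < s * 2].

Definition uball : set 'rV[R]_d := [set y | enorm y < 1].

Lemma measurable_shellr s : measurable (shell s).
Proof.
rewrite (_ : shell s = setT `&` @enorm R d @^-1` [set` `[s, s * 2[]).
  by apply: (@measurable_enorm R d) => //; exact: measurable_itv.
by apply/seteqP; split => y; rewrite /= in_itv/=; [split|case].
Qed.

Lemma measurable_eball y s : measurable (eball y s).
Proof.
rewrite (_ : eball y s = setT `&` (fun z => enorm (z - y)) @^-1` [set` `]-oo, s[]).
  apply: (measurableT_comp (@measurable_enorm R d)) => //.
  have := @measurable_affine_rV R d (- y) 1.
  by under eq_fun do rewrite scale1r addrC.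
by apply/seteqP; split => z; rewrite /eball/= in_itv/=; [split|case].
Qed.

Lemma measurable_uball : measurable uball.
Proof.
rewrite (_ : uball = eball 0 1); first exact: measurable_eball.
by apply/seteqP; split => y; rewrite /uball/eball/= subr0.
Qed.

Lemma shell_preimage s (r : R) : 0 < r ->
  (fun y : 'rV[R]_d => r *: y) @^-1` shell (r * s) = shell s.
Proof.
move=> r0; apply/seteqP; split => y;
  by rewrite /shell/= enormZ gtr0_norm// -mulrA ler_pM2l// ltr_pM2l.
Qed.

End shells.

Section scaling_measure.
Context (R : realType) (d : nat) (alpha : R) (nu : {measure set 'rV[R]_d -> \bar R}).
Hypothesis halpha : 0 < alpha < 2.
Hypothesis nu_scale : forall (s : R) (D : set 'rV[R]_d), 0 < s -> measurable D ->
  nu ((fun y => s *: y) @^-1` D) = ((s `^ alpha)%:E * nu D)%E.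
Hypothesis nu_shell_lty : (nu (@shell R d 1) < +oo)%E.
Hypothesis nu_shell_gt0 : forall v : 'rV[R]_d, v != 0 ->
  (0 < nu (shell 1 `&` [set y | (dotv v y != 0)%R]))%E.
Local Open Scope ereal_scope.

Let alpha0 : (0 < alpha)%R. Proof. by case/andP: halpha. Qed.

Lemma nu_unscale (s : R) D : (0 < s)%R -> measurable D ->
  nu D = (s `^ (- alpha))%:E * nu ((fun y => s *: y) @^-1` D).
Proof.
move=> s0 mD; rewrite nu_scale// muleA -EFinM powRN mulVf ?mul1e//.
by rewrite gt_eqF// powR_gt0.
Qed.

Let M : R := fine (nu (@shell R d 1)).

Let M0 : (0 <= M)%R. Proof. exact: fine_ge0. Qed.

Let nu_shell1 : nu (@shell R d 1) = M%:E.
Proof. by rewrite fineK// ge0_fin_numE. Qed.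

Lemma nu_shell (s : R) : (0 < s)%R -> nu (@shell R d s) = (M * s `^ (- alpha))%:E.
Proof.
move=> s0; rewrite (nu_unscale s0); last exact: measurable_shellr.
have := @shell_preimage R d 1 _ s0; rewrite mulr1 => ->.
by rewrite nu_shell1 -EFinM mulrC.
Qed.

(** The shells of radii 2^k with k >= 0 cover the complement of the ball, and by scaling their
    masses are geometric of ratio 2^(- alpha) < 1. *)
Lemma nu_far_lty : nu (~` @uball R d) < +oo.
Proof.
apply: (@le_lt_trans _ _ (\sum_(0 <= k <oo) (M * (2 `^ (- alpha)) ^+ k)%:E)).
  rewrite (@eq_eseriesr _ _ (fun k => nu (@shell R d (2 ^+ k)))); last first.
    by move=> k _; rewrite nu_shell ?exprn_gt0// powR_exprn.
  apply: measure_sigma_subadditive.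
  - by move=> k; exact: measurable_shellr.
  - by apply: measurableC; exact: measurable_uball.
  - move=> y /negP; rewrite /uball/= -leNgt => /dyadic_ge1[k kP].
    by exists k.
apply: geometric_eseries_lty => //; rewrite powR_ge0/=.
by rewrite powR2_lt1// oppr_lt0.
Qed.

(** By scaling the shell of inner radius 2^(- k - 1) has mass of order 2^(k alpha), while the
    integrand is at most 2^(- 2k) there; the ratio 2^(alpha - 2) is below 1. The origin is in no
    shell, but the integrand vanishes at it. *)
Lemma nu_near_integrable : nu.-integrable (@uball R d) (fun y => (enorm y ^+ 2)%:E).
Proof.
have mE : measurable_fun setT (fun y : 'rV[R]_d => (enorm y ^+ 2)%R).
  by apply: measurable_funX; exact: measurable_enorm.
apply: (@integrable_ge0P _ _ _ _ _ (fun y => enorm y ^+ 2)%R).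
- exact: measurable_funTS.
- by move=> y _; rewrite sqr_ge0.
pose F k := @shell R d (2 ^- k.+1 : R).
have mF k : measurable (F k) by exact: measurable_shellr.
have -> : \int[nu]_(y in @uball R d) (enorm y ^+ 2)%:E =
    \int[nu]_(y in \bigcup_k F k) (enorm y ^+ 2)%:E.
  have UF : \bigcup_k F k `<=` @uball R d.
    move=> y [k _]; rewrite /F/uball/shell/= => /andP[_ /lt_le_trans]; apply.
    rewrite exprSr invfM mulrAC -mulrA divff// mulr1 invf_le1 ?exprn_gt0//.
    by rewrite exprn_ege1// ler1n.
  rewrite [LHS]integral_mkcond [RHS]integral_mkcond; apply: eq_integral => y _.
  rewrite !patchE; have [yU|yU] := boolP (y \in \bigcup_k F k).
    by rewrite mem_set//; apply: UF; move: yU; rewrite in_setE.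
  case: ifPn => //; rewrite in_setE /uball/= => y1.
  have [->|y0] := eqVneq y 0%R; first by rewrite enorm0 expr0n.
  have [|k kP] := @dyadic_lt1 R (enorm y); first by rewrite y1 enorm_gt0.
  by move: yU; rewrite notin_setE => /(_ (ex_intro2 _ _ k I kP)).
rewrite ge0_integral_bigcup//; last 3 first.
- by apply/measurable_EFinP; exact: measurable_funTS.
- by move=> y _; rewrite lee_fin sqr_ge0.
- apply/trivIsetP => i j _ _ ij; apply/seteqP; split => // y [].
  wlog : i j ij / (i < j)%N => [h Fi Fj|{}ij].
    by move: (ij); rewrite neq_ltn => /orP[/h|/h]; apply; rewrite // eq_sym.
  rewrite /F/shell/= => /andP[yi _] /andP[_]; apply/negP; rewrite -leNgt (le_trans _ yi)//.
  rewrite exprSr invfM mulrAC -mulrA divff// mulr1 lef_pV2 ?posrE ?exprn_gt0//.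
  by rewrite ler_weXn2l// ler1n.
apply: (@le_lt_trans _ _ (\sum_(0 <= k <oo) ((M * 2 `^ alpha) * (2 `^ (alpha - 2)) ^+ k)%:E)).
  apply: lee_nneseries => // k _.
    by move=> _; apply: integral_ge0 => y _; rewrite lee_fin sqr_ge0.
  apply: (@le_trans _ _ (\int[nu]_(y in F k) cst ((2 ^- k) ^+ 2)%:E y)).
    apply: ge0_le_integral => //.
    - by move=> y _; rewrite lee_fin sqr_ge0.
    - by apply/measurable_EFinP; exact: measurable_funTS.
    move=> y; rewrite /F/shell/= => /andP[_ /ltW].
    rewrite exprSr invfM mulrAC -mulrA divff// mulr1 => yk.
    by rewrite lee_fin ler_sqr ?nnegrE.
  rewrite integral_cst// nu_shell ?invr_gt0 ?exprn_gt0// -EFinM lee_fin.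
  rewrite le_eqVlt; apply/orP; left; apply/eqP.
  have -> : ((2 ^- k.+1) `^ (- alpha) = (2 `^ alpha) ^+ k.+1 :> R)%R.
    by rewrite -(powR_inv1 (exprn_ge0 _ _))// -powRrM mulN1r opprK powR_exprn.
  have -> : (2 `^ (alpha - 2) = 2 `^ alpha * (2 ^+ 2)^-1 :> R)%R.
    rewrite powRD; last by apply/implyP => _; rewrite pnatr_eq0.
    by rewrite powRN (@powR_mulrn _ 2%R 2%N).
  rewrite exprMn !exprVn -!exprM (mulnC 2%N) exprS.
  by move: (_ ^- _)%R (_ `^ _)%R => a b; ring.
apply: geometric_eseries_lty; first by rewrite mulr_ge0// powR_ge0.
by rewrite powR_ge0/= powR2_lt1// subr_lt0; case/andP: halpha.
Qed.

Lemma nu_integral_scale (s : R) (D : set 'rV[R]_d) (f : 'rV[R]_d -> \bar R) :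
  (0 < s)%R -> measurable D -> measurable_fun setT f -> (forall x, 0 <= f x) ->
  \int[nu]_(y in D) f y =
  (s `^ (- alpha))%:E * \int[nu]_(y in (fun y => s *: y)%R @^-1` D) f (s *: y)%R.
Proof.
move=> s0 mD mf f0.
have mphi : measurable_fun setT (fun y : 'rV[R]_d => s *: y)%R.
  by have := @measurable_affine_rV R d 0%R s; under eq_fun do rewrite add0r.
pose push : {measure set 'rV[R]_d -> \bar R} :=
  measure_function_pushforward__canonical__measure_function_Measure nu mphi.
transitivity (\int[mscale (NngNum (powR_ge0 s (- alpha))) push]_(y in D) f y).
  by apply: eq_measure_integral => A mA _; rewrite (nu_unscale s0).
rewrite ge0_integral_mscale//; last exact: measurable_funTS.
by rewrite /push ge0_integral_pushforward//; exact: measurable_funTS.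
Qed.

Definition psi (u : 'rV[R]_d) : R := (\int[nu]_(y in @uball R d) (1 - cos (dotv u y)))%R.

Let measurable_cosdot (u : 'rV[R]_d) D : measurable_fun D (fun y => 1 - cos (dotv u y))%R.
Proof.
apply: measurable_funTS; apply: measurable_funB => //.
apply: (measurableT_comp (f := @cos R)); last exact: measurable_dotv.
by apply: continuous_measurable_fun; exact: continuous_cos.
Qed.

Let measurable_sqrdot (u : 'rV[R]_d) D : measurable_fun D (fun y => dotv u y ^+ 2)%R.
Proof. by apply: measurable_funTS; apply: measurable_funX; exact: measurable_dotv. Qed.

Lemma integrable_one_minus_cos (u : 'rV[R]_d) :
  nu.-integrable (@uball R d) (fun y => (1 - cos (dotv u y))%:E).
Proof.
apply: (@integrable_dominated _ _ _ _ _ _ _ (fun y => enorm u ^+ 2 * enorm y ^+ 2)%R) => //.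
- exact: measurable_uball.
- exact: (integrableZl (@measurable_uball R d) (enorm u ^+ 2)%R nu_near_integrable).
move=> y _; rewrite ger0_norm ?subr_ge0 ?cos_le1// (le_trans (one_minus_cos_le _))//.
rewrite -exprMn (@le_trans _ _ (dotv u y ^+ 2)%R)//.
  by rewrite ler_pdivrMr// ler_peMr ?sqr_ge0// ler1n.
by rewrite -real_normK ?num_real// ler_sqr ?nnegrE ?mulr_ge0// normr_dotv_le.
Qed.

Lemma psi_ge0 u : (0 <= psi u)%R.
Proof. by apply: Rintegral_ge0 => y _; rewrite subr_ge0 cos_le1. Qed.

(** Second moment of the unit shell in direction [v]. Its minimum over unit vectors is the
    nondegeneracy constant that governs the growth of [psi]. *)
Let Q (v : 'rV[R]_d) : R := (\int[nu]_(y in shell 1) (dotv v y ^+ 2))%R.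

Let shell1_le (y : 'rV[R]_d) : shell 1 y -> (enorm y <= 2)%R.
Proof. by rewrite /shell/= mul1r => /andP[_ /ltW]. Qed.

Let integrable_cst_shell (k : R) : nu.-integrable (shell 1) (EFin \o cst k).
Proof.
apply/integrableP; split; first exact/measurable_EFinP.
rewrite -[ltLHS]/(\int[nu]_(y in shell 1) cst (`|k|%R%:E) y).
rewrite integral_cst; last exact: measurable_shellr.
by rewrite nu_shell1 -EFinM ltry.
Qed.

Let integrable_Q v : nu.-integrable (shell 1) (fun y => (dotv v y ^+ 2)%:E).
Proof.
apply: (@integrable_dominated _ _ _ _ _ _ _ (cst ((enorm v * 2) ^+ 2)%R)) => //.
  exact: measurable_shellr.
move=> y /shell1_le y2; rewrite normrX ler_sqr ?nnegrE ?mulr_ge0//.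
by rewrite (le_trans (normr_dotv_le _ _))// ler_wpM2l.
Qed.

Let continuous_Q : continuous Q.
Proof.
apply: lipschitz_continuous => u; exists ((2 * enorm u + 1) * 4 * M)%R => h h1.
rewrite /Q -RintegralB//; [|exact: measurable_shellr|exact: integrable_Q..].
apply: (@le_trans _ _ (\int[nu]_(y in shell 1) (cst ((2 * enorm u + 1) * 4 * enorm h) y))%R).
  apply: normr_Rintegral_le => //.
  - exact: measurable_shellr.
  - by apply: measurable_funB.
  move=> y /shell1_le y2; rewrite subr_sqr dotvDl addrAC addrN add0r/=.
  rewrite normrM mulrC -dotvDl -dotvDl.
  have h2 : (`|dotv (u + h + u) y| <= (2 * enorm u + 1) * 2)%R.
    rewrite (le_trans (normr_dotv_le _ _))// ler_pM//.
    have := ler_enormD (u + h) u; have := ler_enormD u h; lra.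
  have h3 : (`|dotv h y| <= enorm h * 2)%R.
    by rewrite (le_trans (normr_dotv_le _ _))// ler_wpM2l.
  rewrite (le_trans (ler_pM _ _ h2 h3))// le_eqVlt; apply/orP; left; apply/eqP.
  by ring.
rewrite Rintegral_cst; last exact: measurable_shellr.
by rewrite -/M le_eqVlt; apply/orP; left; apply/eqP; ring.
Qed.

(** If the integral of a square is zero, [dotv v] vanishes almost everywhere on the shell, against
    [nu_shell_gt0]. *)
Let Q_gt0 v : v != 0%R -> (0 < Q v)%R.
Proof.
move=> v0; rewrite lt0r; apply/andP; split; last by apply: Rintegral_ge0 => y _; rewrite sqr_ge0.
apply/negP => /eqP Qv.
have mS := @measurable_shellr R d 1.
have /(ae_eq_integral_abs nu mS) : \int[nu]_(y in shell 1) `|(dotv v y ^+ 2)%:E| = 0.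
  under eq_integral do rewrite /= ger0_norm ?sqr_ge0//.
  by rewrite (Rintegral_EFin mS (integrable_Q v)) -/(Q v) Qv.
move=> /(_ _) [|N [mN N0 sN]]; first exact/measurable_EFinP.
have := nu_shell_gt0 v0; rewrite lt0e => /andP[/negP + _]; apply.
apply/eqP; apply: (subset_measure0 _ mN _ N0).
  apply: measurableI => //; rewrite (_ : [set y | _] = setT `&` dotv v @^-1` [set~ 0%R]).
    by apply: measurable_dotv => //; exact: measurableC.
  by apply/seteqP; split => y; [move/eqP; split|case=> _ /eqP].
move=> y [Sy vy]; apply: sN => /(_ Sy)/= [] /eqP.
by rewrite sqrf_eq0; exact/negP.
Qed.

(** Compactness of the unit sphere turns positivity in each direction into a uniform lower bound. *)
Let Q_lower : exists2 c : R, (0 < c)%R & forall v, enorm v = 1%R -> (c <= Q v)%R.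
Proof.
(* The sphere is empty when [d = 0]; the bound then holds vacuously. *)
have [[v0 v01]|nS] := pselect (exists v : 'rV[R]_d, enorm v = 1%R); last first.
  by exists 1%R => // v v1; exfalso; apply: nS; exists v.
have cE : continuous (@enorm R d).
  apply: lipschitz_continuous => u; exists 1%R => h _; rewrite mul1r ler_norml.
  rewrite lerBlDl ler_enormD andbT lerNl opprB lerBlDl.
  by rewrite -{1}(addrK h u) (le_trans (ler_enormD _ _))// enormN addrC.
have cptS : compact (@esphere R d).
  apply: bounded_closed_compact.
    exists 1%R; split; first exact: num_real.
    move=> x x1 y /= y1; rewrite (le_trans _ (ltW x1))//.
    rewrite [leLHS]/Num.norm/= mx_normrE; apply/bigmax_leP; split => // -[i j] _ /=.
    by rewrite (ord1 i) -y1 coord_le_enorm.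
  by apply: (preimage_closed (f := @enorm R d) (D := [set 1%R]));
    [move=> ? _; exact: cE|exact: closed_eq].
have [||c cS cmin] := @EVT_min_rV R d Q (@esphere R d) _ cptS.
- by exists v0.
- by apply: continuous_subspaceT; exact: continuous_Q.
exists (Q c); last by move=> v v1; apply: cmin; rewrite inE.
apply: Q_gt0; apply/eqP => c0; move: cS; rewrite inE /esphere/= c0 enorm0 => /esym/eqP.
by rewrite oner_eq0.
Qed.

Lemma psi_lower : exists2 c : R, (0 < c)%R &
  forall u, (1 <= enorm u)%R -> (c * enorm u `^ alpha <= psi u)%R.
Proof.
have [c c0 cQ] := Q_lower.
(* The power of 2 comes from s^(- alpha) with s = 1/(2|u|). The 16 is 4 times 4: one factor from
   [one_minus_cos_ge], the other from (s |u|)^2 = 1/4. *)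
exists (2 `^ alpha / 16 * c)%R; first by rewrite !mulr_gt0// powR_gt0.
move=> u u1; have u0 : (0 < enorm u)%R by exact: lt_le_trans u1.
(* On the shell of radius [s] one has [|dotv u y| <= 1], where [1 - cos] is quadratic. *)
pose s := ((2 * enorm u)^-1)%R; have s0 : (0 < s)%R by rewrite invr_gt0 mulr_gt0.
have sE : (s * 2 = (enorm u)^-1)%R by rewrite /s; field; rewrite gt_eqF.
have mS := @measurable_shellr R d s.
have sU : shell s `<=` @uball R d.
  move=> y; rewrite /shell/uball/= sE => /andP[_ /lt_le_trans]; apply.
  by rewrite invf_le1.
rewrite -lee_fin /psi -(Rintegral_EFin (@measurable_uball R d)); last first.
  exact: integrable_one_minus_cos.
apply: (@le_trans _ _ (\int[nu]_(y in shell s) (1 - cos (dotv u y))%:E)); last first.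
  apply: ge0_subset_integral => //; first exact: measurable_uball.
  exact/measurable_EFinP.
apply: (@le_trans _ _ (\int[nu]_(y in shell s) (4^-1 * dotv u y ^+ 2)%:E)); last first.
  apply: ge0_le_integral => //.
  - by move=> y _; rewrite lee_fin mulr_ge0// sqr_ge0.
  - by apply/measurable_EFinP; exact: measurable_funM.
  - exact/measurable_EFinP.
  move=> y; rewrite /shell/= sE => /andP[_ y1]; rewrite lee_fin mulrC one_minus_cos_ge//.
  rewrite (le_trans (normr_dotv_le _ _))// -[leRHS](divff (lt0r_neq0 u0)).
  by rewrite ler_wpM2l// ltW.
rewrite (nu_integral_scale s0)//; last 2 first.
- by apply/measurable_EFinP; exact: measurable_funM.
- by move=> y; rewrite lee_fin mulr_ge0// sqr_ge0.
have := @shell_preimage R d 1 _ s0; rewrite mulr1 => ->.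
pose v := ((enorm u)^-1 *: u)%R.
have v1 : enorm v = 1%R by rewrite enormZ gtr0_norm ?invr_gt0// mulVf// gt_eqF.
rewrite (eq_integral (fun y => (16^-1 * dotv v y ^+ 2)%:E)); last first.
  move=> y _; congr EFin; rewrite dotvZr /v dotvZl.
  by rewrite /s; field; rewrite gt_eqF.
rewrite (@Rintegral_EFin _ _ _ nu _ (@measurable_shellr R d 1)
  (fun y => 16^-1 * dotv v y ^+ 2)%R); last first.
  exact: (integrableZl (@measurable_shellr R d 1) 16^-1%R (integrable_Q v)).
rewrite -EFinM lee_fin (RintegralZl _ (@measurable_shellr R d 1) (integrable_Q v)).
rewrite -/(Q v).
have -> : (s `^ (- alpha) = 2 `^ alpha * enorm u `^ alpha)%R.
  by rewrite /s -(powR_inv1 (_ : 0 <= 2 * enorm u)%R) ?mulr_ge0// -powRrM mulN1r opprK powRM.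
rewrite (_ : _ * _ * _ * _ = 2 `^ alpha * enorm u `^ alpha * (16^-1 * c))%R; last by ring.
by rewrite ler_wpM2l ?mulr_ge0 ?powR_ge0// ler_wpM2l// cQ.
Qed.

Lemma nu_eball (gamma : R) : is_gamma_measure nu gamma ->
  exists2 c : R, (0 <= c)%R & forall (y : 'rV[R]_d) r, (0 < r < enorm y / 2)%R ->
    nu (eball y r) <= (c * enorm y `^ (- alpha - gamma) * r `^ gamma)%:E.
Proof.
(* The constant of the gamma-measure property has no prescribed sign; the later estimates multiply
   by it and want it nonnegative. *)
move=> [c hc]; exists (Num.max c 0%R); first by rewrite le_max lexx orbT.
move=> y r /andP[r0 ry].
have y0 : (0 < enorm y)%R by have := lt_trans r0 ry; rewrite pmulr_lgt0.
rewrite (nu_unscale y0); last exact: measurable_eball.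
have -> : (fun z : 'rV[R]_d => enorm y *: z)%R @^-1` eball y r =
    eball ((enorm y)^-1 *: y)%R (r / enorm y)%R.
  have E z : (enorm (enorm y *: z - y) = enorm (z - (enorm y)^-1 *: y) * enorm y)%R.
    rewrite mulrC -[X in (X * enorm (z - _))%R](gtr0_norm y0) -enormZ scalerBr scalerA.
    by rewrite divff ?gt_eqF// scale1r.
  by apply/seteqP; split => z; rewrite /eball/= ltr_pdivlMr// E.
(* After normalizing the centre, [r < enorm y / 2] is exactly the condition that the new radius be
   below 1/2. *)
have := hc ((enorm y)^-1 *: y)%R (r / enorm y)%R.
rewrite enormZ gtr0_norm ?invr_gt0// mulVf ?gt_eqF// => /(_ erefl).
rewrite divr_gt0// ltr_pdivrMr// mulrC mul1r => /(_ ry) h.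
have a0 : (0 <= enorm y `^ (- alpha))%R by exact: powR_ge0.
apply: (@le_trans _ _ ((enorm y `^ (- alpha))%:E * (c * (r / enorm y) `^ gamma)%:E)).
  by rewrite lee_wpmul2l// mulrC.
rewrite -EFinM lee_fin.
apply: (@le_trans _ _ (enorm y `^ (- alpha) * (Num.max c 0 * (r / enorm y) `^ gamma))%R).
  by rewrite ler_wpM2l// ler_wpM2r ?powR_ge0// le_max lexx.
rewrite powRM ?invr_ge0 ?(ltW r0)// -(powR_inv1 (ltW y0)) -powRrM mulN1r.
rewrite powRD; last by apply/implyP => _; rewrite gt_eqF.
by rewrite le_eqVlt; apply/orP; left; apply/eqP; ring.
Qed.

End scaling_measure.

(** * Convolution of the weight with the large jumps *)

Section weight_convolution.
Context (R : realType) (d : nat) (nu : {finite_measure set 'rV[R]_d -> \bar R}).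
Variables (alpha gamma c : R).
Hypotheses (alpha0 : 0 < alpha) (kappa0 : 0 < alpha + gamma) (c0 : 0 <= c).
Hypothesis nu_ball : forall (y : 'rV[R]_d) r, 0 < r < enorm y / 2 ->
  (nu (eball y r) <= (c * enorm y `^ (- alpha - gamma) * r `^ gamma)%:E)%E.
Implicit Types (y z : 'rV[R]_d).

Let kappa := alpha + gamma.

Definition weight y : R := bracket y `^ (- alpha - gamma).

Let weightE y : weight y = bracket y `^ (- kappa).
Proof. by rewrite /weight /kappa opprD. Qed.

Lemma weight_gt0 y : 0 < weight y.
Proof. by rewrite powR_gt0. Qed.

Lemma weight_ge0 y : 0 <= weight y.
Proof. exact/ltW/weight_gt0. Qed.

Lemma measurable_weight : measurable_fun setT weight.
Proof. exact: (measurableT_comp (measurable_powR _) (@measurable_bracket R d)). Qed.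

Let powRN_anti (a b : R) : 0 < a -> a <= b -> b `^ (- kappa) <= a `^ (- kappa).
Proof.
move=> a0 ab; have b0 : 0 < b by exact: lt_le_trans ab.
rewrite !powRN lef_pV2 ?posrE ?powR_gt0// ge0_ler_powR ?nnegrE//; exact: ltW.
Qed.

Lemma weight_le1 y : weight y <= 1.
Proof. by rewrite weightE (le_trans (powRN_anti ltr01 (bracket_ge1 y)))// powR1. Qed.

(* [weight (y - z)] is at most a multiple of [weight y], except for [z] in the dyadic
   balls [eball y (2 ^+ k)] with [2 ^+ k < enorm y / 2], where [coef y k] compensates. *)
Let coef y k : R := (2 ^+ k < enorm y / 2)%R%:R * (2 `^ kappa * (2 ^+ k) `^ (- kappa)).

Let coef_ge0 y k : 0 <= coef y k.
Proof. by rewrite /coef !mulr_ge0 ?powR_ge0. Qed.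

(** If [bracket (y - z)] is less than a quarter of [bracket y], then 4|y - z| + 3 < |y|. Hence the
    least power of 2, from 1 on, that exceeds |y - z| is still below |y|/2, and its ball contains z;
    2^kappa pays for rounding up to a power of 2. [N] only makes the sum finite, as the coefficients
    vanish from [N] on. *)
Let weight_sub_le y z N : enorm y < 2 ^+ N ->
  weight (y - z) <= 4 `^ kappa * weight y +
    \sum_(0 <= k < N) coef y k * \1_(eball y (2 ^+ k)) z.
Proof.
move=> yN.
have term_ge0 k : 0 <= coef y k * \1_(eball y (2 ^+ k)) z :> R by rewrite mulr_ge0.
have [yz|yz] := leP (bracket y / 4) (bracket (y - z)).
  rewrite ler_wpDr ?sumr_ge0// !weightE (le_trans (powRN_anti _ yz))//.
    by rewrite divr_gt0.
  rewrite powRM// -(powR_inv1 (ler0n R 4)) -powRrM mulN1r opprK mulrC//.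
rewrite ler_wpDl ?mulr_ge0 ?powR_ge0//.
have tE : enorm (z - y) = enorm (y - z) by exact: enorm_sub.
have yz' : 4 * enorm (y - z) + 3 < enorm y.
  by move: yz; rewrite /bracket ltr_pdivlMr//; lra.
have t0 := enorm_ge0 (y - z).
suff [k [kN ky kz wk]] : exists k, [/\ (k < N)%N, 2 ^+ k < enorm y / 2,
    enorm (z - y) < 2 ^+ k & weight (y - z) <= 2 `^ kappa * (2 ^+ k) `^ (- kappa)].
  rewrite (bigD1_seq k) ?mem_index_iota ?iota_uniq//= ler_wpDr ?sumr_ge0//.
  by rewrite /coef ky mul1r indicE mem_set// mulr1.
have kN k : 2 ^+ k < enorm y / 2 -> (k < N)%N.
  move=> h; rewrite -(ltr_eXn2l (ltr1n R 2)) (lt_trans h)// (le_lt_trans _ yN)//.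
  by rewrite ler_pdivrMr// ler_peMr// ler1n.
have [t1|t1] := ltP (enorm (y - z)) 1.
  exists 0%N; rewrite expr0 tE; have h : 1 < enorm y / 2 by rewrite ltr_pdivlMr//; lra.
  split => //; first by apply: kN; rewrite expr0.
  rewrite (le_trans (weight_le1 _))// powR1 mulr1 -[leLHS](powRr0 2) ler_powR ?ler1n//.
  exact: ltW.
have [j /andP[j1 j2]] := dyadic_ge1 t1.
have h : 2 ^+ j.+1 < enorm y / 2 by rewrite exprSr ltr_pdivlMr//; lra.
exists j.+1; rewrite tE {2}exprSr; split => //; first exact: kN.
rewrite weightE (@le_trans _ _ ((2 ^+ j) `^ (- kappa)))//.
  rewrite powRN_anti ?exprn_gt0// (le_trans j1)// /bracket; lra.
rewrite exprS powRM ?exprn_ge0// mulrA -powRD; last by rewrite pnatr_eq0 implybT.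
by rewrite subrr powRr0 mul1r.
Qed.

(** The first term of [weight_sub_le] integrates to a multiple of the total mass. In the k-th term
    the ball has mass at most c |y|^(- kappa) 2^(k gamma) against a coefficient of order 2^(- k
    kappa), which leaves a geometric series of ratio 2^(- alpha). *)
Lemma weight_convolution_le : exists2 K : R, 0 <= K &
  forall y, (\int[nu]_z (weight (y - z))%:E <= (K * weight y)%:E)%E.
Proof.
pose m := fine (nu setT).
have nuT : nu setT = m%:E by rewrite fineK// fin_num_measure.
have m0 : 0 <= m by exact: fine_ge0.
have q1 : 0 <= (2 : R) `^ (- alpha) < 1 by rewrite powR_ge0 powR2_lt1// oppr_lt0.
pose K2 := 2 `^ kappa * c * 2 `^ kappa / (1 - 2 `^ (- alpha)).
have K20 : 0 <= K2.
  rewrite /K2 divr_ge0// ?mulr_ge0 ?powR_ge0// subr_ge0 ltW//.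
  by case/andP: q1.
exists (4 `^ kappa * m + K2); first by rewrite addr_ge0// mulr_ge0// powR_ge0.
move=> y; have [N yN] : exists N, enorm y < 2 ^+ N.
  exists (Num.truncn (enorm y)).+1; rewrite (lt_le_trans (truncnS_gt _))//.
  by rewrite -natrX ler_nat ltnW// ltn_expl.
have m1 k : measurable_fun setT (\1_(eball y (2 ^+ k)) : 'rV[R]_d -> R).
  by apply: measurable_indic; exact: measurable_eball.
have mw : measurable_fun setT (fun z => weight (y - z)).
  apply: (measurableT_comp measurable_weight).
  apply: measurable_fun_mx => i j; under eq_fun do rewrite !mxE.
  by apply: measurable_funB => //; exact: measurable_coord.
apply: (@le_trans _ _ (\int[nu]_z ((4 `^ kappa * weight y)%R%:E +
    \sum_(0 <= k < N) (coef y k)%:E * (\1_(eball y (2 ^+ k)%R) z)%:E))%E).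
  apply: ge0_le_integral => //.
  - by move=> z _; rewrite lee_fin weight_ge0.
  - exact/measurable_EFinP.
  - apply: emeasurable_funD => //; apply: emeasurable_sum => k.
    by apply: emeasurable_funM => //; exact/measurable_EFinP.
  move=> z _; under eq_bigr do rewrite -EFinM.
  by rewrite sumEFin -EFinD lee_fin weight_sub_le.
have w0 := weight_ge0 y.
have S0 k z : (0 <= (coef y k)%:E * (\1_(eball y (2 ^+ k)) z)%:E)%E.
  by rewrite -EFinM lee_fin mulr_ge0.
have mS k : measurable_fun setT (fun z => (coef y k)%:E * (\1_(eball y (2 ^+ k)) z)%:E)%E.
  by apply: emeasurable_funM => //; exact/measurable_EFinP.
rewrite ge0_integralD//; last 3 first.
- by move=> z _; rewrite lee_fin mulr_ge0// powR_ge0.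
- by move=> z _; apply: sume_ge0.
- exact: emeasurable_sum.
rewrite mulrDl EFinD; apply: leeD.
  have -> : (\int[nu]_z (4 `^ kappa * weight y)%R%:E = (4 `^ kappa * weight y)%R%:E * m%:E)%E.
    by rewrite (integral_cst nu measurableT); congr (_ * _)%E; exact: nuT.
  by rewrite -EFinM lee_fin mulrAC.
rewrite ge0_integral_sum//.
apply: (@le_trans _ _ (\sum_(0 <= k < N) (2 `^ kappa * c * (2 `^ kappa * weight y) *
   (2 `^ (- alpha)) ^+ k)%:E)%E).
  apply: lee_sum => k _; rewrite ge0_integralZl_EFin//; last exact/measurable_EFinP.
  rewrite integral_indic//; last exact: measurable_eball.
  rewrite setIT /coef; have [ky|_] := boolP (2 ^+ k < enorm y / 2)%R; last first.
    by rewrite mul0r mul0e lee_fin !mulr_ge0// ?exprn_ge0 ?powR_ge0.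
  rewrite mul1r; have := @nu_ball y (2 ^+ k); rewrite exprn_gt0// ky => /(_ isT) hb.
  apply: (le_trans (lee_wpmul2l _ hb)); first by rewrite lee_fin mulr_ge0// powR_ge0.
  have y1 : 1 < enorm y.
    have : 1 <= 2 ^+ k :> R by rewrite exprn_ege1// ler1n.
    by move=> /le_lt_trans /(_ ky); rewrite ltr_pdivlMr//; lra.
  have y0 : 0 < enorm y by exact: lt_trans y1.
  (* A nonzero coefficient forces |y| > 1, so |y| is comparable with [bracket y] and the singularity
     of the power at the origin is harmless. *)
  have yw : enorm y `^ (- kappa) <= 2 `^ kappa * weight y.
    apply: (@le_trans _ _ ((bracket y / 2) `^ (- kappa))).
      by apply: powRN_anti; rewrite ?divr_gt0// ler_pdivrMr// /bracket; lra.
    by rewrite powRM// -(powR_inv1 (ler0n R 2)) -powRrM mulN1r opprK mulrC weightE.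
  rewrite -EFinM lee_fin -powR_exprn// (_ : - alpha = - kappa + gamma); last first.
    by rewrite /kappa; ring.
  rewrite (_ : - kappa + gamma - gamma = - kappa); last by ring.
  rewrite (@powRD _ (2 ^+ k) (- kappa) gamma); last first.
    by apply/implyP => _; rewrite gt_eqF// exprn_gt0.
  rewrite [leLHS](_ : _ = 2 `^ kappa * c * enorm y `^ (- kappa) *
    ((2 ^+ k) `^ (- kappa) * (2 ^+ k) `^ gamma)); last by ring.
  by rewrite ler_wpM2r ?mulr_ge0 ?powR_ge0// ler_wpM2l// mulr_ge0// powR_ge0.
rewrite sumEFin lee_fin /K2 (le_trans (geometric_sum_le _ _ q1))//.
  by rewrite !mulr_ge0 ?powR_ge0.
by rewrite le_eqVlt; apply/orP; left; apply/eqP; ring.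
Qed.

End weight_convolution.

(** * Fourier decay for the small jumps *)

Section parameter_integrals.
Context d (T : measurableType d) (R : realType) (mu : {measure set T -> \bar R}).
Variables (D : set T) (mD : measurable D).
Implicit Types f g : T -> R.

Lemma integrable_lin f1 f0 f2 t : mu.-integrable D (EFin \o f1) ->
  mu.-integrable D (EFin \o f0) -> mu.-integrable D (EFin \o f2) ->
  mu.-integrable D (EFin \o (fun x => f1 x - f0 x - t * f2 x)).
Proof.
move=> i1 i0 i2.
rewrite (_ : EFin \o _ = (((EFin \o f1) \- (EFin \o f0)) \-
  (fun x => t%:E * (EFin \o f2) x))%E); last first.
  by apply/funext => x; rewrite /= !EFinB EFinM.
exact: (integrableB mD (integrableB mD i1 i0) (integrableZl mD t i2)).
Qed.

Lemma Rintegral_taylor f1 f0 f2 g t s : mu.-integrable D (EFin \o f1) ->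
  mu.-integrable D (EFin \o f0) -> mu.-integrable D (EFin \o f2) ->
  mu.-integrable D (EFin \o g) ->
  (forall x, D x -> `|f1 x - f0 x - t * f2 x| <= s * g x) ->
  `|\int[mu]_(x in D) f1 x - \int[mu]_(x in D) f0 x - t * \int[mu]_(x in D) f2 x|
    <= s * \int[mu]_(x in D) g x.
Proof.
move=> i1 i0 i2 ig h; have ih := integrable_lin t i1 i0 i2.
have itf2 : mu.-integrable D (EFin \o (fun x => t * f2 x)).
  exact: (integrableZl mD t i2).
have i10 : mu.-integrable D (EFin \o (fun x => f1 x - f0 x)).
  rewrite (_ : EFin \o _ = ((EFin \o f1) \- (EFin \o f0))%E); first exact: integrableB.
  by apply/funext => x; rewrite /= EFinB.
rewrite -(RintegralZl t mD i2) -(RintegralB mD i1 i0) -(RintegralB mD i10 itf2).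
rewrite -(RintegralZl s mD ig); apply: normr_Rintegral_le => //.
  by apply/measurable_EFinP; exact: measurable_int ih.
exact: (integrableZl mD s ig).
Qed.

Lemma normr_RintegralB_le f1 f0 g : mu.-integrable D (EFin \o f1) ->
  mu.-integrable D (EFin \o f0) -> mu.-integrable D (EFin \o g) ->
  (forall x, D x -> `|f1 x - f0 x| <= g x) ->
  `|\int[mu]_(x in D) f1 x - \int[mu]_(x in D) f0 x| <= \int[mu]_(x in D) g x.
Proof.
move=> i1 i0 ig h.
have := @Rintegral_taylor f1 f0 f0 g 0 1 i1 i0 i0 ig; rewrite mul0r subr0 mul1r; apply.
by move=> x Dx; rewrite mul0r subr0 mul1r h.
Qed.

End parameter_integrals.

Section exponential_estimates.
Context (R : realType).
Implicit Types x p : R.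

Lemma expR_sub1_le x : expR x - 1 <= x * expR x.
Proof.
have := expR_ge1Dx (- x); rewrite expRN => h.
have ex := expR_gt0 x.
have : (1 - x) * expR x <= (expR x)^-1 * expR x by rewrite ler_wpM2r// ltW.
by rewrite mulVf ?gt_eqF// mulrBl mul1r; lra.
Qed.

(** With z = - x one has 0 <= e^z - 1 - z <= z (e^z - 1), which is at most z^2 e^z or z^2 according
    to the sign of z. Using the exponential at both endpoints covers both cases without any bound on
    [x], and both endpoint values decay when p is an exponent. *)
Lemma expRN_taylor p x :
  `|expR (- (p + x)) - expR (- p) + x * expR (- p)| <=
    x ^+ 2 * (expR (- p) + expR (- (p + x))).
Proof.
rewrite opprD expRD; set e := expR (- p); have e0 : 0 < e by exact: expR_gt0.
have -> : e * expR (- x) - e + x * e = (expR (- x) - 1 - (- x)) * e by ring.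
have -> : x ^+ 2 * (e + e * expR (- x)) = ((- x) ^+ 2 * (1 + expR (- x))) * e by ring.
rewrite normrM (gtr0_norm e0) ler_wpM2r ?(ltW e0)//.
move: (- x) => z; have ez := expR_gt0 z.
have h1 := expR_ge1Dx z; have h2 := expR_sub1_le z.
rewrite ger0_norm; last by lra.
move: (expR z) ez h1 h2 => E ez h1 h2.
have [z0|z0] := leP 0 z.
  have h3 : z * (E - 1) <= z * (z * E) by rewrite ler_wpM2l.
  have h4 := sqr_ge0 z; rewrite expr2 in h4 *; lra.
have h3 : z * (E - 1) <= z * z by rewrite ler_wnM2l ?(ltW z0)//; lra.
have h4 := mulr_ge0 (sqr_ge0 z) (ltW ez); rewrite expr2 in h4 *; lra.
Qed.

Lemma exprn_le_expR x n : 0 <= x -> x ^+ n <= n`!%:R * expR x.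
Proof.
move=> x0; case: n => [|n].
  by rewrite expr0 fact0 mul1r (le_trans _ (expR_ge1Dx x))// lerDl.
have h := expR_ge1Dxn n x0; have n0 : (0 : R) < (n.+1)`!%:R by rewrite ltr0n fact_gt0.
by rewrite mulrC -ler_pdivrMr// (le_trans _ h)// lerDr.
Qed.

End exponential_estimates.

Section growth.
Context (R : realType) (d : nat).
Implicit Types (f g : 'rV[R]_d -> R) (u h : 'rV[R]_d).

Definition poly_bounded f := exists N, exists2 C, 0 <= C & forall u, `|f u| <= C * bracket u ^+ N.

Definition rapid f := forall N, exists2 C, 0 <= C & forall u, `|f u| * bracket u ^+ N <= C.

Lemma poly_bounded_le f g : poly_bounded g -> (forall u, `|f u| <= `|g u|) -> poly_bounded f.
Proof.
move=> [N [C C0 gC]] fg; exists N, C => // u; exact: le_trans (fg u) (gC u).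
Qed.

Lemma rapid_le f g : rapid g -> (forall u, `|f u| <= `|g u|) -> rapid f.
Proof.
move=> rg fg N; have [C C0 gC] := rg N; exists C => // u.
by rewrite (le_trans _ (gC u))// ler_wpM2r// exprn_ge0.
Qed.

Lemma poly_bounded_cst c : poly_bounded (fun=> c).
Proof. by exists 0%N, `|c| => // u; rewrite expr0 mulr1. Qed.

Lemma poly_bounded_coord j : poly_bounded (fun u => u ord0 j).
Proof. by exists 1%N, 1 => // u; rewrite expr1 mul1r coord_le_bracket. Qed.

Lemma poly_boundedD f g : poly_bounded f -> poly_bounded g ->
  poly_bounded (fun u => f u + g u).
Proof.
move=> [N1 [C1 C10 h1]] [N2 [C2 C20 h2]]; exists (N1 + N2)%N, (C1 + C2).
  exact: addr_ge0.
move=> u; rewrite (le_trans (ler_normD _ _))// mulrDl lerD//.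
  by rewrite (le_trans (h1 u))// ler_wpM2l// ler_weXn2l// leq_addr.
by rewrite (le_trans (h2 u))// ler_wpM2l// ler_weXn2l// leq_addl.
Qed.

Lemma poly_boundedM f g : poly_bounded f -> poly_bounded g ->
  poly_bounded (fun u => f u * g u).
Proof.
move=> [N1 [C1 C10 h1]] [N2 [C2 C20 h2]]; exists (N1 + N2)%N, (C1 * C2).
  exact: mulr_ge0.
by move=> u; rewrite normrM exprD mulrACA ler_pM.
Qed.

Lemma poly_bounded_norm f : poly_bounded f -> poly_bounded (fun u => `|f u|).
Proof. by move/poly_bounded_le; apply => u; rewrite normr_id. Qed.

Lemma rapidD f g : rapid f -> rapid g -> rapid (fun u => f u + g u).
Proof.
move=> rf rg N; have [C1 C10 h1] := rf N; have [C2 C20 h2] := rg N.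
exists (C1 + C2); first exact: addr_ge0.
move=> u; rewrite (le_trans _ (lerD (h1 u) (h2 u)))// -mulrDl ler_wpM2r ?exprn_ge0//.
exact: ler_normD.
Qed.

Lemma rapidM f g : poly_bounded f -> rapid g -> rapid (fun u => f u * g u).
Proof.
move=> [N1 [C1 C10 h1]] rg N; have [C2 C20 h2] := rg (N1 + N)%N.
exists (C1 * C2); first exact: mulr_ge0.
move=> u; rewrite normrM; apply: le_trans (ler_wpM2l C10 (h2 u)).
rewrite exprD [leRHS](_ : _ = C1 * bracket u ^+ N1 * `|g u| * bracket u ^+ N); last by ring.
by rewrite !ler_wpM2r ?exprn_ge0.
Qed.

Lemma rapid_norm f : rapid f -> rapid (fun u => `|f u|).
Proof. by move/rapid_le; apply => u; rewrite normr_id. Qed.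

Lemma bracket_le2 h : enorm h <= 1 -> bracket h <= 2.
Proof. by rewrite /bracket; lra. Qed.

Lemma poly_bounded_shift f : poly_bounded f ->
  exists2 g, poly_bounded g & forall u h, enorm h <= 1 -> `|f (u + h)| <= g u.
Proof.
move=> [N [C C0 fC]]; exists (fun u => C * 2 ^+ N * bracket u ^+ N).
  exists N, (C * 2 ^+ N) => [|u]; first by rewrite mulr_ge0.
  by rewrite ger0_norm// !mulr_ge0// exprn_ge0.
move=> u h h1; rewrite (le_trans (fC _))// -mulrA ler_wpM2l// -exprMn.
rewrite lerXn2r ?nnegrE ?mulr_ge0// (le_trans (bracketD _ _))// mulrC.
by rewrite ler_wpM2r// bracket_le2.
Qed.

(** A single majorant must serve all exponents [N], so it is the supremum of the translates over the
    unit ball and not a bound derived from one particular [N]. *)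
Lemma rapid_shift f : rapid f ->
  exists2 g, rapid g & forall u h, enorm h <= 1 -> `|f (u + h)| <= g u.
Proof.
move=> rf; pose S u : set R := [set `|f (u + h)| | h in [set h | enorm h <= 1]].
have S0 u : S u !=set0.
  by exists `|f (u + 0)|, 0 => //=; rewrite enorm0.
have bnd u h N C : (forall u, `|f u| * bracket u ^+ N <= C) -> enorm h <= 1 ->
    `|f (u + h)| <= 2 ^+ N * C / bracket u ^+ N.
  move=> fC h1; rewrite ler_pdivlMr ?exprn_gt0//.
  rewrite (@le_trans _ _ (2 ^+ N * (`|f (u + h)| * bracket (u + h) ^+ N)))//; last first.
    by rewrite ler_wpM2l// exprn_ge0.
  rewrite mulrCA ler_wpM2l// -exprMn lerXn2r ?nnegrE ?mulr_ge0//.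
  rewrite (le_trans (bracket_shift u h))// mulrC ler_wpM2r// bracket_le2//.
have Sub u : has_ubound (S u).
  have [C C0 fC] := rf 0%N; exists (2 ^+ 0 * C / bracket u ^+ 0) => _ [h h1 <-].
  exact: bnd.
exists (fun u => sup (S u)); last first.
  by move=> u h h1; apply: ub_le_sup => //; exists h.
move=> N; have [C C0 fC] := rf N; exists (2 ^+ N * C); first by rewrite mulr_ge0.
move=> u; rewrite ger0_norm; last first.
  by apply: (@le_trans _ _ `|f (u + 0)|) => //;
    apply: ub_le_sup => //; exists 0 => //=; rewrite enorm0.
rewrite -ler_pdivlMr ?exprn_gt0//; apply: ge_sup => // _ [h h1 <-].
exact: bnd.
Qed.

Lemma rapid_integrable f : measurable_fun setT f -> rapid f ->
  (lebesgue_measure_rV R d).-integrable setT (EFin \o f).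
Proof.
move=> mf rf; have [C C0 fC] := rf d.*2.
apply: (@integrable_dominated _ _ _ _ _ measurableT _ (fun u => C * bracket u ^- d.*2)) => //.
  exact: (integrableZl measurableT C (integrable_bracketV R (leqnn _))).
by move=> u _; rewrite ler_pdivlMr// exprn_gt0.
Qed.

End growth.

Section taylor_classes.
Context (R : realType) (d : nat).
Implicit Types (f g : 'rV[R]_d -> R) (u : 'rV[R]_d) (i : 'I_d) (t : R).

Definition evec i : 'rV[R]_d := delta_mx ord0 i.

(* Integrated against a Lebesgue integral, this remainder bound and translation invariance
   suffice to integrate by parts. *)
Definition taylor i f f' (W : 'rV[R]_d -> R) := forall u t, `|t| <= 1 ->
  `|f (u + t *: evec i) - f u - t * f' u| <= t ^+ 2 * W u.

Lemma enorm_evec i t : `|t| <= 1 -> enorm (t *: evec i) <= 1.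
Proof. by move=> t1; rewrite enormZ enorm_delta mulr1. Qed.

(** The remainder of a product is (remainder of f) g(u + t e) + (f + t f') (remainder of g) + t^2 f'
    g'. The first term involves g at the shifted point, hence the extra majorant [Sg]. *)
Lemma taylorM i f f' g g' Wf Wg Sg : taylor i f f' Wf -> taylor i g g' Wg ->
  (forall u t, `|t| <= 1 -> `|g (u + t *: evec i)| <= Sg u) ->
  taylor i (fun u => f u * g u) (fun u => f' u * g u + f u * g' u)
    (fun u => Wf u * Sg u + (`|f u| + `|f' u|) * Wg u + `|f' u| * `|g' u|).
Proof.
move=> tf tg sg u t t1; have := tf u t t1; have := tg u t t1; have := sg u t t1.
move: (f _) (f u) (f' u) (g _) (g u) (g' u) => A1 A A' B1 B B' hB1 hB hA.
rewrite (_ : _ - _ - _ = (A1 - A - t * A') * B1 + (A + t * A') * (B1 - B - t * B') +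
  t ^+ 2 * (A' * B')); last by ring.
rewrite (le_trans (ler_normD _ _))// [leRHS]mulrDr lerD//; last first.
  by rewrite normrM (ger0_norm (sqr_ge0 t)) normrM.
rewrite (le_trans (ler_normD _ _))// [leRHS]mulrDr lerD//.
  by rewrite normrM mulrA ler_pM.
rewrite normrM mulrCA ler_pM// (le_trans (ler_normD _ _))// lerD2l normrM.
by rewrite ler_piMl.
Qed.

Lemma taylorD i f f' g g' Wf Wg : taylor i f f' Wf -> taylor i g g' Wg ->
  taylor i (fun u => f u + g u) (fun u => f' u + g' u) (fun u => Wf u + Wg u).
Proof.
move=> tf tg u t t1.
rewrite (_ : _ - _ - _ = (f (u + t *: evec i) - f u - t * f' u) +
  (g (u + t *: evec i) - g u - t * g' u)); last by ring.
by rewrite mulrDr (le_trans (ler_normD _ _))// lerD ?tf ?tg.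
Qed.

End taylor_classes.

Section small_jumps.
Context (R : realType) (d : nat) (nu : {measure set 'rV[R]_d -> \bar R}).
Hypothesis near : nu.-integrable (@uball R d) (fun y => (enorm y ^+ 2)%:E).
Implicit Types (u h y : 'rV[R]_d) (i : 'I_d) (t : R).

Let mU := @measurable_uball R d.

Let M2 : R := \int[nu]_(y in @uball R d) enorm y ^+ 2.

Let M20 : 0 <= M2.
Proof. by apply: Rintegral_ge0 => y _; rewrite sqr_ge0. Qed.

Let integrable_sq (c : R) : nu.-integrable (@uball R d) (fun y => (c * enorm y ^+ 2)%:E).
Proof. exact: (integrableZl mU c near). Qed.

#[local] Hint Extern 0 (is_true (integrable _ _ _)) => exact: integrable_sq : core.

Let integral_sq (c : R) : \int[nu]_(y in @uball R d) (c * enorm y ^+ 2) = c * M2.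
Proof. exact: (RintegralZl c mU near). Qed.

Lemma dotv_evec u y i t : dotv (u + t *: evec R i) y = dotv u y + t * y ord0 i.
Proof. by rewrite dotvDl dotvZl (dotvC (evec R i)) dotv_delta. Qed.

Lemma measurable_trig_dotv k u (D : set 'rV[R]_d) : measurable_fun D (fun y => trig k (dotv u y)).
Proof.
apply: measurable_funTS; apply: (measurableT_comp (f := @trig R k)); last exact: measurable_dotv.
apply: continuous_measurable_fun => x; rewrite /trig.
apply: (@continuous_comp _ _ _ (fun x : R => x + k%:R * (pi / 2)) (@cos R)).
  by apply: continuousD; [exact: cvg_id|exact: cvg_cst].
exact: continuous_cos.
Qed.

Let integrable_1cos u : nu.-integrable (@uball R d) (fun y => (1 - cos (dotv u y))%:E).
Proof.
apply: (@integrable_dominated _ _ _ _ _ mU _ (fun y => enorm u ^+ 2 * enorm y ^+ 2)) => //.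
  apply: measurable_funB => //; under eq_fun do rewrite -trig0.
  exact: measurable_trig_dotv.
move=> y _; rewrite ger0_norm ?subr_ge0 ?cos_le1// (le_trans (one_minus_cos_le _))//.
rewrite -exprMn (@le_trans _ _ (dotv u y ^+ 2))//.
  by rewrite ler_pdivrMr// ler_peMr ?sqr_ge0// ler1n.
by rewrite -real_normK ?num_real// ler_sqr ?nnegrE ?mulr_ge0// normr_dotv_le.
Qed.

#[local] Hint Extern 0 (is_true (integrable _ _ _)) => exact: integrable_1cos : core.

(* The iterated [i]-th derivatives of [psi] are, up to sign, the [moment i k] with [0 < k]. *)
Definition moment i k u : R :=
  \int[nu]_(y in @uball R d) (y ord0 i ^+ k * trig k (dotv u y)).

Let coordX_le k y i : (0 < k)%N -> uball y -> `|y ord0 i ^+ k.+1| <= enorm y ^+ 2.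
Proof.
rewrite /uball/= => k0 y1; rewrite normrX.
rewrite (@le_trans _ _ (enorm y ^+ k.+1))// ?lerXn2r ?nnegrE ?coord_le_enorm//.
by rewrite ler_wiXn2l// ltW.
Qed.

(** For [k > 1] the powers of the coordinate already give |y|^2. For [k = 1] the second factor |y|
    comes from |sin (u.y)| <= |u| |y|, which is the source of the growth in [u]. *)
Let moment_integrand_le k u y i : (0 < k)%N -> uball y ->
  `|y ord0 i ^+ k * trig k (dotv u y)| <= bracket u * enorm y ^+ 2.
Proof.
case: k => // -[_ y1|k _ y1]; last first.
  rewrite normrM (@le_trans _ _ (`|y ord0 i ^+ k.+2|))//.
    by rewrite ler_piMr// trig_le1.
  by rewrite (le_trans (coordX_le _ _ y1))// ler_peMl// sqr_ge0.
rewrite expr1 normrM (@le_trans _ _ (enorm y * (enorm u * enorm y)))//.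
  rewrite ler_pM// ?coord_le_enorm// (le_trans _ (normr_dotv_le _ _))//.
  have := trig_lip 1 (dotv u y) 0.
  by rewrite subr0 [trig 1 0]trigS mul0r addr0 sin0 oppr0 subr0.
by rewrite mulrCA -expr2 ler_wpM2r ?sqr_ge0// /bracket lerDr.
Qed.

Let measurable_moment_integrand k u i :
  measurable_fun (@uball R d) (fun y => y ord0 i ^+ k * trig k (dotv u y)).
Proof.
apply: measurable_funM; last exact: measurable_trig_dotv.
by apply: measurable_funTS; apply: measurable_funX; exact: measurable_coord.
Qed.

Let integrable_moment k u i : (0 < k)%N ->
  nu.-integrable (@uball R d) (fun y => (y ord0 i ^+ k * trig k (dotv u y))%:E).
Proof.
move=> k0; apply: (@integrable_dominated _ _ _ _ _ mU _ (fun y => bracket u * enorm y ^+ 2)) => //.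
by move=> y y1; exact: moment_integrand_le.
Qed.

Lemma moment_poly_bounded i k : (0 < k)%N -> poly_bounded (moment i k).
Proof.
move=> k0; exists 1%N, M2 => // u; rewrite expr1 mulrC -integral_sq.
by apply: normr_Rintegral_le => // y y1; exact: moment_integrand_le.
Qed.

Lemma taylor_moment i k : (0 < k)%N -> taylor i (moment i k) (moment i k.+1) (fun=> M2).
Proof.
move=> k0 u t t1; apply: Rintegral_taylor => //; try exact: integrable_moment.
move=> y y1; rewrite dotv_evec.
rewrite (_ : _ - _ - _ = y ord0 i ^+ k * (trig k (dotv u y + t * y ord0 i) -
  trig k (dotv u y) - (t * y ord0 i) * trig k.+1 (dotv u y))); last by rewrite exprS; ring.
rewrite normrM (le_trans (ler_wpM2l _ (trig_taylor _ _ _)))// exprMn mulrCA ler_wpM2l ?sqr_ge0//.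
rewrite -(ger0_norm (sqr_ge0 (y ord0 i))) -normrM -exprD addn2.
by rewrite (le_trans (coordX_le _ _ y1)).
Qed.

Lemma continuous_moment i k : (0 < k)%N -> continuous (moment i k).
Proof.
move=> k0; apply: lipschitz_continuous => u; exists M2 => h _.
rewrite mulrC -integral_sq; apply: normr_RintegralB_le => //; try exact: integrable_moment.
move=> y y1; rewrite -mulrBr normrM (le_trans (ler_wpM2l _ (trig_lip _ _ _)))//.
rewrite dotvDl addrC addKr (le_trans (ler_wpM2l _ (normr_dotv_le _ _)))//.
rewrite mulrCA ler_wpM2l// expr2 ler_wpM2r// normrX.
rewrite (@le_trans _ _ (enorm y ^+ k))// ?lerXn2r ?nnegrE ?coord_le_enorm//.
by rewrite -[leRHS]expr1 ler_wiXn2l// ltW.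
Qed.

Lemma psi_le u : psi nu u <= M2 * enorm u ^+ 2.
Proof.
rewrite mulrC -integral_sq; apply: le_Rintegral => // y _.
rewrite (le_trans (one_minus_cos_le _))// -exprMn (@le_trans _ _ (dotv u y ^+ 2))//.
  by rewrite ler_pdivrMr// ler_peMr ?sqr_ge0// ler1n.
by rewrite -real_normK ?num_real// ler_sqr ?nnegrE ?mulr_ge0// normr_dotv_le.
Qed.

(** The derivative is the integral of y_i sin (u.y); the minus sign appears because [trig 1] is
    minus the sine. *)
Lemma taylor_psi i : taylor i (psi nu) (fun u => - moment i 1 u) (fun=> M2).
Proof.
move=> u t t1; rewrite mulrN -mulNr; apply: Rintegral_taylor => //.
  exact: integrable_moment.
move=> y y1; rewrite dotv_evec expr1 -!trig0.
rewrite (_ : _ - _ - _ = - (trig 0 (dotv u y + t * y ord0 i) -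
  trig 0 (dotv u y) - (t * y ord0 i) * trig 1 (dotv u y))); last by ring.
rewrite normrN (le_trans (trig_taylor _ _ _))// exprMn ler_wpM2l ?sqr_ge0//.
by rewrite -[leLHS]ger0_norm ?sqr_ge0// coordX_le.
Qed.

(** A plain Lipschitz bound by |h| |y| need not be integrable near the origin. Keeping the
    first-order term apart and using |sin (u.y)| <= |u| |y| in it produces the integrable |y|^2. *)
Lemma continuous_psi : continuous (psi nu).
Proof.
apply: lipschitz_continuous => u; exists (bracket u * M2) => h h1.
rewrite mulrAC -integral_sq; apply: normr_RintegralB_le => // y y1.
rewrite dotvDl; have := trig_taylor 0 (dotv u y) (dotv h y); rewrite !trig0 => H.
set a := dotv u y in H *; set b := dotv h y in H *.
rewrite (_ : _ - _ = - (cos (a + b) - cos a - b * trig 1 a) - b * trig 1 a); last by ring.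
rewrite (le_trans (ler_normB _ _))// normrN.
have b1 : `|b| <= enorm h * enorm y by exact: normr_dotv_le.
have b2 : b ^+ 2 <= enorm h * enorm y ^+ 2.
  rewrite -real_normK ?num_real// (@le_trans _ _ ((enorm h * enorm y) ^+ 2))//.
    by rewrite ler_sqr ?nnegrE ?mulr_ge0.
  by rewrite exprMn ler_wpM2r ?sqr_ge0// expr2 ler_piMl.
have b3 : `|b * trig 1 a| <= enorm h * enorm u * enorm y ^+ 2.
  rewrite normrM (_ : _ * _ * _ = (enorm h * enorm y) * (enorm u * enorm y)); last by ring.
  rewrite ler_pM// (le_trans _ (normr_dotv_le _ _))//.
  have := trig_lip 1 a 0.
  by rewrite subr0 [trig 1 0]trigS mul0r addr0 sin0 oppr0 subr0.
rewrite (le_trans (lerD H b3))// (le_trans (lerD b2 (lexx _)))//.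
by rewrite le_eqVlt /bracket; apply/orP; left; apply/eqP; ring.
Qed.

End small_jumps.

(** * Fourier transforms and integration by parts *)

Section fourier.
Context (R : realType) (d : nat).
Local Notation leb := (lebesgue_measure_rV R d).
Implicit Types (f : 'rV[R]_d -> R) (u y : 'rV[R]_d).

(** Phase 0 is the cosine transform and phase 1 minus the sine transform, both without normalizing
    constant. The phase counts the derivatives that have fallen on the cosine. *)
Definition fourier f (s : nat) y : R := \int[leb]_u (f u * trig s (dotv u y)).

Lemma trig4 s (x : R) : trig s.+4 x = trig s x.
Proof.
by rewrite !trigS /trig; do !rewrite -addn1 natrD mulrDl mul1r addrA ?sinDpihalf ?cosDpihalf ?opprK.
Qed.

Lemma measurable_trig_dotvl s y (D : set 'rV[R]_d) :
  measurable_fun D (fun u => trig s (dotv u y)).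
Proof. by under eq_fun do rewrite dotvC; exact: measurable_trig_dotv. Qed.

Lemma integrable_fourier f s y : leb.-integrable setT (EFin \o f) ->
  leb.-integrable setT (fun u => (f u * trig s (dotv u y))%:E).
Proof.
move=> intf; have /measurable_EFinP mf := measurable_int leb intf.
apply: (@integrable_dominated _ _ _ _ _ measurableT _ (fun u => `|f u|)).
- by apply: measurable_funM => //; exact: measurable_trig_dotvl.
- exact: (integrable_norm intf).
- by move=> u _; rewrite normrM ler_piMr// trig_le1.
Qed.

Lemma normr_fourier_le f s y : leb.-integrable setT (EFin \o f) ->
  `|fourier f s y| <= \int[leb]_u `|f u|.
Proof.
move=> intf; have /measurable_EFinP mf := measurable_int leb intf.
apply: normr_Rintegral_le => //.
- by apply: measurable_funM => //; exact: measurable_trig_dotvl.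
- exact: (integrable_norm intf).
- by move=> u _; rewrite normrM ler_piMr// trig_le1.
Qed.

(** Integrating the Taylor bound, translation invariance cancels the two integrals of [f] and leaves
    t |I| <= t^2 K for every t in (0, 1]; a small t then forces I = 0. *)
Lemma Rintegral_partial_eq0 i f f' W : leb.-integrable setT (EFin \o f) ->
  leb.-integrable setT (EFin \o f') -> rapid W -> taylor i f f' W ->
  \int[leb]_u f' u = 0.
Proof.
move=> intf intf' rW tf; have [C C0 hW] := rW d.*2.
set I := (X in X = 0).
pose K := C * \int[leb]_u (bracket u ^- d.*2).
have K0 : 0 <= K.
  by rewrite mulr_ge0//; apply: Rintegral_ge0 => u _; rewrite invr_ge0 exprn_ge0.
have intB := integrable_bracketV R (leqnn d.*2).
have h t : 0 < t <= 1 -> `|I| <= t * K.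
  move=> /andP[t0 t1]; rewrite -(ler_pM2l t0) mulrA -expr2.
  have := @Rintegral_taylor _ _ _ leb setT measurableT (fun u => f (u + t *: evec R i)) f f'
    (fun u => C * bracket u ^- d.*2) t (t ^+ 2).
  rewrite (Rintegral_shift _ intf) addrN sub0r normrN normrM (gtr0_norm t0).
  rewrite (RintegralZl C measurableT intB) -/K; apply => //.
  - exact: integrable_shift.
  - exact: (integrableZl measurableT C intB).
  move=> u _; rewrite (le_trans (tf u t _)) ?gtr0_norm// ler_wpM2l ?sqr_ge0//.
  by rewrite ler_pdivlMr ?exprn_gt0// (le_trans _ (hW u))// ler_wpM2r ?exprn_ge0// ler_norm.
apply/eqP; rewrite -normr_eq0; apply/negPn/negP => I0.
have {}I0 : 0 < `|I| by rewrite lt_neqAle eq_sym I0 normr_ge0.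
have K1 : 0 < 2 * (K + 1) by rewrite mulr_gt0// ltr_wpDl.
have := h (Num.min 1 (`|I| / (2 * (K + 1)))).
rewrite lt_min ltr01 divr_gt0//= ge_min lexx => /(_ isT).
apply/negP; rewrite -ltNge (@le_lt_trans _ _ (`|I| / (2 * (K + 1)) * K))//.
  by rewrite ler_wpM2r// ge_min lexx orbT.
rewrite mulrAC ltr_pdivrMr// ltr_pM2l//; lra.
Qed.

Lemma fourier_partial i f f' W s y : measurable_fun setT f -> measurable_fun setT f' ->
  rapid f -> rapid f' -> rapid W -> taylor i f f' W ->
  y ord0 i * fourier f s.+1 y = - fourier f' s y.
Proof.
move=> mf mf' rf rf' rW tf.
have intf := rapid_integrable mf rf; have intf' := rapid_integrable mf' rf'.
have tg : taylor i (fun u => trig s (dotv u y)) (fun u => y ord0 i * trig s.+1 (dotv u y))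
    (fun=> y ord0 i ^+ 2).
  by move=> u t _; rewrite dotv_evec mulrA -exprMn trig_taylor.
have := taylorM tf tg (Sg := fun=> 1) (fun _ _ _ => trig_le1 _ _).
set W' := (X in taylor _ _ _ X) => tfg.
have rW' : rapid W'.
  have rabs g : rapid g -> rapid (fun u => `|g u|) by exact: rapid_norm.
  have rW1 : rapid (fun u => W u * 1).
    by apply: rapid_le rW _ => u; rewrite mulr1.
  have rW2 : rapid (fun u => (`|f u| + `|f' u|) * y ord0 i ^+ 2).
    apply: rapid_le
      (rapidM (poly_bounded_cst d (y ord0 i ^+ 2)) (rapidD (rabs _ rf) (rabs _ rf'))) _.
    by move=> u; rewrite mulrC.
  have rW3 : rapid (fun u => `|f' u| * `|y ord0 i * trig s.+1 (dotv u y)|).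
    apply: rapid_le (rapidM (poly_bounded_cst d (y ord0 i)) (rabs _ rf')) _ => u.
    by rewrite !normrM !normr_id mulrA [leRHS]mulrC ler_piMr ?mulr_ge0// trig_le1.
  exact: rapidD (rapidD rW1 rW2) rW3.
have int1 := integrable_fourier s y intf'.
have int2 : leb.-integrable setT (EFin \o (fun u => f u * (y ord0 i * trig s.+1 (dotv u y)))).
  have := integrableZl measurableT (y ord0 i) (integrable_fourier s.+1 y intf).
  by apply: eq_integrable => // u _; rewrite /= -EFinM mulrCA.
have intS : leb.-integrable setT (EFin \o (fun u => f' u * trig s (dotv u y) +
    f u * (y ord0 i * trig s.+1 (dotv u y)))).
  by apply: eq_integrable (integrableD measurableT int1 int2) => // u _; rewrite /= EFinD.
have := Rintegral_partial_eq0 (integrable_fourier s y intf) intS rW' tfg.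
rewrite RintegralD//.
rewrite (_ : \int[leb]_x (f x * (y ord0 i * trig s.+1 (dotv x y))) =
    y ord0 i * fourier f s.+1 y); last first.
  rewrite -(RintegralZl _ measurableT (integrable_fourier s.+1 y intf)).
  by apply: eq_Rintegral => u _; rewrite mulrCA.
by rewrite addrC => /eqP; rewrite addr_eq0 => /eqP.
Qed.

End fourier.

Section tempered.
Context (R : realType) (d : nat) (nu : {measure set 'rV[R]_d -> \bar R}) (alpha : R).
Hypothesis alpha0 : 0 < alpha.
Hypothesis near : nu.-integrable (@uball R d) (fun y => (enorm y ^+ 2)%:E).
Hypothesis psi_low : exists2 c : R, 0 < c &
  forall u : 'rV[R]_d, 1 <= enorm u -> c * enorm u `^ alpha <= psi nu u.
Implicit Types (f : 'rV[R]_d -> R) (u y : 'rV[R]_d).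

Definition phi u : R := expR (- psi nu u).

Lemma phi_gt0 u : 0 < phi u.
Proof. exact: expR_gt0. Qed.

Lemma phi_le1 u : phi u <= 1.
Proof. by rewrite /phi -expR0 ler_expR oppr_le0 psi_ge0. Qed.

Lemma measurable_psi : measurable_fun setT (psi nu).
Proof. by apply: continuous_rV_measurable; exact: continuous_psi. Qed.

Lemma measurable_phi : measurable_fun setT phi.
Proof.
by apply: (measurableT_comp (@measurable_expR R)); apply: measurable_funN; exact: measurable_psi.
Qed.

(** For |u| >= 1, [phi u] is at most exp(- x) with x = c |u|^alpha, and x^k <= k! e^x. Choosing k
    with alpha k >= N turns x^k into at least a multiple of |u|^N. *)
Lemma rapid_phi : rapid phi.
Proof.
move=> N; have [c c0 hc] := psi_low.
pose k := (Num.truncn (N%:R / alpha)).+1.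
have Nk : N%:R <= alpha * k%:R.
  by rewrite mulrC -ler_pdivrMr// ltW// truncnS_gt.
exists (2 ^+ N * (1 + k`!%:R / c ^+ k)).
  by rewrite mulr_ge0 ?exprn_ge0// addr_ge0// divr_ge0// exprn_ge0// ltW.
move=> u; rewrite (gtr0_norm (phi_gt0 u)).
have [u1|u1] := leP 1 (enorm u); last first.
  rewrite (@le_trans _ _ (1 * 2 ^+ N))//.
    rewrite ler_pM ?phi_le1 ?exprn_ge0 ?(ltW (phi_gt0 _))//.
    by rewrite lerXn2r ?nnegrE// bracket_le2// ltW.
  rewrite mulrC ler_wpM2l ?exprn_ge0// lerDl divr_ge0// exprn_ge0// ltW//.
have u0 : 0 < enorm u by exact: lt_le_trans u1.
rewrite (@le_trans _ _ (phi u * (2 ^+ N * enorm u ^+ N)))//.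
  rewrite ler_wpM2l ?(ltW (phi_gt0 _))// -exprMn lerXn2r ?nnegrE ?mulr_ge0//.
  by rewrite /bracket; lra.
rewrite mulrCA ler_wpM2l ?exprn_ge0//.
rewrite (@le_trans _ _ (k`!%:R / c ^+ k))//; last by rewrite lerDr.
pose x := c * enorm u `^ alpha.
have x0 : 0 <= x by rewrite mulr_ge0 ?powR_ge0// ltW.
have h1 : enorm u ^+ N <= x ^+ k / c ^+ k.
  rewrite /x exprMn mulrAC divff ?mul1r; last by rewrite expf_neq0// gt_eqF.
  by rewrite -(powR_mulrn k (powR_ge0 _ _)) -powRrM -(powR_mulrn N (ltW u0)) ler_powR.
have h2 : phi u <= (expR x)^-1 by rewrite -expRN ler_expR lerN2 hc.
apply: (@le_trans _ _ ((expR x)^-1 * (x ^+ k / c ^+ k))).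
  by rewrite ler_pM ?exprn_ge0// ltW// phi_gt0.
rewrite mulrA ler_wpM2r ?invr_ge0 ?exprn_ge0 ?(ltW c0)//.
by rewrite mulrC ler_pdivrMr ?expR_gt0// exprn_le_expR.
Qed.

(** Apply [expRN_taylor] to the increment x of [psi], which is of order t, and then replace x by its
    linear part at a cost of order t^2. The value of [phi] at the shifted point is majorized by
    [rapid_shift]. *)
Lemma taylor_phi i : exists2 W, rapid W &
  taylor i phi (fun u => moment nu i 1 u * phi u) W.
Proof.
have := taylor_psi near i; set M := (X in taylor _ _ _ (fun=> X)) => tpsi.
have M0 : 0 <= M by apply: Rintegral_ge0 => y _; rewrite sqr_ge0.
have [S rS hS] := rapid_shift rapid_phi.
have pm := moment_poly_bounded near i (ltn0Sn 0).
pose m u := `|moment nu i 1 u| + M.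
have pbm : poly_bounded (fun u => m u * m u).
  have h : poly_bounded m.
    exact: poly_boundedD (poly_bounded_norm pm) (poly_bounded_cst d M).
  exact: poly_boundedM.
exists (fun u => (m u * m u) * (phi u + S u) + M * phi u).
  apply: rapidD; first by apply: rapidM pbm (rapidD rapid_phi rS).
  exact: (rapidM (poly_bounded_cst d M) rapid_phi).
move=> u t t1; have := tpsi u t t1; have := hS u (t *: evec R i) (enorm_evec _ t1).
rewrite /phi; set p := psi nu u; set p' := psi nu _.
rewrite (_ : p' = p + (p' - p)); last by rewrite addrC subrK.
set x := p' - p; set m1 := moment nu i 1 u.
rewrite (ger0_norm (ltW (expR_gt0 _))) => hSu hx.
have {}hx : `|x + t * m1| <= t ^+ 2 * M.
  by move: hx; rewrite mulrN opprK (addrC p) addrK.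
have x2 : x ^+ 2 <= t ^+ 2 * (m u * m u).
  rewrite -real_normK ?num_real// -(real_normK (num_real t)) -expr2 -exprMn.
  rewrite ler_sqr ?nnegrE ?mulr_ge0 ?addr_ge0//.
  have -> : x = (x + t * m1) - t * m1 by rewrite addrK.
  rewrite (le_trans (ler_normB _ _))// /m mulrDr addrC normrM lerD2l//.
  rewrite (le_trans hx)// ler_wpM2r// -(real_normK (num_real t)) expr2.
  by rewrite ler_piMl.
rewrite (_ : _ - _ - _ = (expR (- (p + x)) - expR (- p) + x * expR (- p)) -
  (x + t * m1) * expR (- p)); last by ring.
rewrite (le_trans (ler_normB _ _))// mulrDr lerD//.
  rewrite (le_trans (expRN_taylor _ _))// mulrA; apply: ler_pM => //.
  - exact: sqr_ge0.
  - by rewrite lerD2l.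
by rewrite normrM mulrA (gtr0_norm (expR_gt0 _)) ler_wpM2r// ltW// expR_gt0.
Qed.

End tempered.

Section tame_amplitudes.
Context (R : realType) (d : nat) (nu : {measure set 'rV[R]_d -> \bar R}) (alpha : R).
Hypothesis alpha0 : 0 < alpha.
Hypothesis near : nu.-integrable (@uball R d) (fun y => (enorm y ^+ 2)%:E).
Hypothesis psi_low : exists2 c : R, 0 < c &
  forall u : 'rV[R]_d, 1 <= enorm u -> c * enorm u `^ alpha <= psi nu u.
Implicit Types (f : 'rV[R]_d -> R) (u y : 'rV[R]_d).

Local Notation phi := (phi nu).

(* Closed under [f |-> d_i f + f * moment nu i 1], so that [f * phi] can be
   differentiated indefinitely in the direction [i]. *)
Inductive tame (i : 'I_d) : ('rV[R]_d -> R) -> Prop :=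
| tame_cst c : tame i (fun=> c)
| tame_coord j : tame i (fun u => u ord0 j)
| tame_moment k : tame i (moment nu i k.+1)
| tame_add f g : tame i f -> tame i g -> tame i (fun u => f u + g u)
| tame_mul f g : tame i f -> tame i g -> tame i (fun u => f u * g u).

Lemma tame_poly_bounded i f : tame i f -> poly_bounded f.
Proof.
elim=> [c|j|k|{}f g _ pf _ pg|{}f g _ pf _ pg].
- exact: poly_bounded_cst.
- exact: poly_bounded_coord.
- exact: moment_poly_bounded.
- exact: poly_boundedD.
- exact: poly_boundedM.
Qed.

Lemma tame_measurable i f : tame i f -> measurable_fun setT f.
Proof.
elim=> [c|j|k|{}f g _ mf _ mg|{}f g _ mf _ mg].
- exact: measurable_cst.
- exact: measurable_coord.
- by apply: continuous_rV_measurable; exact: continuous_moment.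
- exact: measurable_funD.
- exact: measurable_funM.
Qed.

Lemma tame_taylor i f : tame i f -> exists f' W,
  [/\ tame i f', poly_bounded W & taylor i f f' W].
Proof.
elim=> [c|j|k|{}f g _ [f' [Wf [tf pf hf]]] _ [g' [Wg [tg pg hg]]]
       |{}f g uf [f' [Wf [tf pf hf]]] ug [g' [Wg [tg pg hg]]]].
- exists (fun=> 0), (fun=> 0); split; [exact: tame_cst|exact: poly_bounded_cst|].
  by move=> u t _; rewrite subrr mulr0 subr0 normr0 mulr0.
- exists (fun=> (j == i)%:R), (fun=> 0); split; [exact: tame_cst|exact: poly_bounded_cst|].
  move=> u t _; rewrite !mxE eqxx/= mulr0 (_ : _ - _ - _ = 0) ?normr0//; ring.
- exists (moment nu i k.+2), (fun=> \int[nu]_(y in @uball R d) enorm y ^+ 2).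
  split; [exact: tame_moment|exact: poly_bounded_cst|].
  exact: (taylor_moment near i (ltn0Sn k)).
- exists (fun u => f' u + g' u), (fun u => Wf u + Wg u); split.
  + exact: tame_add.
  + exact: poly_boundedD.
  + exact: taylorD.
- have [S pS hS] := poly_bounded_shift (tame_poly_bounded ug).
  have hS' u t : `|t| <= 1 -> `|g (u + t *: evec R i)| <= S u.
    by move=> t1; apply: hS; exact: enorm_evec.
  exists (fun u => f' u * g u + f u * g' u); eexists; split; last exact: (taylorM hf hg hS').
    by apply: tame_add; exact: tame_mul.
  have pf' := poly_bounded_norm (tame_poly_bounded tf).
  have pg' := poly_bounded_norm (tame_poly_bounded tg).
  apply: poly_boundedD; last exact: (poly_boundedM pf' pg').
  apply: poly_boundedD; first exact: (poly_boundedM pf pS).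
  exact: (poly_boundedM (poly_boundedD (poly_bounded_norm (tame_poly_bounded uf)) pf') pg).
Qed.

Lemma measurable_mul_phi i f : tame i f -> measurable_fun setT (fun u => f u * phi u).
Proof.
by move=> tf; apply: measurable_funM; [exact: tame_measurable tf|exact: measurable_phi near].
Qed.

Lemma rapid_mul_phi i f : tame i f -> rapid (fun u => f u * phi u).
Proof. by move=> tf; apply: rapidM (tame_poly_bounded tf) (rapid_phi alpha0 psi_low). Qed.

Lemma taylor_mul_phi i f : tame i f -> exists f' W, [/\ tame i f', rapid W &
  taylor i (fun u => f u * phi u) (fun u => f' u * phi u) W].
Proof.
move=> tf; have [f' [Wf [tf' pW hf]]] := tame_taylor tf.
have rphi := rapid_phi alpha0 psi_low.
have [Wp rW hp] := taylor_phi alpha0 near psi_low i.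
have [S rS hS] := rapid_shift rphi.
have hS' u t : `|t| <= 1 -> `|phi (u + t *: evec R i)| <= S u.
  by move=> t1; apply: hS; exact: enorm_evec.
have tm : tame i (fun u => f' u + f u * moment nu i 1 u).
  by apply: tame_add => //; apply: tame_mul => //; exact: tame_moment.
have H := taylorM hf hp hS'.
exists (fun u => f' u + f u * moment nu i 1 u); eexists; split; [exact: tm| |]; last first.
  have -> : (fun u => (f' u + f u * moment nu i 1 u) * phi u) =
      (fun u => f' u * phi u + f u * (moment nu i 1 u * phi u)).
    by apply/funext => u; ring.
  exact: H.
have pf := poly_bounded_norm (tame_poly_bounded tf).
have pf' := poly_bounded_norm (tame_poly_bounded tf').
have rm := rapid_norm (rapidM (tame_poly_bounded (tame_moment i 0)) rphi).
apply: rapidD; last exact: (rapidM pf' rm).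
by apply: rapidD; [exact: rapidM pW rS|exact: (rapidM (poly_boundedD pf pf') rW)].
Qed.

(** Each power of the coordinate is traded for one integration by parts, which keeps the amplitude
    in [tame i]. The constant is uniform in the phase because the phase changes along the
    induction. *)
Lemma fourier_coord_decay i m f : tame i f -> exists2 C, 0 <= C & forall s y,
  `|y ord0 i| ^+ m * `|fourier (fun u => f u * phi u) s y| <= C.
Proof.
elim: m f => [|m IHm] f tf.
  exists (\int[lebesgue_measure_rV R d]_u `|f u * phi u|).
    by apply: Rintegral_ge0.
  move=> s y; rewrite expr0 mul1r; apply: normr_fourier_le.
  by apply: rapid_integrable; [exact: measurable_mul_phi tf|exact: rapid_mul_phi tf].
have [f' [W [tf' rW hW]]] := taylor_mul_phi tf.
have [C C0 hC] := IHm f' tf'; exists C => // s y.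
(* [fourier_partial] lowers the phase by one and so needs a successor; period 4 provides one even
   for phase 0. *)
have h4 : fourier (fun u => f u * phi u) s y = fourier (fun u => f u * phi u) s.+4 y.
  by apply: eq_Rintegral => u _; rewrite trig4.
rewrite h4 exprSr -mulrA -normrM.
rewrite (fourier_partial s.+3 y (measurable_mul_phi tf) (measurable_mul_phi tf')
  (rapid_mul_phi tf) (rapid_mul_phi tf') rW hW).
by rewrite normrN hC.
Qed.

(** If |y| <= 2d |y_i| for some i, decay in direction i suffices. Otherwise summing over i and |y|
    <= sum |y_i| give 2d |y| <= d |y|, so y = 0; the factor 2 is what makes this a contradiction for
    nonzero y. *)
Lemma fourier_decay f N : (forall i, tame i f) -> rapid (fun u => f u * phi u) ->
  measurable_fun setT f ->
  exists2 C, 0 <= C & forall s y,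
    `|fourier (fun u => f u * phi u) s y| * bracket y ^+ N <= C.
Proof.
move=> tf rf mf.
have intf : (lebesgue_measure_rV R d).-integrable setT (EFin \o (fun u => f u * phi u)).
  by apply: rapid_integrable => //; apply: measurable_funM => //; exact: measurable_phi near.
pose C0 := \int[lebesgue_measure_rV R d]_u `|f u * phi u|.
have C00 : 0 <= C0 by apply: Rintegral_ge0.
have hC0 s y : `|fourier (fun u => f u * phi u) s y| <= C0 by exact: normr_fourier_le.
have /choice[C hC] (i : 'I_d) : exists C, 0 <= C /\ forall s y,
    `|y ord0 i| ^+ N * `|fourier (fun u => f u * phi u) s y| <= C.
  by have [C C1 hC] := fourier_coord_decay N (tf i); exists C.
have S0 : 0 <= \sum_i C i by apply: sumr_ge0 => i _; case: (hC i).
exists ((1 + (2 * d)%:R) ^+ N * (C0 + \sum_i C i)).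
  by rewrite mulr_ge0 ?addr_ge0// exprn_ge0// addr_ge0.
move=> s y; set F := `|fourier _ _ _|; have F0 : 0 <= F by exact: normr_ge0.
have [/existsP[i yi]|/existsPn noi] := boolP [exists i, enorm y <= (2 * d)%:R * `|y ord0 i|].
  have [y1|y1] := leP `|y ord0 i| 1.
    rewrite mulrC ler_pM ?exprn_ge0//; last by rewrite (le_trans (hC0 _ _))// lerDl.
    rewrite lerXn2r ?nnegrE ?addr_ge0// /bracket lerD2l (le_trans yi)//.
    by rewrite ler_piMr.
  rewrite (@le_trans _ _ (F * ((1 + (2 * d)%:R) * `|y ord0 i|) ^+ N))//.
    rewrite ler_wpM2l// lerXn2r ?nnegrE ?mulr_ge0 ?addr_ge0// /bracket mulrDl mul1r lerD//.
    exact: ltW.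
  rewrite exprMn mulrCA ler_wpM2l ?exprn_ge0 ?addr_ge0// mulrC.
  rewrite (le_trans ((hC i).2 _ _))// ler_wpDl// (bigD1 i)//= lerDl.
  by apply: sumr_ge0 => j _; case: (hC j).
have y0 : enorm y = 0.
  apply/eqP; rewrite eq_le enorm_ge0 andbT leNgt; apply/negP => y0.
  have d0 : (0 < d)%N.
    rewrite lt0n; apply/negP => /eqP d0; move: (enorm_le_sum y) y0.
    by rewrite big1 => [|[k kd]]; [lra|exfalso; rewrite d0 in kd].
  have : (2 * d)%:R * \sum_i `|y ord0 i| <= \sum_(i < d) enorm y.
    by rewrite mulr_sumr ler_sum// => i _; rewrite ltW// ltNge noi.
  have := ler_wpM2l (ler0n R (2 * d)) (enorm_le_sum y).
  rewrite sumr_const card_ord -mulr_natl natrM => h1 h2.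
  have := le_trans h1 h2; have d1 : (1 : R) <= d%:R by rewrite ler1n.
  by rewrite -mulrA; have := mulr_gt0 (lt_le_trans ltr01 d1) y0; lra.
have h := hC0 s y; rewrite /bracket y0 addr0 expr1n mulr1 (le_trans h)//.
rewrite (@le_trans _ _ (1 * (C0 + \sum_i C i)))//; first by rewrite mul1r lerDl.
by rewrite ler_wpM2r ?addr_ge0// exprn_ege1// lerDl.
Qed.

End tame_amplitudes.

(** * Adding the large jumps *)

Section exponential_series.
Context (R : realType).

Lemma series_exp_cvg (x : R) : series (exp_coeff x) @ \oo --> expR x.
Proof. exact: is_cvg_series_exp_coeff. Qed.

Lemma series_exp_le (x : R) n : 0 <= x -> series (exp_coeff x) n <= expR x.
Proof.
move=> x0; apply: nondecreasing_cvgn_le; last exact: is_cvg_series_exp_coeff.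
apply/nondecreasing_seqP => k.
by rewrite /series/= big_nat_recr//= lerDl exp_coeff_ge0.
Qed.

End exponential_series.

Section large_jumps.
Context (R : realType) (d : nat) (nu : {finite_measure set 'rV[R]_d -> \bar R}).
Variables (alpha gamma K : R).
Local Notation leb := (lebesgue_measure_rV R d).
Local Notation w := (weight alpha gamma).
Hypothesis K0 : 0 <= K.
Hypothesis w_convolution : forall y, (\int[nu]_z (w (y - z))%:E <= (K * w y)%:E)%E.
Hypothesis w_le1 : forall y : 'rV[R]_d, w y <= 1.
Implicit Types (f : 'rV[R]_d -> R) (u y z : 'rV[R]_d).

Let m : R := fine (nu setT).

Let m0 : 0 <= m. Proof. exact: fine_ge0. Qed.

Definition cos_transform u : R := \int[nu]_z cos (dotv u z).

Local Notation chi := cos_transform.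

Let integrable_cst (c : R) : nu.-integrable setT (EFin \o cst c).
Proof. exact: finite_measure_integrable_cst. Qed.

#[local] Hint Extern 0 (is_true (integrable _ _ _)) => exact: integrable_cst : core.

Let integral_cst1 (c : R) : \int[nu]_z c = c * m.
Proof. exact: Rintegral_cst. Qed.

Let measurable_cos_dotv u : measurable_fun setT (fun z => cos (dotv u z)).
Proof. by under eq_fun do rewrite -trig0; exact: measurable_trig_dotv. Qed.

Lemma normr_cos_transform u : `|chi u| <= m.
Proof.
rewrite -[leRHS]mul1r -integral_cst1; apply: normr_Rintegral_le => //.
by move=> z _; rewrite ler_norml cos_geN1 cos_le1.
Qed.

Let measurable_cos_pair :
  measurable_fun setT (fun p : 'rV[R]_d * 'rV[R]_d => cos (dotv p.1 p.2)).
Proof.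
apply: (measurableT_comp (f := @cos R)).
  by apply: continuous_measurable_fun; exact: continuous_cos.
apply: measurable_sum => j; apply: measurable_funM.
  exact: (measurableT_comp (@measurable_coord R 1 d ord0 j) measurable_fst).
exact: (measurableT_comp (@measurable_coord R 1 d ord0 j) measurable_snd).
Qed.

Let measurable_mul_cos f : measurable_fun setT f ->
  measurable_fun setT (fun p : 'rV[R]_d * 'rV[R]_d => f p.1 * cos (dotv p.1 p.2)).
Proof.
by move=> mf; apply: measurable_funM => //; exact: (measurableT_comp mf measurable_fst).
Qed.

Let mul_cos_le f u z : `|f u * cos (dotv u z)| <= `|f u| * 1.
Proof. by rewrite normrM ler_wpM2l// ler_norml cos_geN1 cos_le1. Qed.

Let mul_chiE f u : f u * chi u = \int[nu]_z (f u * cos (dotv u z)).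
Proof.
rewrite RintegralZl//; apply: (@integrable_dominated _ _ _ _ _ measurableT _ (cst 1)) => //.
by move=> z _; rewrite ler_norml cos_geN1 cos_le1.
Qed.

Lemma integrable_mul_chi f : leb.-integrable setT (EFin \o f) ->
  leb.-integrable setT (EFin \o (fun u => f u * chi u)).
Proof.
move=> intf; have /measurable_EFinP mf := measurable_int leb intf.
apply: (@integrable_dominated _ _ _ _ _ measurableT _ (fun u => m * `|f u|)).
(* Measurability of the product comes from Fubini on the product with the measure of the large
   jumps. *)
- under eq_fun do rewrite mul_chiE.
  apply: (@measurable_Rintegral1 _ _ _ _ _ leb nu
    (fun p => f p.1 * cos (dotv p.1 p.2)) (fun u => `|f u|) (cst 1)) => //.
  + exact: measurable_mul_cos.
  + exact: (integrable_norm intf).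
- exact: (integrableZl measurableT m (integrable_norm intf)).
- by move=> u _; rewrite normrM mulrC ler_wpM2r// normr_cos_transform.
Qed.

(** Insert the integral defining [chi], exchange the integrals, and apply [trig_sum]. The
    measurability of the average in z is recorded as well, since the estimate of its integral relies
    on it. *)
Lemma fourier_mul_chi f s y : leb.-integrable setT (EFin \o f) ->
  fourier (fun u => f u * chi u) s y =
  \int[nu]_z (2^-1 * (fourier f s (y - z) + fourier f s (y + z))) /\
  measurable_fun setT (fun z => 2^-1 * (fourier f s (y - z) + fourier f s (y + z))).
Proof.
move=> intf; have /measurable_EFinP mf := measurable_int leb intf.
pose F (p : 'rV[R]_d * 'rV[R]_d) := f p.1 * trig s (dotv p.1 y) * cos (dotv p.1 p.2).
have mft : measurable_fun setT (fun u => f u * trig s (dotv u y)).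
  by apply: measurable_funM => //; exact: measurable_trig_dotvl.
have mF : measurable_fun setT F by exact: measurable_mul_cos mft.
have F_le u z : `|F (u, z)| <= `|f u| * 1.
  rewrite (le_trans (mul_cos_le (fun u => f u * trig s (dotv u y)) _ _))// !mulr1.
  by rewrite normrM ler_piMr// trig_le1.
have HE z : 2^-1 * (fourier f s (y - z) + fourier f s (y + z)) = \int[leb]_u F (u, z).
  have i1 := integrable_fourier s (y - z) intf.
  have i2 := integrable_fourier s (y + z) intf.
  rewrite -RintegralD// -RintegralZl//; last first.
    by apply: eq_integrable (integrableD measurableT i1 i2) => // u _; rewrite /= EFinD.
  apply: eq_Rintegral => u _; rewrite dotvBr dotvDr -mulrDr trig_sum /F.
  by field.
split.
  under eq_Rintegral do rewrite HE.
  rewrite -(@Rintegral_fubini _ _ _ _ _ leb nu F (fun u => `|f u|) (cst 1))//.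
    apply: eq_Rintegral => u _; rewrite mulrAC.
    exact: (mul_chiE (fun u => f u * trig s (dotv u y))).
  exact: (integrable_norm intf).
under eq_fun do rewrite HE.
apply: (@measurable_Rintegral1 _ _ _ _ _ nu leb (F \o (fun p => (p.2, p.1)))
  (cst 1) (fun u => `|f u|)) => //.
- by apply: (measurableT_comp mF); exact: measurable_fun_pair.
- exact: (integrable_norm intf).
- by move=> z u; rewrite [leRHS]mulrC F_le.
Qed.

Let w_even y : w (- y) = w y.
Proof. by rewrite /weight bracketN. Qed.

Let integrable_w y : nu.-integrable setT (EFin \o (fun z => w (y - z))).
Proof.
apply: (@integrable_dominated _ _ _ _ _ measurableT _ (cst 1)) => //.
  apply: (measurableT_comp (@measurable_weight R d alpha gamma)).
  apply: measurable_fun_mx => i j; under eq_fun do rewrite !mxE.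
  by apply: measurable_funB => //; exact: measurable_coord.
by move=> z _; rewrite ger0_norm ?weight_ge0// w_le1.
Qed.

Let w_convolutionR y : \int[nu]_z w (y - z) <= K * w y.
Proof.
by rewrite -lee_fin -(Rintegral_EFin measurableT (integrable_w y)) w_convolution.
Qed.

Lemma fourier_mul_chi_le f C : leb.-integrable setT (EFin \o f) ->
  (forall s y, `|fourier f s y| <= C * w y) ->
  forall s y, `|fourier (fun u => f u * chi u) s y| <= C * K * w y.
Proof.
move=> intf fC s y; have [-> mH] := fourier_mul_chi s y intf.
have C0 : 0 <= C.
  by have := le_trans (normr_ge0 _) (fC s y); rewrite pmulr_lge0// weight_gt0.
have i1 : nu.-integrable setT (EFin \o (fun z => C / 2 * w (y - z))).
  exact: (integrableZl measurableT (C / 2) (integrable_w y)).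
have i2 : nu.-integrable setT (EFin \o (fun z => C / 2 * w (- y - z))).
  exact: (integrableZl measurableT (C / 2) (integrable_w (- y))).
apply: (@le_trans _ _ (\int[nu]_z (C / 2 * w (y - z) + C / 2 * w (- y - z)))).
  apply: normr_Rintegral_le => //.
    by apply: eq_integrable (integrableD measurableT i1 i2) => // z _; rewrite /= EFinD.
  (* Evenness of the weight turns the translate y + z into - y - z, so both halves are convolutions,
     at y and at - y. *)
  move=> z _; rewrite -opprD w_even normrM ger0_norm ?invr_ge0//.
  have := lerD (fC s (y - z)) (fC s (y + z)).
  have := ler_normD (fourier f s (y - z)) (fourier f s (y + z)); lra.
rewrite (RintegralD measurableT i1 i2) (RintegralZl _ measurableT (integrable_w y)).
rewrite (RintegralZl _ measurableT (integrable_w (- y))).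
have := w_convolutionR (- y); rewrite w_even => h2.
have h1 := w_convolutionR y.
have hC : 0 <= C / 2 by rewrite divr_ge0.
apply: (le_trans (lerD (ler_wpM2l hC h1) (ler_wpM2l hC h2))).
by rewrite le_eqVlt; apply/orP; left; apply/eqP; field.
Qed.

(** The k-th term of the series costs K^k / k!, so the partial sums obey the bound uniformly in n.
    Dominated convergence passes to the limit at each fixed [y]. *)
Lemma fourier_exp_chi_le f C : leb.-integrable setT (EFin \o f) ->
  (forall s y, `|fourier f s y| <= C * w y) ->
  forall s y, `|fourier (fun u => f u * expR (chi u)) s y| <= C * expR K * w y.
Proof.
move=> intf fC s y.
have C0 : 0 <= C.
  by have := le_trans (normr_ge0 _) (fC s y); rewrite pmulr_lge0// weight_gt0.
have w0 := weight_ge0 alpha gamma y.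
pose F k := (fun u => f u * chi u ^+ k).
have FS k : F k.+1 = (fun u => F k u * chi u).
  by apply/funext => u; rewrite /F exprSr mulrA.
have iF k : leb.-integrable setT (EFin \o F k).
  elim: k => [|k IHk]; last by rewrite FS; exact: integrable_mul_chi.
  by apply: eq_integrable intf => // u _; rewrite /F/= expr0 mulr1.
have FC k s' y' : `|fourier (F k) s' y'| <= C * K ^+ k * w y'.
  elim: k s' y' => [|k IHk] s' y'.
    rewrite expr0 mulr1 (_ : F 0%N = f)//.
    by apply/funext => u; rewrite /F expr0 mulr1.
  by rewrite FS exprSr mulrA; exact: fourier_mul_chi_le.
pose S n u := \sum_(0 <= k < n) (k`!%:R)^-1 * (F k u * trig s (dotv u y)).
have iS n : leb.-integrable setT (EFin \o S n).
  rewrite (_ : EFin \o S n = (fun u => \sum_(0 <= k < n)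
      (k`!%:R)^-1%:E * (F k u * trig s (dotv u y))%:E)%E); last first.
    by apply/funext => u; rewrite /S/= -sumEFin; apply: eq_bigr => k _; rewrite EFinM.
  apply: (integrable_sum measurableT) => k _.
  exact: (integrableZl measurableT _ (integrable_fourier s y (iF k))).
have SE n : \int[leb]_u S n u = \sum_(0 <= k < n) (k`!%:R)^-1 * fourier (F k) s y.
  elim: n => [|n IHn].
    by rewrite big_nil; under eq_Rintegral do rewrite /S big_nil; rewrite Rintegral_cst// mul0r.
  have iT : leb.-integrable setT (EFin \o (fun u => (n`!%:R)^-1 * (F n u * trig s (dotv u y)))).
    exact: (integrableZl measurableT _ (integrable_fourier s y (iF n))).
  rewrite big_nat_recr//= -IHn -(RintegralZl _ measurableT (integrable_fourier s y (iF n))).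
  rewrite -(RintegralD measurableT (iS n) iT).
  by apply: eq_Rintegral => u _; rewrite /S big_nat_recr.
have S_le n : `|\int[leb]_u S n u| <= C * expR K * w y.
  rewrite SE (le_trans (ler_norm_sum _ _ _))//.
  apply: (@le_trans _ _ (C * series (exp_coeff K) n * w y)); last first.
    by rewrite ler_wpM2r// ler_wpM2l// series_exp_le.
  rewrite /series/= mulr_sumr mulr_suml ler_sum// => k _.
  rewrite normrM ger0_norm ?invr_ge0// /exp_coeff/=.
  rewrite (le_trans (ler_wpM2l _ (FC k s y))) ?invr_ge0//.
  by rewrite le_eqVlt; apply/orP; left; apply/eqP; ring.
pose G u := f u * expR (chi u) * trig s (dotv u y).
have SG u : S ^~ u @ \oo --> G u.
  have SuE : S ^~ u = (fun n => f u * trig s (dotv u y) * series (exp_coeff (chi u)) n).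
    apply/funext => n; rewrite /S /series/= mulr_sumr; apply: eq_bigr => k _.
    by rewrite /F /exp_coeff/=; ring.
  rewrite SuE /G (_ : _ * _ * _ = f u * trig s (dotv u y) * expR (chi u)); last by ring.
  by apply: cvgMl_tmp; exact: series_exp_cvg.
(* Since |chi| is at most the total mass m, e^m |f| majorizes all partial sums. *)
have S_bnd n u : `|S n u| <= expR m * `|f u|.
  have -> : S n u = f u * trig s (dotv u y) * series (exp_coeff (chi u)) n.
    rewrite /S /series/= mulr_sumr; apply: eq_bigr => k _.
    by rewrite /F /exp_coeff/=; ring.
  rewrite normrM mulrC ler_pM//; last by rewrite normrM ler_piMr// trig_le1.
  rewrite (le_trans _ (series_exp_le n m0))// (le_trans (ler_norm_sum _ _ _))//.
  apply: ler_sum => k _; rewrite /exp_coeff/= normrM normrX normfV.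
  rewrite [X in _ / X]ger0_norm// ler_wpM2r ?invr_ge0//.
  by rewrite lerXn2r ?nnegrE// normr_cos_transform.
have mS n : measurable_fun setT (S n).
  by apply/measurable_EFinP; have := measurable_int leb (iS n).
have mG : measurable_fun setT G.
  by apply: (measurable_fun_cvg (h := S)) => // u _; exact: SG.
have igm : leb.-integrable setT (fun u => (expR m * `|f u|)%:E).
  exact: (integrableZl measurableT (expR m) (integrable_norm intf)).
have SGe u : (S n u)%:E @[n --> \oo] --> (G u)%:E.
  by apply: cvg_EFin; [exact: nearW|exact: SG].
have [iG _ cvgS] := @dominated_convergence _ _ _ leb setT measurableT
  (fun n => EFin \o S n) (EFin \o G) (fun u => (expR m * `|f u|)%:E)
  (fun n => (measurable_EFinP _ _).2 (mS n)) ((measurable_EFinP _ _).2 mG)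
  (aeW _ (fun u _ => SGe u)) igm
  (aeW _ (fun u n _ => S_bnd n u)).
have : (\int[leb]_u (S n u)%:E)%E @[n --> \oo] --> (\int[leb]_u G u)%R%:E.
  by rewrite -(Rintegral_EFin measurableT iG); exact: cvgS.
move=> /fine_cvg/cvg_norm cvgSR.
rewrite -[leLHS](cvg_lim (@Rhausdorff R) cvgSR).
by apply: limr_le; [exact: cvgP cvgSR|exact: nearW].
Qed.

End large_jumps.

(** * Fourier inversion *)

Section density.
Context dd (T : measurableType dd) (R : realType) (P leb : {measure set T -> \bar R}).
Variable p : T -> R.
Hypotheses (mp : measurable_fun setT p) (p0 : forall x, 0 <= p x).
Hypothesis Pp : forall A, measurable A -> P A = (\int[leb]_(x in A) (p x)%:E)%E.
Local Open Scope ereal_scope.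

Import HBNNSimple.

Let integral_density_nnsfun (h : {nnsfun T >-> R}) :
  \int[P]_x (h x)%:E = \int[leb]_x ((h x)%:E * (p x)%:E).
Proof.
have mE r : measurable (h @^-1` [set r]) by [].
have fE x : (h x)%:E = \sum_(r \in range h) (r * \1_(h @^-1` [set r]) x)%:E.
  by rewrite fsumEFin// -fimfunE.
have pos r x : 0 <= (r * \1_(h @^-1` [set r]) x)%:E :> \bar R.
  by rewrite EFinM nnfun_muleindic_ge0.
transitivity (\sum_(r \in range h) \int[P]_x (r * \1_(h @^-1` [set r]) x)%:E).
  rewrite -ge0_integral_fsum//; first by apply: eq_integral => x _; rewrite fE.
  by move=> r; apply/measurable_EFinP; exact: measurable_funM.
transitivity (\sum_(r \in range h)
    \int[leb]_x ((r * \1_(h @^-1` [set r]) x)%:E * (p x)%:E)); last first.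
  rewrite -ge0_integral_fsum//; last 2 first.
  - move=> r; apply: emeasurable_funM; last exact/measurable_EFinP.
    by apply/measurable_EFinP; exact: measurable_funM.
  - by move=> r x _; rewrite mule_ge0// lee_fin.
  apply: eq_integral => x _; rewrite fE ge0_mule_fsuml//.
apply: eq_fsbigr => r _; rewrite integralZl_indic_nnsfun//.
rewrite integral_indic// setIT Pp// integral_mkcond.
(* A nonnegative simple function takes no negative value, so these levels are empty; for the others
   [r] can be moved into a nonnegative integral. *)
have [r0|r0] := ltP r 0%R.
  rewrite (_ : h @^-1` [set r] = set0); last exact: preimage_nnfun0.
  rewrite patch_set0 integral0 mule0; apply/esym/integral0_eq => x _.
  by rewrite indic0 mulr0 mul0e.
rewrite -ge0_integralZl_EFin//; last 2 first.
- by move=> x _; apply: erestrict_ge0 => z _; rewrite lee_fin.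
- by apply/(measurable_restrictT _ _).1 => //; exact/measurable_EFinP/measurable_funTS.
apply: eq_integral => x _; rewrite patchE indicE.
by case: ifPn => xr; rewrite ?mulr1// mulr0 mul0e mule0.
Qed.

Lemma ge0_integral_density (f : T -> \bar R) : measurable_fun setT f ->
  (forall x, 0 <= f x) -> \int[P]_x f x = \int[leb]_x (f x * (p x)%:E).
Proof.
move=> mf f0; pose f_ := nnsfun_approx measurableT mf.
have cf x : (f_ n x)%:E @[n --> \oo] --> f x by exact: cvg_nnsfun_approx.
transitivity (limn (fun n => \int[P]_x (f_ n x)%:E)).
  rewrite -monotone_convergence//.
  - by apply: eq_integral => x _; apply/esym/cvg_lim.
  - by move=> n; exact/measurable_EFinP/measurable_funP.
  - by move=> n x _; rewrite lee_fin.
  - by move=> x _ a b ab; rewrite lee_fin; exact/lefP/nd_nnsfun_approx.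
under eq_fun do rewrite integral_density_nnsfun.
rewrite -monotone_convergence//.
- apply: eq_integral => x _; apply/cvg_lim => //.
  by apply: cvgeZr => //; exact: cf.
- by move=> n; apply: emeasurable_funM; exact/measurable_EFinP.
- by move=> n x _; rewrite mule_ge0// lee_fin.
- move=> x _ a b ab; rewrite lee_wpmul2r ?lee_fin//.
  exact/lefP/nd_nnsfun_approx.
Qed.

Lemma Rintegral_density (f : T -> R) : P.-integrable setT (EFin \o f) ->
  leb.-integrable setT (EFin \o (fun x => f x * p x)%R) /\
  (\int[P]_x f x = \int[leb]_x (f x * p x))%R.
Proof.
move=> intf; have /measurable_EFinP mf := measurable_int P intf.
have mfp : measurable_fun setT (fun x => f x * p x)%R by exact: measurable_funM.
have intfp : leb.-integrable setT (EFin \o (fun x => f x * p x)%R).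
  apply/integrableP; split; first exact/measurable_EFinP.
  move/integrableP : intf => [_]; rewrite (@ge0_integral_density (fun x => `|(f x)%:E|))//.
    by under eq_integral do rewrite /= -EFinM -(ger0_norm (p0 _)) -normrM.
  by apply: measurableT_comp => //; exact/measurable_EFinP.
split => //; rewrite /Rintegral [in LHS]integralE [in RHS]integralE.
have mpos : measurable_fun setT (EFin \o f)^\+ by apply: measurable_funepos; exact/measurable_EFinP.
have mneg : measurable_fun setT (EFin \o f)^\- by apply: measurable_funeneg; exact/measurable_EFinP.
rewrite (ge0_integral_density mpos); last by move=> x; exact: funepos_ge0.
rewrite (ge0_integral_density mneg); last by move=> x; exact: funeneg_ge0.
congr (fine (_ - _)); apply: eq_integral => x _.
  by rewrite !funeposE/= -!EFin_max -EFinM maxr_pMl// mul0r.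
by rewrite !funenegE/= -!EFin_max -EFinM maxr_pMl// mul0r mulNr.
Qed.


End density.

Section directional_derivative.
Context (R : realType) (d : nat).

Lemma quadratic_is_derive (g : 'rV[R]_d -> R) (y v : 'rV[R]_d) (l C : R) :
  (forall t, `|t| <= 1 -> `|g (y + t *: v) - g y - t * l| <= t ^+ 2 * C) ->
  derivable g y v /\ 'D_v g y = l.
Proof.
move=> h.
have C0 : 0 <= C.
  by have := h 1; rewrite normr1 expr1n !mul1r => /(_ (lexx _))/(le_trans (normr_ge0 _)).
suff cvg_l : (fun t => t^-1 *: ((g \o shift y) (t *: v) - g y)) @ 0^' --> l.
  by split; [exact: cvgP cvg_l|exact: (cvg_lim (@Rhausdorff R) cvg_l)].
apply/cvgrPdist_le => e e0; near=> t.
have t0 : t != 0 by near: t; exact: nbhs_dnbhs_neq.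
have t1 : `|t| <= Num.min 1 (e / (C + 1)).
  near: t; apply: dnbhs0_le; by rewrite lt_min ltr01 divr_gt0// ltr_wpDl.
move: t1; rewrite le_min => /andP[t1 te].
have := h t t1; rewrite /= [t *: v + y]addrC => ht.
rewrite -(@ler_pM2l _ `|t|) ?normr_gt0// -normrM.
rewrite (_ : t * _ = - (g (y + t *: v) - g y - t * l)); last first.
  by rewrite /GRing.scale/=; field.
rewrite normrN (le_trans ht)// -real_normK ?num_real// expr2 -mulrA ler_wpM2l//.
rewrite (@le_trans _ _ (`|t| * (C + 1)))//.
  by rewrite ler_wpM2l// lerDl.
by rewrite -ler_pdivlMr// ltr_wpDl.
Unshelve. all: by end_near. Qed.

(** Differentiation under the integral sign: [trig_taylor] in y leaves a remainder of at most t^2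
    u_j^2 |f u|, integrable because [f] decays rapidly. *)
Lemma partial_fourier (f : 'rV[R]_d -> R) s j :
  measurable_fun setT f -> rapid f ->
  partial j (fourier f s) = fourier (fun u : 'rV[R]_d => u ord0 j * f u) s.+1.
Proof.
move=> mf rf; apply/funext => y.
have mc : measurable_fun setT (fun u : 'rV[R]_d => u ord0 j) by exact: measurable_coord.
have intf := rapid_integrable mf rf.
have int1 : (lebesgue_measure_rV R d).-integrable setT
    (EFin \o (fun u : 'rV[R]_d => u ord0 j * f u)).
  apply: rapid_integrable; first exact: measurable_funM.
  exact: rapidM (poly_bounded_coord R j) rf.
have int2 : (lebesgue_measure_rV R d).-integrable setT
    (EFin \o (fun u : 'rV[R]_d => u ord0 j ^+ 2 * `|f u|)).
  apply: rapid_integrable.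
    by apply: measurable_funM; [exact: measurable_funX|exact: measurableT_comp].
  apply: rapidM (rapid_norm rf).
  exact: poly_boundedM (poly_bounded_coord R j) (poly_bounded_coord R j).
apply: (@quadratic_is_derive _ _ _ _
  (\int[lebesgue_measure_rV R d]_(u in setT) ((u : 'rV[R]_d) ord0 j ^+ 2 * `|f u|)) _).2 => t t1.
apply: Rintegral_taylor => //; try exact: integrable_fourier.
move=> u _; rewrite dotvDr dotvZr dotv_delta.
rewrite (_ : _ - _ - _ = f u * (trig s (dotv u y + t * u ord0 j) - trig s (dotv u y) -
  t * u ord0 j * trig s.+1 (dotv u y))); last by ring.
by rewrite normrM mulrA -exprMn mulrC ler_wpM2r// trig_taylor.
Qed.

End directional_derivative.

Section inversion.
Context (R : realType) (d : nat).
Local Notation leb := (lebesgue_measure_rV R d).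
Implicit Types (x y u : 'rV[R]_d) (s : R).

Lemma continuous_fourier (f : 'rV[R]_d -> R) n : measurable_fun setT f -> rapid f ->
  continuous (fourier f n).
Proof.
move=> mf rf; have intf := rapid_integrable mf rf.
have intb : leb.-integrable setT (EFin \o (fun u => bracket u * `|f u|)).
  apply: rapid_integrable.
    by apply: measurable_funM; [exact: measurable_bracket|exact: measurableT_comp].
  apply: rapidM (rapid_norm rf); exists 1%N, 1 => // u.
  by rewrite expr1 mul1r ger0_norm.
apply: lipschitz_continuous => y; exists (\int[leb]_u (bracket u * `|f u|)) => h _.
rewrite mulrC -(RintegralZl _ measurableT intb); apply: normr_RintegralB_le => //.
- exact: integrable_fourier.
- exact: integrable_fourier.
- exact: (integrableZl measurableT (enorm h) intb).
move=> u _; rewrite -mulrBr normrM mulrC mulrA ler_wpM2r//.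
rewrite (le_trans (trig_lip _ _ _))// dotvDr addrC addKr mulrC.
by rewrite (le_trans (normr_dotv_le _ _))// ler_wpM2r// /bracket lerDr.
Qed.

Variables (P : probability 'rV[R]_d R) (p ch k : 'rV[R]_d -> R) (M : R).
Hypotheses (mp : measurable_fun setT p) (p0 : forall x, 0 <= p x).
Hypothesis Pp : forall A, measurable A -> P A = (\int[leb]_(x in A) (p x)%:E)%E.
Hypothesis cp : continuous p.
Hypotheses (mch : measurable_fun setT ch) (rch : rapid ch).
Hypothesis P_cos : forall u, \int[P]_x cos (dotv u x) = ch u.
Hypothesis P_sin : forall u, \int[P]_x sin (dotv u x) = 0.
Hypotheses (mk : measurable_fun setT k) (rk : rapid k).
Hypothesis k_near1 : forall u, `|1 - k u| <= M * enorm u ^+ 2.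
Hypothesis k_decay : forall N, exists2 C, 0 <= C &
  forall y, `|fourier k 0 y| * bracket y ^+ N <= C.

Let G := fourier k 0.

Let intk := rapid_integrable mk rk.

Let mG : measurable_fun setT G.
Proof. by apply: continuous_rV_measurable; exact: continuous_fourier. Qed.

Let rG : rapid G. Proof. exact: k_decay. Qed.

Let intG := rapid_integrable mG rG.

Let scaled s u := k (s *: u).

Let intks s : 0 < s -> leb.-integrable setT (EFin \o scaled s).
Proof.
move=> s0; apply: eq_integrable (integrable_affine 0 s0 intk) => // u _.
by rewrite add0r.
Qed.

Let Gs s := fourier (scaled s) 0.

Let Gs_scale s x : 0 < s -> Gs s x = s^-1 ^+ d * G (s^-1 *: x).
Proof.
move=> s0; rewrite -(Rintegral_affine 0 s0 (integrable_fourier 0 (s^-1 *: x) intk)).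
apply: eq_Rintegral => u _; rewrite add0r /scaled; congr (_ * trig _ _).
by rewrite dotvZl dotvZr mulrA divff ?mul1r// gt_eqF.
Qed.

Let int_cos u : P.-integrable setT (EFin \o (fun x => cos (dotv u x))).
Proof.
apply: (@integrable_dominated _ _ _ _ _ measurableT _ (cst 1)) => //.
- by under eq_fun do rewrite -trig0; exact: measurable_trig_dotv.
- exact: finite_measure_integrable_cst.
- by move=> x _; rewrite ler_norml cos_geN1 cos_le1.
Qed.

Let int_sin u : P.-integrable setT (EFin \o (fun x => sin (dotv u x))).
Proof.
apply: (@integrable_dominated _ _ _ _ _ measurableT _ (cst 1)) => //.
- apply: (measurableT_comp (f := @sin R)); last exact: measurable_dotv.
  by apply: continuous_measurable_fun; exact: continuous_sin.
- exact: finite_measure_integrable_cst.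
- by move=> x _; rewrite ler_norml sin_geN1 sin_le1.
Qed.

Let P_trig_shift u y : \int[P]_x trig 0 (dotv u (x - y)) = ch u * trig 0 (dotv u y).
Proof.
have i1 : P.-integrable setT (EFin \o (fun x => cos (dotv u y) * cos (dotv u x))).
  exact: (integrableZl measurableT _ (int_cos u)).
have i2 : P.-integrable setT (EFin \o (fun x => sin (dotv u y) * sin (dotv u x))).
  exact: (integrableZl measurableT _ (int_sin u)).
rewrite (_ : \int[P]_x _ = \int[P]_x (cos (dotv u y) * cos (dotv u x) +
    sin (dotv u y) * sin (dotv u x))); last first.
  by apply: eq_Rintegral => x _; rewrite trig0 dotvBr cosB; ring.
rewrite (RintegralD measurableT i1 i2) (RintegralZl _ measurableT (int_cos u)).
by rewrite (RintegralZl _ measurableT (int_sin u)) P_cos P_sin mulr0 addr0 trig0 mulrC.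
Qed.

(* Abel means of the inverse transform: as [s] tends to 0 they converge to [fourier ch 0 y],
   while by Fubini they are the convolution of [P] with the approximate unit [Gs s]. *)
Let Ls s y := fourier (fun u => ch u * scaled s u) 0 y.

Let LsE s y : 0 < s -> Ls s y = \int[P]_x Gs s (x - y).
Proof.
move=> s0; have iks := intks s0.
have /measurable_EFinP mks := measurable_int leb iks.
pose F (z : 'rV[R]_d * 'rV[R]_d) := scaled s z.2 * trig 0 (dotv z.2 (z.1 - y)).
have mF : measurable_fun setT F.
  apply: measurable_funM; first exact: (measurableT_comp mks measurable_snd).
  under eq_fun do rewrite trig0; apply: (measurableT_comp (f := @cos R)).
    by apply: continuous_measurable_fun; exact: continuous_cos.
  apply: measurable_sum => j; apply: measurable_funM.
    exact: (measurableT_comp (@measurable_coord R 1 d ord0 j) measurable_snd).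
  under eq_fun do rewrite !mxE; apply: measurable_funB => //.
  exact: (measurableT_comp (@measurable_coord R 1 d ord0 j) measurable_fst).
have F_le x u : `|F (x, u)| <= cst 1 x * `|scaled s u|.
  by rewrite mul1r normrM ler_piMr// trig_le1.
rewrite /Gs /fourier (@Rintegral_fubini _ _ _ _ _ P leb F (cst 1) (fun u => `|scaled s u|))//.
- apply: eq_Rintegral => u _; rewrite /F/=.
  rewrite RintegralZl//; first by rewrite P_trig_shift; ring.
  apply: (@integrable_dominated _ _ _ _ _ measurableT _ (cst 1)) => //.
  + under eq_fun do rewrite trig0 dotvBr.
    apply: (measurableT_comp (f := @cos R)).
      by apply: continuous_measurable_fun; exact: continuous_cos.
    by apply: measurable_funB => //; exact: measurable_dotv.
  + exact: finite_measure_integrable_cst.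
  + by move=> x _; exact: trig_le1.
- exact: finite_measure_integrable_cst.
- exact: (integrable_norm iks).
Qed.

(** The factor s^(- d) of [Gs] cancels the Jacobian, so the kernel keeps the same integral for every
    [s]. *)
Let int_Gs s y : 0 < s -> leb.-integrable setT (EFin \o (fun x => Gs s (x - y))) /\
  \int[leb]_x Gs s (x - y) = \int[leb]_x G x.
Proof.
move=> s0; have s0' : 0 < s^-1 by rewrite invr_gt0.
have ia : leb.-integrable setT (EFin \o (fun x => G (s^-1 *: x))).
  by apply: eq_integrable (integrable_affine 0 s0' intG) => // x _; rewrite add0r.
have iGs : leb.-integrable setT (EFin \o Gs s).
  apply: eq_integrable (integrableZl measurableT (s^-1 ^+ d) ia) => // x _.
  by rewrite /= -EFinM -Gs_scale.
split; first exact: (integrable_shift (- y) iGs).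
rewrite (Rintegral_shift (- y) iGs) (_ : \int[leb]_x Gs s x =
  \int[leb]_x (s^-1 ^+ d * G (s^-1 *: x))); last first.
  by apply: eq_Rintegral => x _; rewrite Gs_scale.
rewrite (RintegralZl _ measurableT ia) (_ : \int[leb]_x G (s^-1 *: x) =
  \int[leb]_x G (0 + s^-1 *: x)); last by apply: eq_Rintegral => x _; rewrite add0r.
rewrite (Rintegral_affine 0 s0' intG) invrK mulrA -exprMn mulVf ?gt_eqF//.
by rewrite expr1n mul1r.
Qed.

Let int_absGs s y : 0 < s -> leb.-integrable setT (EFin \o (fun x => `|Gs s (x - y)|)) /\
  \int[leb]_x `|Gs s (x - y)| = \int[leb]_x `|G x|.
Proof.
move=> s0; have s0' : 0 < s^-1 by rewrite invr_gt0.
have [iG _] := int_Gs y s0; split; first exact: (integrable_norm iG).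
have iN := integrable_norm intG.
have ia : leb.-integrable setT (EFin \o (fun x => `|G (s^-1 *: x)|)).
  by apply: eq_integrable (integrable_affine 0 s0' iN) => // x _; rewrite add0r.
have iGs : leb.-integrable setT (EFin \o (fun x => `|Gs s x|)).
  apply: eq_integrable (integrableZl measurableT (s^-1 ^+ d) ia) => // x _.
  by rewrite /= -EFinM Gs_scale// normrM ger0_norm// exprn_ge0// ltW.
rewrite (Rintegral_shift (- y) iGs) (_ : \int[leb]_x `|Gs s x| =
  \int[leb]_x (s^-1 ^+ d * `|G (s^-1 *: x)|)); last first.
  apply: eq_Rintegral => x _; rewrite Gs_scale// normrM ger0_norm// exprn_ge0//.
  exact: ltW.
rewrite (RintegralZl _ measurableT ia) (_ : \int[leb]_x `|G (s^-1 *: x)| =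
  \int[leb]_x `|G (0 + s^-1 *: x)|); last by apply: eq_Rintegral => x _; rewrite add0r.
rewrite (Rintegral_affine 0 s0' iN) invrK mulrA -exprMn mulVf ?gt_eqF//.
by rewrite expr1n mul1r.
Qed.

(** The kernel satisfies |1 - k (s u)| <= M s^2 |u|^2, and |u|^2 |ch u| is integrable. Only the
    linear rate is retained, as s^2 <= s. *)
Let Ls_near y : exists2 C, 0 <= C &
  forall s, 0 < s <= 1 -> `|Ls s y - fourier ch 0 y| <= s * C.
Proof.
have intch := rapid_integrable mch rch.
have M0 : 0 <= `|M| by [].
have intb : leb.-integrable setT (EFin \o (fun u => `|M| * enorm u ^+ 2 * `|ch u|)).
  apply: rapid_integrable.
    apply: measurable_funM; last exact: measurableT_comp.
    by apply: measurable_funM => //; apply: measurable_funX; exact: measurable_enorm.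
  apply: rapidM (rapid_norm rch); exists 2%N, `|M| => // u.
  rewrite normrM normr_id ler_wpM2l// ger0_norm ?sqr_ge0// ler_sqr ?nnegrE//.
  by rewrite /bracket lerDr.
exists (\int[leb]_u (`|M| * enorm u ^+ 2 * `|ch u|)).
  by apply: Rintegral_ge0 => u _; rewrite mulr_ge0// mulr_ge0// sqr_ge0.
move=> s /andP[s0 s1].
have ks_near u : `|1 - scaled s u| <= s * (`|M| * enorm u ^+ 2).
  rewrite (le_trans (k_near1 _))// enormZ (gtr0_norm s0) exprMn mulrCA.
  rewrite (@le_trans _ _ (s ^+ 2 * (`|M| * enorm u ^+ 2)))//.
    by rewrite ler_wpM2l ?sqr_ge0// ler_wpM2r ?sqr_ge0// ler_norm.
  by rewrite ler_wpM2r ?mulr_ge0 ?sqr_ge0// expr2 ler_piMl// ltW.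
have /measurable_EFinP mks := measurable_int leb (intks s0).
have intchk : leb.-integrable setT (EFin \o (fun u => ch u * scaled s u)).
  apply: (@integrable_dominated _ _ _ _ _ measurableT _
    (fun u => `|ch u| + `|M| * enorm u ^+ 2 * `|ch u|)).
  - exact: measurable_funM.
  - by apply: eq_integrable (integrableD measurableT (integrable_norm intch) intb).
  move=> u _; rewrite normrM mulrC -{2}[`|ch u|]mul1r -mulrDl ler_wpM2r//.
  rewrite (_ : scaled s u = 1 - (1 - scaled s u)); last by rewrite opprB addrC subrK.
  rewrite (le_trans (ler_normB _ _))// normr1 lerD2l (le_trans (ks_near u))//.
  by rewrite ler_piMl// mulr_ge0// sqr_ge0.
rewrite -(RintegralZl _ measurableT intb); apply: normr_RintegralB_le => //.
- exact: integrable_fourier.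
- exact: integrable_fourier.
- exact: (integrableZl measurableT s intb).
move=> u _; rewrite -mulrBl normrM (le_trans (ler_piMr _ (trig_le1 _ _)))//.
rewrite (_ : _ - _ = ch u * - (1 - scaled s u)); last by ring.
by rewrite normrM normrN mulrC mulrA ler_wpM2r.
Qed.

Let int_p : leb.-integrable setT (EFin \o p).
Proof.
by apply: integrable_ge0P => //; rewrite -Pp// probability_setT ltry.
Qed.

Let int_p1 : \int[leb]_x p x = 1.
Proof. by rewrite /Rintegral -Pp// probability_setT. Qed.

Let p_near y e : 0 < e -> exists2 r, 0 < r &
  forall x, enorm (x - y) < r -> `|p x - p y| <= e.
Proof.
move=> e0; have /(@cvgrPdist_le _ _ _ (nbhs y) (nbhs_filter y))/(_ e e0) := @cp y.
move=> /nbhs_ballP[r /= r0 h]; exists r => // x xy; rewrite distrC; apply: h.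
rewrite -ball_normE/= distrC (le_lt_trans _ xy)//.
rewrite [leLHS]/Num.norm/= mx_normrE; apply/bigmax_leP; split => // -[a j] _ /=.
by rewrite (ord1 a) coord_le_enorm.
Qed.

(** The decay of [G] is used with exponent 2d + (d + 1). The part 2d leaves an integrable function
    of x; on |x| >= e the part d + 1 gives (s/e)^(d + 1), which absorbs the s^(- d) of the kernel
    and leaves one factor s. *)
Let Gs_far e : 0 < e -> exists2 C, 0 <= C & forall s x, 0 < s <= 1 -> e <= enorm x ->
  `|Gs s x| <= s * (C * bracket x ^- d.*2).
Proof.
move=> e0; have [C C0 hC] := rG (d.*2 + d.+1)%N.
exists (C * e ^- d.+1); first by rewrite mulr_ge0// invr_ge0 exprn_ge0// ltW.
move=> s x /andP[s0 s1] ex; rewrite Gs_scale// normrM ger0_norm; last first.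
  by rewrite exprn_ge0// invr_ge0 ltW.
pose z := s^-1 *: x.
have nz : enorm z = s^-1 * enorm x by rewrite enormZ gtr0_norm// invr_gt0.
have z1 : bracket x <= bracket z.
  by rewrite /bracket lerD2l nz ler_peMl// invf_ge1.
have z2 : e / s <= bracket z.
  by rewrite /bracket nz mulrC (@le_trans _ _ (s^-1 * enorm x)) ?lerDr// ler_wpM2l// invr_ge0 ltW.
have es0 : 0 < e / s by rewrite divr_gt0.
have hz : `|G z| <= C * bracket x ^- d.*2 * (e / s) ^- d.+1.
  have : `|G z| <= C / bracket z ^+ (d.*2 + d.+1) by rewrite ler_pdivlMr ?exprn_gt0.
  move=> /le_trans; apply; rewrite exprD invfM mulrA ler_pM//.
  - by rewrite mulr_ge0// invr_ge0 exprn_ge0.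
  - by rewrite invr_ge0 exprn_ge0.
  - by rewrite ler_wpM2l// lef_pV2 ?posrE ?exprn_gt0// lerXn2r ?nnegrE.
  - by rewrite lef_pV2 ?posrE ?exprn_gt0// lerXn2r ?nnegrE// ltW.
rewrite (le_trans (ler_wpM2l _ hz))//; first by rewrite exprn_ge0// invr_ge0 ltW.
rewrite le_eqVlt; apply/orP; left; apply/eqP.
have -> : (e / s) ^- d.+1 = e ^- d.+1 * (s * s ^+ d).
  by rewrite expr_div_n invf_div mulrC (exprS s).
rewrite exprVn; have sd : s ^- d * s ^+ d = 1 by rewrite mulVf// expf_neq0// gt_eqF.
by rewrite -[RHS]mul1r -sd; ring.
Qed.

(** Pointwise form of the approximate-unit argument: either the values of the density are close or
    the kernel is small. In the second case [px] is integrable by itself, whereas the constant [py]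
    keeps the integrable factor [b]. *)
Let near_far_le (px py g b s C e : R) : 0 <= px -> 0 <= py -> 0 <= b <= 1 -> 0 <= s ->
  0 <= C -> 0 <= e -> `|px - py| <= e \/ `|g| <= s * (C * b) ->
  `|px - py| * `|g| <= e * `|g| + s * C * (px + py * b).
Proof.
move=> px0 py0 /andP[b0 b1] s0 C0 e0 [h|h].
  by rewrite ler_wpDr ?ler_wpM2r// mulr_ge0 ?mulr_ge0// addr_ge0// mulr_ge0.
rewrite ler_wpDl ?mulr_ge0//.
rewrite (@le_trans _ _ ((px + py) * (s * (C * b))))//.
  by rewrite ler_pM// (le_trans (ler_normB _ _))// !ger0_norm.
rewrite mulrDl mulrDr lerD//.
  rewrite [leLHS](_ : _ = s * C * px * b); last by ring.
  by rewrite ler_piMr// !mulr_ge0.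
by rewrite le_eqVlt; apply/orP; left; apply/eqP; ring.
Qed.

Let Ls_approx y e : 0 < e -> exists2 C, 0 <= C & forall s, 0 < s <= 1 ->
  `|Ls s y - p y * \int[leb]_x G x| <= e * \int[leb]_x `|G x| + s * C.
Proof.
move=> e0; have [r r0 hr] := p_near y e0; have [C C0 hC] := Gs_far r0.
have intB := integrable_bracketV R (leqnn d.*2).
have intBy : leb.-integrable setT (EFin \o (fun x => bracket (x - y) ^- d.*2)).
  exact: (integrable_shift (- y) intB).
pose B := \int[leb]_x (bracket x ^- d.*2).
have By : \int[leb]_x (bracket (x - y) ^- d.*2) = B by exact: (Rintegral_shift (- y) intB).
have B0 : 0 <= B by apply: Rintegral_ge0 => x _; rewrite invr_ge0 exprn_ge0.
exists (C * (1 + p y * B)); first by rewrite mulr_ge0// addr_ge0// mulr_ge0.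
move=> s s01; have /andP[s0 s1] := s01.
have [iGs EGs] := int_Gs y s0; have [iaGs EaGs] := int_absGs y s0.
have /measurable_EFinP mGs := measurable_int leb iGs.
have iPGs : P.-integrable setT (EFin \o (fun x => Gs s (x - y))).
  apply: (@integrable_dominated _ _ _ P _ measurableT _ (cst (\int[leb]_u `|scaled s u|)) mGs).
    exact: finite_measure_integrable_cst.
  by move=> x _; exact: (normr_fourier_le _ _ (intks s0)).
have [iGp EGp] := Rintegral_density mp p0 Pp iPGs.
have ipB : leb.-integrable setT (EFin \o (fun x => p y * bracket (x - y) ^- d.*2)).
  exact: (integrableZl measurableT (p y) intBy).
have ipB2 : leb.-integrable setT (EFin \o (fun x => p x + p y * bracket (x - y) ^- d.*2)).
  by apply: eq_integrable (integrableD measurableT int_p ipB).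
have i1 : leb.-integrable setT (EFin \o (fun x => e * `|Gs s (x - y)|)).
  exact: (integrableZl measurableT e iaGs).
have i2 : leb.-integrable setT
    (EFin \o (fun x => s * C * (p x + p y * bracket (x - y) ^- d.*2))).
  exact: (integrableZl measurableT (s * C) ipB2).
have i0 : leb.-integrable setT (EFin \o (fun x => p y * Gs s (x - y))).
  exact: (integrableZl measurableT (p y) iGs).
have i12 : leb.-integrable setT (EFin \o (fun x => e * `|Gs s (x - y)| +
    s * C * (p x + p y * bracket (x - y) ^- d.*2))).
  by apply: eq_integrable (integrableD measurableT i1 i2).
rewrite (LsE y s0) EGp -EGs -(RintegralZl _ measurableT iGs).
have -> : e * \int[leb]_x `|G x| + s * (C * (1 + p y * B)) =
    \int[leb]_x (e * `|Gs s (x - y)| + s * C * (p x + p y * bracket (x - y) ^- d.*2)).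
  rewrite (RintegralD measurableT i1 i2) (RintegralZl _ measurableT iaGs) EaGs.
  rewrite (RintegralZl _ measurableT ipB2) (RintegralD measurableT int_p ipB) int_p1.
  by rewrite (RintegralZl _ measurableT intBy) By mulrA.
apply: (normr_RintegralB_le measurableT iGp i0 i12) => x _.
rewrite mulrC -mulrBl normrM.
have b01 : 0 <= bracket (x - y) ^- d.*2 <= 1.
  by rewrite invr_ge0 exprn_ge0 ?bracket_ge0//= invf_le1 ?exprn_gt0 ?exprn_ege1.
apply: near_far_le (p0 x) (p0 y) b01 (ltW s0) C0 (ltW e0) _.
have [xr|xr] := ltP (enorm (x - y)) r; first by left; exact: hr.
by right; exact: hC.
Qed.

Lemma fourier_inversion y : p y * \int[leb]_x G x = fourier ch 0 y.
Proof.
have [C1 C10 h1] := Ls_near y.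
set A := \int[leb]_x `|G x|; have A0 : 0 <= A by apply: Rintegral_ge0.
apply/eqP; rewrite -subr_eq0 -normr_eq0; apply/negPn/negP => D0.
set D := `|_| in D0; have {}D0 : 0 < D by rewrite lt_neqAle eq_sym D0 /D normr_ge0.
have A1 : 0 < 4 * (A + 1) by rewrite mulr_gt0// ltr_wpDl.
(* The tolerance and then [s] are chosen so that the two kinds of error are at most D/4 each; their
   sum is less than D. *)
have [C2 C20 h2] := Ls_approx y (divr_gt0 D0 A1).
have C1' : 0 < 4 * (C1 + C2 + 1) by rewrite mulr_gt0// ltr_wpDl// addr_ge0.
pose s := Num.min 1 (D / (4 * (C1 + C2 + 1))).
have s01 : 0 < s <= 1 by rewrite lt_min ltr01 divr_gt0//= ge_min lexx.
have sD : s * (C1 + C2) <= D / 4.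
  rewrite (@le_trans _ _ (D / (4 * (C1 + C2 + 1)) * (C1 + C2)))//.
    by rewrite ler_wpM2r ?addr_ge0// ge_min lexx orbT.
  rewrite invfM mulrA -mulrA ler_piMr ?divr_ge0 ?(ltW D0)//.
  by rewrite mulrC ler_pdivrMr ?mul1r ?lerDl// ltr_wpDl// addr_ge0.
have AD : D / (4 * (A + 1)) * A <= D / 4.
  rewrite invfM mulrA -mulrA ler_piMr ?divr_ge0 ?(ltW D0)//.
  by rewrite mulrC ler_pdivrMr ?mul1r ?lerDl// ltr_wpDl.
have : D <= `|Ls s y - fourier ch 0 y| + `|Ls s y - p y * \int[leb]_x G x|.
  rewrite /D (_ : _ - _ = (Ls s y - fourier ch 0 y) - (Ls s y - p y * \int[leb]_x G x)).
    exact: ler_normB.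
  by ring.
move=> /le_trans/(_ (lerD (h1 s s01) (h2 s s01))); apply/negP; rewrite -ltNge.
rewrite -/A addrCA -mulrDr (le_lt_trans (lerD AD sD))//.
by rewrite -mulrDl ltr_pdivrMr//; move: D0; lra.
Qed.

End inversion.

(** * The stable density *)

Section exponent_splitting.
Context (R : realType) (d : nat).
Variable nu : {measure set 'rV[R]_d -> \bar R}.
Variable far : {finite_measure set 'rV[R]_d -> \bar R}.
Local Notation Rd := 'rV[R]_d.
Hypothesis int_near : forall u, nu.-integrable (@uball R d) (fun y => (1 - cos (dotv u y))%:E).
Hypothesis farE : forall A, measurable A -> far A = nu (A `&` ~` @uball R d).

Let mfar : measurable (~` @uball R d) := measurableC (@measurable_uball R d).

Let disjoint_uball : [disjoint @uball R d & ~` @uball R d]%classic.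
Proof. by rewrite disj_set2E setICr. Qed.

Let measurable_cosm u : measurable_fun setT (fun y : Rd => 1 - cos (dotv u y)).
Proof.
apply: measurable_funB; first exact: measurable_cst.
apply: (measurableT_comp (f := @cos R)); last exact: measurable_dotv.
by apply: continuous_measurable_fun; exact: continuous_cos.
Qed.

Let integrable_cosdot u : far.-integrable setT (fun y : Rd => (cos (dotv u y))%:E).
Proof.
apply: (@integrable_dominated _ _ _ far _ measurableT _ (cst 1)).
- apply: (measurableT_comp (f := @cos R)); last exact: measurable_dotv.
  by apply: continuous_measurable_fun; exact: continuous_cos.
- exact: finite_measure_integrable_cst.
- by move=> y _; rewrite ler_norml cos_geN1 cos_le1.
Qed.

Let integrable_far u : far.-integrable setT (fun y : Rd => (1 - cos (dotv u y))%:E).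
Proof.
apply: (@integrable_dominated _ _ _ far _ measurableT _ (cst 2)) => //.
  exact: finite_measure_integrable_cst.
move=> y _; rewrite (le_trans (ler_normB _ _))// normr1 -[leRHS]/(1 + 1) lerD2l.
by rewrite ler_norml cos_geN1 cos_le1.
Qed.

Let far_integralE (f : Rd -> \bar R) : measurable_fun setT f ->
  (\int[far]_y f y = \int[nu]_(y in ~` @uball R d) f y)%E.
Proof.
move=> mf; rewrite -{1}(setUv (@uball R d)).
rewrite (integral_setU _ (@measurable_uball R d) mfar) ?disjoint_uball//; last first.
  exact: measurable_funTS.
(* On the unit ball [far] agrees with the zero measure. *)
rewrite (@eq_measure_integral _ _ _ (@uball R d) mzero far); last first.
  move=> A mA AU; apply: (etrans (farE mA)); rewrite (_ : A `&` _ = set0) ?measure0//.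
  by rewrite -subset0 => x [/AU].
rewrite integral_measure_zero add0e.
by apply: eq_measure_integral => A mA AU; apply: (etrans (farE mA)); rewrite setIidl.
Qed.

Lemma levy_exponentE u :
  levy_exponent nu u = psi nu u + (fine (far setT) - cos_transform far u).
Proof.
have mf : measurable_fun setT (fun y : Rd => (1 - cos (dotv u y))%:E).
  exact/measurable_EFinP.
have intf : nu.-integrable (~` @uball R d) (fun y : Rd => (1 - cos (dotv u y))%:E).
  apply/integrableP; split; first exact: measurable_funTS.
  rewrite -far_integralE; last exact: measurableT_comp.
  by have /integrableP[] := integrable_far u.
have intT : nu.-integrable (@uball R d `|` ~` @uball R d)
    (fun y : Rd => (1 - cos (dotv u y))%:E).
  apply/integrableP; split; first exact: measurable_funTS.
  rewrite (integral_setU _ (@measurable_uball R d) mfar) ?disjoint_uball//; last first.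
    by apply: measurable_funTS; exact: measurableT_comp.
  apply: lte_add_pinfty; last by have /integrableP[] := intf.
  by have /integrableP[] := int_near u.
rewrite /levy_exponent -{1}(setUv (@uball R d))
  (Rintegral_setU (@measurable_uball R d) mfar intT) ?disjoint_uball//.
congr (_ + _).
rewrite /Rintegral -far_integralE// -/(Rintegral _ _ _).
rewrite (RintegralB measurableT (f1 := cst 1) _ (integrable_cosdot u)).
  by rewrite (Rintegral_cst far measurableT 1) mul1r.
exact: finite_measure_integrable_cst.
Qed.

End exponent_splitting.

(** * Weighted bounds for transforms involving the full characteristic function *)

Section compound_poisson_factor.
Context (R : realType) (d : nat) (i0 : 'I_d).
Variables (alpha gamma c : R).
Variable nu : {measure set 'rV[R]_d -> \bar R}.
Variable far : {finite_measure set 'rV[R]_d -> \bar R}.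
Local Notation Rd := 'rV[R]_d.
Local Notation leb := (lebesgue_measure_rV R d).
Hypothesis alpha0 : 0 < alpha.
Hypothesis near : nu.-integrable (@uball R d) (fun y => (enorm y ^+ 2)%:E).
Hypothesis psi_low : exists2 c : R, 0 < c &
  forall u : Rd, 1 <= enorm u -> c * enorm u `^ alpha <= psi nu u.
Hypothesis c0 : 0 <= c.
Hypothesis far_ball : forall (y : Rd) (r : R), 0 < r < enorm y / 2 ->
  (far (eball y r) <= (c * enorm y `^ (- alpha - gamma) * r `^ gamma)%:E)%E.

Local Notation chi := (cos_transform far).

(* [far] is the restriction of [nu] to the complement of the unit ball; see [levy_exponentE]. *)
Definition stable_char (u : Rd) : R :=
  phi nu u * expR (- fine (far setT)) * expR (chi u).

Lemma stable_char_gt0 u : 0 < stable_char u.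
Proof. exact: (mulr_gt0 (mulr_gt0 (phi_gt0 _ _) (expR_gt0 _)) (expR_gt0 _)). Qed.

Lemma stable_char_le u : stable_char u <= phi nu u.
Proof.
rewrite /stable_char -mulrA -expRD ler_piMr ?(ltW (phi_gt0 _ _))//.
rewrite -expR0 ler_expR addrC subr_le0.
by rewrite (le_trans (ler_norm _))// normr_cos_transform.
Qed.

(** [chi] need not be integrable for Lebesgue measure, so it is multiplied by the integrable [phi],
    where Fubini gives measurability, and then divided by it. *)
Lemma measurable_cos_transform : measurable_fun setT chi.
Proof.
have iphi := rapid_integrable (measurable_phi near) (rapid_phi alpha0 psi_low).
have /measurable_EFinP m1 := measurable_int leb (integrable_mul_chi far iphi).
rewrite (_ : chi = fun u => expR (psi nu u) * (phi nu u * chi u)); last first.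
  by apply/funext => u; rewrite mulrA /phi -expRD subrr expR0 mul1r.
apply: measurable_funM => //.
by apply: measurableT_comp => //; exact: (measurable_psi near).
Qed.

Lemma measurable_stable_char : measurable_fun setT stable_char.
Proof.
apply: measurable_funM.
  by apply: measurable_funM => //; exact: (measurable_phi near).
by apply: measurableT_comp => //; exact: measurable_cos_transform.
Qed.

Section tame_factor.
Variable a : Rd -> R.
Hypothesis a_tame : forall i, tame nu i a.

Lemma measurable_mul_stable_char : measurable_fun setT (fun u => a u * stable_char u).
Proof.
apply: measurable_funM; first exact: (tame_measurable near (a_tame i0)).
exact: measurable_stable_char.
Qed.

Lemma rapid_mul_stable_char : rapid (fun u => a u * stable_char u).
Proof.
apply: (rapid_le (rapid_mul_phi alpha0 near psi_low (a_tame i0))) => u.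
rewrite [leLHS]normrM [leRHS]normrM (gtr0_norm (stable_char_gt0 u)) (gtr0_norm (phi_gt0 nu u)).
exact: (ler_wpM2l (normr_ge0 _) (stable_char_le u)).
Qed.

Lemma fourier_stable_char_le : exists C : R, forall s y,
  `|fourier (fun u => a u * stable_char u) s y| <= C * weight alpha gamma y.
Proof.
have int_ch := rapid_integrable measurable_mul_stable_char rapid_mul_stable_char.
(* When alpha + gamma <= 0 the weight is at least 1 and the trivial bound by the integral of the
   amplitude is enough. Otherwise the transform without [chi] decays to an integer order above alpha
   + gamma, and adding [chi] preserves the weight. *)
have [kappa0|kappa0] := ltP 0 (alpha + gamma); last first.
  exists (\int[leb]_u `|a u * stable_char u|) => s y.
  rewrite (le_trans (normr_fourier_le s y int_ch))// ler_peMr//.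
    by apply: Rintegral_ge0 => u _; exact: normr_ge0.
  have -> : 1 = bracket y `^ 0 by rewrite powRr0.
  by rewrite /weight ler_powR ?bracket_ge1// -opprD oppr_ge0.
have mphi := measurable_mul_phi near (a_tame i0).
have rphi := rapid_mul_phi alpha0 near psi_low (a_tame i0).
have [C C0 hC] := fourier_decay alpha0 near psi_low (Num.truncn (alpha + gamma)).+1
  a_tame rphi (tame_measurable near (a_tame i0)).
have [K K0 hK] := weight_convolution_le alpha0 kappa0 c0 far_ball.
have decay s (y : Rd) : `|fourier (fun u => a u * phi nu u) s y| <= C * weight alpha gamma y.
  have w0 := weight_gt0 alpha gamma y.
  rewrite -ler_pdivrMr// (le_trans _ (hC s y))// ler_wpM2l//.
  rewrite /weight -powRN -opprD opprK -powR_mulrn ?bracket_ge0//.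
  by rewrite ler_powR ?bracket_ge1// ltW// truncnS_gt.
have iphi := rapid_integrable mphi rphi.
have h := fourier_exp_chi_le K0 hK (weight_le1 kappa0) iphi decay.
have ichi : leb.-integrable setT
    (EFin \o (fun u => a u * phi nu u * expR (chi u))).
  have := integrableZl measurableT (expR (fine (far setT))) int_ch.
  apply: eq_integrable => // u _ /=; rewrite -EFinM; congr EFin.
  by rewrite /stable_char expRN; field; rewrite gt_eqF ?expR_gt0.
exists (expR (- fine (far setT)) * (C * expR K)) => s y.
rewrite (_ : fourier _ s y = expR (- fine (far setT)) *
    fourier (fun u => a u * phi nu u * expR (chi u)) s y); last first.
  rewrite /fourier -(RintegralZl _ measurableT (integrable_fourier s y ichi)).
  by apply: eq_Rintegral => u _; rewrite /stable_char; ring.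
by rewrite normrM (gtr0_norm (expR_gt0 _)) -mulrA ler_wpM2l ?expR_ge0.
Qed.

End tame_factor.

(** A derivative in y falls on the trigonometric factor alone: it multiplies the amplitude by a
    coordinate, which is tame in every direction, and raises the phase. The characteristic function
    itself stays untouched. *)
Lemma mderiv_fourier_stable_char (beta : 'I_d -> nat) a : (forall i, tame nu i a) ->
  exists b s, (forall i, tame nu i b) /\
    mderiv beta (fourier (fun u => a u * stable_char u) 0) =
      fourier (fun u => b u * stable_char u) s.
Proof.
move=> ta; rewrite /mderiv; elim: (enum 'I_d) => [|j l [b [s [tb IH]]]] /=.
  by exists a, 0%N.
rewrite IH; elim: (beta j) => [|n [b' [s' [tb' IHn]]]] /=; first by exists b, s.
exists (fun u : Rd => u ord0 j * b' u), s'.+1; split.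
  by move=> i; apply: tame_mul => //; exact: tame_coord.
rewrite IHn (partial_fourier s' j (measurable_mul_stable_char tb') (rapid_mul_stable_char tb')).
by apply: (congr1 (fun f => fourier f _)); apply/funext => u; rewrite mulrA.
Qed.

End compound_poisson_factor.

Section stable_density.
Context (R : realType) (d : nat) (alpha : R).
Variable nu : {measure set 'rV[R]_d -> \bar R}.
Variable far : {finite_measure set 'rV[R]_d -> \bar R}.
Local Notation Rd := 'rV[R]_d.
Local Notation leb := (lebesgue_measure_rV R d).
Hypothesis alpha0 : 0 < alpha.
Hypothesis near : nu.-integrable (@uball R d) (fun y => (enorm y ^+ 2)%:E).
Hypothesis psi_low : exists2 c : R, 0 < c &
  forall u : Rd, 1 <= enorm u -> c * enorm u `^ alpha <= psi nu u.

Local Notation ch := (stable_char nu far).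

Let mch : measurable_fun setT ch := measurable_stable_char far alpha0 near psi_low.

Let rapid_ch : rapid ch.
Proof.
apply: (rapid_le (rapid_phi alpha0 psi_low)) => u.
rewrite (gtr0_norm (stable_char_gt0 nu far u)) (gtr0_norm (phi_gt0 nu u)).
exact: stable_char_le.
Qed.

(** At the origin the transform is the integral of a strictly positive function. If it were zero the
    whole space would be Lebesgue null, although the unit cube has measure 1. *)
Lemma fourier_stable_char0_neq0 : fourier ch 0 0 != 0.
Proof.
have ich := rapid_integrable mch rapid_ch.
have chE : fourier ch 0 0 = \int[leb]_u ch u.
  apply: eq_Rintegral => u _.
  rewrite trig0 (_ : dotv u 0 = 0) ?cos0 ?mulr1//.
  by rewrite /dotv big1// => i _; rewrite mxE mulr0.
rewrite chE; apply/eqP => ch0.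
have : (\int[leb]_u `|(ch u)%:E| = 0)%E.
  apply: (@etrans _ _ (\int[leb]_u ch u)%R%:E); last by rewrite ch0.
  rewrite -(Rintegral_EFin measurableT ich).
  by apply: eq_integral => u _; rewrite gee0_abs// lee_fin ltW// stable_char_gt0.
have mE : measurable_fun setT (EFin \o ch) by exact/measurable_EFinP.
move=> /(ae_eq_integral_abs leb measurableT mE)[N [mN N0 hN]].
have NT : N = setT.
  rewrite -subTset => u _; apply: hN => /= /(_ I) => -[h].
  by have := stable_char_gt0 nu far u; rewrite h ltxx.
have := @lebesgue_measure_rV_box R d 0 (const_mx 1).
set B := [set x | _] => hB.
have {hB} : leb B = 1%:E.
  rewrite hB => [|i]; last by rewrite !mxE.
  by rewrite big1// => i _; rewrite !mxE subr0.
have : (leb B <= leb N)%E.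
  by rewrite NT; apply: le_measure; rewrite ?inE//; exact: measurable_rV_box.
by rewrite N0 => + B1; rewrite B1 lee_fin ler10.
Qed.

Lemma density_fourier (P : probability Rd R) (p : Rd -> R) :
  is_density P p -> continuous p ->
  (forall u, char_fun P u = (ch u)%:C%C) ->
  p = fourier (fun u => (\int[leb]_x fourier (phi nu) 0 x)^-1 * ch u) 0.
Proof.
move=> [mp p0 Pp] cp chP.
have P_cos u : \int[P]_x cos (dotv u x) = ch u by have [] := chP u.
have P_sin u : \int[P]_x sin (dotv u x) = 0 by have [] := chP u.
have phi_near1 u :
    `|1 - phi nu u| <= (\int[nu]_(y in @uball R d) enorm y ^+ 2) * enorm u ^+ 2.
  rewrite ger0_norm ?subr_ge0 ?phi_le1// (le_trans _ (psi_le near u))//.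
  by rewrite lerBlDr -lerBlDl (le_trans _ (expR_ge1Dx _)).
have phi_decay N : exists2 C, 0 <= C &
    forall y, `|fourier (phi nu) 0 y| * bracket y ^+ N <= C.
  have one_phi : (fun u : Rd => 1 * phi nu u) = phi nu by apply/funext => u; rewrite mul1r.
  have [|C C0 hC] := @fourier_decay _ _ _ _ alpha0 near psi_low (fun=> 1) N
    (fun i => tame_cst nu i 1) _ (measurable_cst _).
    by rewrite one_phi; exact: (rapid_phi alpha0 psi_low).
  by rewrite one_phi in hC; exists C => // y; exact: hC.
have inv := fourier_inversion mp p0 Pp cp mch rapid_ch P_cos P_sin
  (measurable_phi near) (rapid_phi alpha0 psi_low) phi_near1 phi_decay.
set k := \int[leb]_x _ in inv *.
(* Inversion at y = 0 equates p(0) k with the nonzero value of the transform at the origin. *)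
have k0 : k != 0.
  apply/eqP => k0; have := inv 0; rewrite k0 mulr0 => /esym/eqP.
  by rewrite (negbTE fourier_stable_char0_neq0).
apply/funext => y; apply: (mulIf k0); rewrite inv /fourier.
have iy := integrable_fourier 0 y (rapid_integrable mch rapid_ch).
rewrite mulrC -(RintegralZl k measurableT).
  by apply: eq_Rintegral => u _; field.
have := integrableZl measurableT k^-1 iy.
by apply: eq_integrable => // u _ /=; rewrite -EFinM mulrA.
Qed.

End stable_density.

Theorem lemma2 (R : realType) (d : nat) (hd : (2 <= d)%N)
    (alpha : R) (halpha : 0 < alpha < 2)
    (mu : {finite_measure set 'rV[R]_d -> \bar R})
    (hmu : is_spectral_measure mu)
    (gamma : R) (hgamma : is_gamma_measure (levy_measure alpha mu) gamma)
    (beta : 'I_d -> nat) :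
  exists c : R,
    forall (P : R -> probability 'rV[R]_d R) (p1 : 'rV[R]_d -> R),
      is_stable_semigroup (levy_measure alpha mu) P ->
      is_density (P 1) p1 -> smooth p1 ->
      forall y : 'rV[R]_d,
        `|mderiv beta p1 y| <= c * (1 + enorm y) `^ (- alpha - gamma).
Proof.
have /andP[alpha0 _] := halpha.
pose nu : {measure set 'rV[R]_d -> \bar R} := levy_measure alpha mu.
have scale (s : R) (D : set 'rV[R]_d) : 0 < s -> measurable D ->
  nu ((fun y => s *: y) @^-1` D) = ((s `^ alpha)%:E * nu D)%E.
  exact: levy_measure_scale.
have shell1 : @shell R d 1 = [set y | (1 <= enorm y < 2)%R] by rewrite /shell mul1r.
have shell_lty : (nu (@shell R d 1) < +oo)%E.
  by rewrite shell1; exact: levy_measure_shell_lty.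
have shell_gt0 v : v != 0 ->
    (0 < nu (@shell R d 1 `&` [set y | (dotv v y != 0)%R]))%E.
  by move=> v0; rewrite shell1; exact: (levy_measure_shell_gt0 hmu alpha0 v0).
have near := nu_near_integrable halpha scale shell_lty.
have psi_low := psi_lower halpha scale shell_lty shell_gt0.
have mfar : measurable (~` @uball R d) := measurableC (@measurable_uball R d).
pose far : {finite_measure set 'rV[R]_d -> \bar R} :=
  mfrestr mfar (nu_far_lty halpha scale shell_lty).
have farE A : far A = nu (A `&` ~` @uball R d) by [].
have [c c0 nu_ball] := nu_eball scale hgamma.
have far_ball (y : 'rV[R]_d) (r : R) : 0 < r < enorm y / 2 ->
    (far (eball y r) <= (c * enorm y `^ (- alpha - gamma) * r `^ gamma)%:E)%E.
  move=> hr; apply: le_trans (nu_ball y r hr).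
  have mB : measurable (eball y r) := measurable_eball y r.
  rewrite farE.
  exact: (le_measure nu (mem_set (measurableI _ _ mB mfar)) (mem_set mB)
    (@subIsetl _ _ _)).
have i0 : 'I_d := Ordinal (ltnW hd).
(* The initial amplitude is the inverse of the inversion constant, which depends on [nu] alone.
   Hence the amplitude [b], the phase [s] and the bound [C] are all fixed before the semigroup and
   its density are introduced. *)
have [b [s [tb hb]]] := mderiv_fourier_stable_char i0 far alpha0 near psi_low beta
  (fun i => tame_cst nu i (\int[lebesgue_measure_rV R d]_x fourier (phi nu) 0 x)^-1).
have [C hC] := fourier_stable_char_le i0 alpha0 near psi_low c0 far_ball tb.
exists C => P p [_ chP] densp smp y.
have chE u : char_fun (P 1) u = (stable_char nu far u)%:C%C.
  rewrite (chP 1 u ltr01).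
  rewrite (levy_exponentE (integrable_one_minus_cos halpha scale shell_lty)
    (fun A _ => farE A)).
  rewrite /stable_char /phi -!expRD; congr (expR _)%:C%C.
  by ring.
have [cp _] := smp [::].
rewrite (density_fourier alpha0 near psi_low densp cp chE) hb.
exact: hC.
Qed.
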